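(* Let $a,b>0$ and $g\in L^2(\mathbb{R})$ be such that $(g,a,b)$ is a Gabor frame for $L^2(\mathbb{R})$ with optimal frame bounds $A,B$ and canonical tight window $h^0=S^{-1/2}g$, where $S$ is the frame operator of $(g,a,b)$. Set $g_0=g$ and define $$g_k=\frac12\left(\frac{g_{k-1}}{\|g_{k-1}\|}+\frac{\gamma^0_{k-1}}{\|\gamma^0_{k-1}\|}\right),\qquad k=1,2,\dots,$$ where $\gamma^0_{k-1}=S_{k-1}^{-1}g_{k-1}$ is the canonical dual window of the frame $(g_{k-1},a,b)$ and $S_{k-1}$ is the frame operator of $(g_{k-1},a,b)$. Then $g_k$ converges quadratically to $\frac{1}{\sqrt{ab}}\,h^0$ in $L^2(\mathbb{R})$.
   Context: For $g\in L^2(\mathbb{R})$ write $g_{na,mb}(t)=e^{2\pi i mbt}g(t-na)$, $n,m\in\mathbb{Z}$. The triple $(g,a,b)$ is a Gabor frame for $L^2(\mathbb{R})$ with frame bounds $A,B>0$ if $A\|f\|^2\le\sum_{n,m\in\mathbb{Z}}|\langle f,g_{na,mb}\rangle|^2\le B\|f\|^2$ for all $f\in L^2(\mathbb{R})$; the optimal frame bounds are the largest such $A$ and the smallest such $B$. Its frame operator is $Sf=\sum_{n,m}\langle f,g_{na,mb}\rangle g_{na,mb}$, which is bounded, self-adjoint and satisfies $AI\le S\le BI$. The norm $\|\cdot\|$ is that of $L^2(\mathbb{R})$. That the iteration is well defined (each $(g_k,a,b)$ is again a Gabor frame) is understood as part of the assertion. ''Converges quadratically to $u$'' means: there are a constant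 $C<\infty$ and a sequence $\varepsilon_k\ge 0$ with $\varepsilon_k\to0$ and $\varepsilon_{k+1}\le C\varepsilon_k^2$ such that $\|g_k-u\|\le\varepsilon_k$ for all $k$. *)

(* Defs.v *)
From mathcomp Require Import all_boot all_order all_algebra finmap.
From mathcomp Require Import complex.
From mathcomp Require Import all_classical all_reals all_analysis.

Set Implicit Arguments.
Unset Strict Implicit.
Unset Printing Implicit Defensive.

Import Order.TTheory GRing.Theory Num.Theory.
Import numFieldNormedType.Exports.

Local Open Scope classical_set_scope.
Local Open Scope complex_scope.
Local Open Scope ring_scope.

(* Elements of L^2 are represented by genuine functions [f : R -> R[i]]
   satisfying [L2 f]; equality in L^2 is equality Lebesgue-almost everywhere.
   Functions are Borel measurable, which loses no L^2 class. *)
Section L2.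
Variable R : realType.
Implicit Types (f g h : R -> R[i]) (S T : (R -> R[i]) -> (R -> R[i])).

Local Notation mu := (@lebesgue_measure R).

Definition L2norm f : \bar R :=
  Lnorm mu 2%:E (fun t => (Normc.normc (f t))%:E).

Definition L2 f : Prop :=
  [/\ measurable_fun [set: measurableTypeR R] (fun t => complex.Re (f t)),
      measurable_fun [set: measurableTypeR R] (fun t => complex.Im (f t)) &
      (L2norm f < +oo)%E].

Definition ae_equal f g : Prop := f = g %[ae mu].

Definition inner f g : R[i] :=
  (Rintegral mu setT (fun t => complex.Re (f t * (g t)^*)))
  +i* (Rintegral mu setT (fun t => complex.Im (f t * (g t)^*))).

Definition bounded_operator T : Prop :=
  [/\ forall f, L2 f -> L2 (T f),
      forall (c : R[i]) f g, L2 f -> L2 g ->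
        ae_equal (T (fun t => c * f t + g t)) (fun t => c * T f t + T g t) &
      exists M : R, forall f, L2 f -> (L2norm (T f) <= M%:E * L2norm f)%E].

Definition positive_operator T : Prop :=
  forall f, L2 f -> 0 <= inner (T f) f.

Definition is_inverse S T : Prop :=
  bounded_operator T /\
  forall f, L2 f -> ae_equal (S (T f)) f /\ ae_equal (T (S f)) f.

Definition is_positive_sqrt S T : Prop :=
  [/\ bounded_operator T, positive_operator T &
      forall f, L2 f -> ae_equal (T (T f)) (S f)].

(* [xget] picks a witness of the defining property, and returns its first
   argument when there is none; each choice is unique up to a.e. equality. *)
Definition op_inv S : (R -> R[i]) -> (R -> R[i]) :=
  xget (idfun : (R -> R[i]) -> (R -> R[i])) [set T | is_inverse S T].

Definition op_sqrt S : (R -> R[i]) -> (R -> R[i]) :=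
  xget (idfun : (R -> R[i]) -> (R -> R[i])) [set T | is_positive_sqrt S T].

Definition converges_quadratically (u : nat -> (R -> R[i])) (v : R -> R[i]) :
    Prop :=
  exists (C : R) (eps : nat -> R),
    [/\ forall k, 0 <= eps k,
        eps @ \oo --> (0 : R),
        forall k, eps k.+1 <= C * eps k ^+ 2 &
        forall k, (L2norm (fun t => (u k t - v t)%R) <= (eps k)%:E)%E].

End L2.

Section Gabor.
Variable R : realType.
Implicit Types (a b A B : R) (f g h : R -> R[i]).

Definition modulated_shift g a b (n m : int) : R -> R[i] := fun t =>
  let theta := 2 * pi * (m%:~R * b) * t in
  (cos theta +i* sin theta) * g (t - n%:~R * a).

Definition coef g a b f (p : int * int) : R[i] :=
  inner f (modulated_shift g a b p.1 p.2).

Definition frame_energy g a b f : \bar R :=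
  \esum_(p in [set: int * int]) ((Normc.normc (coef g a b f p) ^+ 2)%:E).

Definition frame_bounds g a b A B : Prop :=
  [/\ 0 < A, 0 < B & forall f, L2 f ->
    (A%:E * L2norm f ^+ 2 <= frame_energy g a b f)%E /\
    (frame_energy g a b f <= B%:E * L2norm f ^+ 2)%E].

Definition gabor_frame g a b : Prop :=
  L2 g /\ exists A B, frame_bounds g a b A B.

Definition optimal_frame_bounds g a b A B : Prop :=
  frame_bounds g a b A B /\
  forall A' B', frame_bounds g a b A' B' -> A' <= A /\ B <= B'.

(* The double series converges unconditionally in L^2, i.e. along the net of
   finite subsets of [int * int]. *)
Definition is_frame_series g a b f h : Prop :=
  L2 h /\
  forall e : R, 0 < e -> exists F0 : {fset int * int},
    forall F : {fset int * int}, (F0 `<=` F)%fset ->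
      (L2norm (fun t => (h t -
         \sum_(p <- F) coef g a b f p * modulated_shift g a b p.1 p.2 t)%R)
       < e%:E)%E.

Definition frame_operator g a b f : R -> R[i] :=
  xget (fun=> 0) [set h | is_frame_series g a b f h].

Definition dual_window g a b : R -> R[i] :=
  op_inv (frame_operator g a b) g.

Definition tight_window g a b : R -> R[i] :=
  op_sqrt (op_inv (frame_operator g a b)) g.

Definition normalize f : R -> R[i] := fun t => f t / (fine (L2norm f))%:C.

Fixpoint window_iter g a b (k : nat) : R -> R[i] :=
  if k is k'.+1 then
    let gk := window_iter g a b k' in
    fun t => 2^-1 * (normalize gk t + normalize (dual_window gk a b) t)
  else g.

End Gabor.

(* Main.v *)
(* The canonical tight window h = S^(-1/2) g satisfies the Parseval identity for
   its time-frequency shifts, and every window of the iteration is g_k = Z_k h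
   for a positive invertible operator Z_k commuting with these shifts: then
   Z_k^2 is the frame operator of g_k, and its canonical dual window is
   Z_k^(-1) h. One step therefore replaces Z by (alpha Z + beta Z^(-1)) / 2 with
   alpha = 1/|Z h| and beta = 1/|Z^(-1) h|, a normalized Newton step for the
   square root of the identity. If the spectrum of Z lies in [m, M] and
   kappa = M/m, the new spectrum lies in an interval with ratio of end points
   (kappa + 1/kappa)/2, so kappa_k - 1 tends to 0 quadratically, and
   |g_{k+1} - h/|h|| <= kappa_k - 1. Finally |h|^2 = ab: the Parseval identity
   tested on indicators of intervals of length at most 1/b yields it through
   Fourier's Parseval identity. *)
Require Import Defs.
From HB Require Import structures.
From mathcomp Require Import all_boot all_order all_algebra finmap.
From mathcomp Require Import complex ring lra.
From mathcomp Require Import all_classical all_reals all_analysis.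
From mathcomp Require Import measurable_realfun.

Set Implicit Arguments.
Unset Strict Implicit.
Unset Printing Implicit Defensive.

Import Order.TTheory GRing.Theory Num.Theory.
Import numFieldNormedType.Exports.

Local Open Scope classical_set_scope.
Local Open Scope complex_scope.
Local Open Scope ring_scope.

(** * Hilbert spaces *)

(** Spectra never occur in the proof: a spectrum in [m, M] is expressed by form bounds
    [m |x|^2 <= <Z x, x> <= M |x|^2] for symmetric Z, and scalar inequalities on [m, M] become
    positivity of products such as (M - Z)(Z - m)Z. The interval shrinks for this reason: with p =
    |Z h| and q = |Z^(-1) h| the step sends z to rho (tau z + 1/(tau z)) / 2, where tau^2 = q/p and
    rho^2 = 1/(pq). The normalization puts 1/tau inside [m, M], so tau z stays in [1/kappa, kappa];
    the arithmetic-geometric mean inequality gives the lower end point rho, and y + 1/y is largest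
    on that interval at its two ends. The same rho satisfies 1/kappa <= rho |h| <= 1, which ties the
    scale of the new operator to 1/|h|. A second obstacle is that inverse, square root and frame
    operator are chosen among maps on functions, only up to almost everywhere equality; the algebra
    is done in the quotient, where each of them is shown to be unique. The value of |h| is obtained
    for all a and b at once, by cutting the period a into pieces of length at most 1/b. *)

Section ComplexModulus.
Variable R : realType.
Implicit Types (z w : R[i]) (x : R).

Local Notation normc := Normc.normc.

Lemma normc_ge0 z : 0 <= normc z.
Proof. by case: z => a b; exact: sqrtr_ge0. Qed.

Lemma normc_sqr z : normc z ^+ 2 = complex.Re z ^+ 2 + complex.Im z ^+ 2.
Proof. by case: z => a b /=; rewrite sqr_sqrtr// addr_ge0 ?sqr_ge0. Qed.

Lemma mulcJ z : z * z^*%C = (normc z ^+ 2)%:C.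
Proof.
by rewrite normc_sqr; case: z => a b; simpc; congr (_ +i* _); ring.
Qed.

Lemma normcD z w : normc (z + w) <= normc z + normc w.
Proof. exact: (@le_normcD R). Qed.

Lemma normcJ z : normc z^*%C = normc z.
Proof. by case: z => a b /=; rewrite sqrrN. Qed.

Lemma normc_real x : normc x%:C = `|x|.
Proof. by rewrite /= expr0n addr0 sqrtr_sqr. Qed.

Lemma conjcR x : (x%:C)^*%C = x%:C.
Proof. by rewrite /= oppr0. Qed.

Lemma Re_le_normc z : `|complex.Re z| <= normc z.
Proof.
by case: z => a b /=; rewrite -sqrtr_sqr ler_wsqrtr// lerDl sqr_ge0.
Qed.

Lemma ReD z w : complex.Re (z + w) = complex.Re z + complex.Re w.
Proof. by case: z; case: w. Qed.

Lemma ReN z : complex.Re (- z) = - complex.Re z.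
Proof. by case: z. Qed.

Lemma ReB z w : complex.Re (z - w) = complex.Re z - complex.Re w.
Proof. by rewrite ReD ReN. Qed.

Lemma ReZ x z : complex.Re (x%:C * z) = x * complex.Re z.
Proof. by case: z => a b /=; rewrite mul0r subr0. Qed.

Lemma ReJ z : complex.Re z^*%C = complex.Re z.
Proof. by case: z. Qed.

Lemma Re_sum (I : Type) (s : seq I) (F : I -> R[i]) :
  complex.Re (\sum_(i <- s) F i) = \sum_(i <- s) complex.Re (F i).
Proof. by elim: s => [|i s IH]; rewrite ?big_nil// !big_cons ReD IH. Qed.

End ComplexModulus.

(** Completeness is phrased with the squared norm because the norm is itself defined from [dot].
    Working over this structure keeps representatives of classes out of the operator theory. *)
Record hilbertSpace (R : realType) := HilbertSpace {
  hilbert_sort :> lmodType R[i];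
  dot : hilbert_sort -> hilbert_sort -> R[i];
  dot_linear : forall (c : R[i]) x y z, dot (c *: x + y) z = c * dot x z + dot y z;
  dotC : forall x y, dot y x = (dot x y)^*%C;
  dot_gt0 : forall x, x != 0 -> 0 < dot x x;
  hilbert_complete : forall u : nat -> hilbert_sort,
    (forall e : R, 0 < e -> exists k, forall m n, (k <= m)%N -> (k <= n)%N ->
       complex.Re (dot (u m - u n) (u m - u n)) < e) ->
    exists l, forall e : R, 0 < e -> exists k, forall n, (k <= n)%N ->
       complex.Re (dot (u n - l) (u n - l)) < e }.
Arguments dot {R h}.

Section Hilbert.
Variables (R : realType) (H : hilbertSpace R).
Implicit Types (x y z : H) (c : R[i]) (r : R).

Local Notation normc := Normc.normc.

Lemma dotDl x y z : dot (x + y) z = dot x z + dot y z.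
Proof. by have := dot_linear 1 x y z; rewrite scale1r mul1r. Qed.

Lemma dot0l z : dot 0 z = 0 :> R[i].
Proof. by apply: (addrI (dot 0 z)); rewrite -dotDl !addr0. Qed.

Lemma dotZl c x z : dot (c *: x) z = c * dot x z.
Proof. by rewrite -[c *: x]addr0 dot_linear dot0l addr0. Qed.

Lemma dotNl x z : dot (- x) z = - dot x z.
Proof. by rewrite -scaleN1r dotZl mulN1r. Qed.

Lemma dotBl x y z : dot (x - y) z = dot x z - dot y z.
Proof. by rewrite dotDl dotNl. Qed.

Lemma dotDr x y z : dot z (x + y) = dot z x + dot z y.
Proof. by rewrite dotC dotDl rmorphD/= -!dotC. Qed.

Lemma dot0r z : dot z 0 = 0 :> R[i].
Proof. by rewrite dotC dot0l rmorph0. Qed.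

Lemma dotZr c x z : dot z (c *: x) = c^*%C * dot z x.
Proof. by rewrite dotC dotZl rmorphM/= -dotC. Qed.

Lemma dotNr x z : dot z (- x) = - dot z x.
Proof. by rewrite dotC dotNl rmorphN/= -dotC. Qed.

Lemma dotBr x y z : dot z (x - y) = dot z x - dot z y.
Proof. by rewrite dotDr dotNr. Qed.

Lemma dot_suml (I : Type) (s : seq I) (F : I -> H) z :
  dot (\sum_(i <- s) F i) z = \sum_(i <- s) dot (F i) z.
Proof. by elim: s => [|i s IH]; rewrite ?big_nil ?dot0l// !big_cons dotDl IH. Qed.

Lemma dot_sumr (I : Type) (s : seq I) (F : I -> H) z :
  dot z (\sum_(i <- s) F i) = \sum_(i <- s) dot z (F i).
Proof. by elim: s => [|i s IH]; rewrite ?big_nil ?dot0r// !big_cons dotDr IH. Qed.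

Definition sqnorm x : R := complex.Re (dot x x).
Definition hnorm x : R := Num.sqrt (sqnorm x).

Lemma dotxx x : dot x x = (sqnorm x)%:C.
Proof.
have := dotC x x; rewrite /sqnorm; case: (dot x x) => a b /= [/eqP].
by rewrite -addr_eq0 -mulr2n mulrn_eq0/= => /eqP ->.
Qed.

Lemma sqnorm_gt0 x : x != 0 -> 0 < sqnorm x.
Proof. by move=> /dot_gt0; rewrite dotxx ltcR. Qed.

Lemma sqnorm0 : sqnorm 0 = 0.
Proof. by rewrite /sqnorm dot0l. Qed.

Lemma sqnorm_ge0 x : 0 <= sqnorm x.
Proof. by have [->|/sqnorm_gt0/ltW//] := eqVneq x 0; rewrite sqnorm0. Qed.

Lemma sqnorm_eq0 x : (sqnorm x == 0) = (x == 0).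
Proof.
have [->|x0] := eqVneq x 0; first by rewrite sqnorm0 eqxx.
by rewrite gt_eqF// sqnorm_gt0.
Qed.

Lemma hnorm_ge0 x : 0 <= hnorm x. Proof. exact: sqrtr_ge0. Qed.

Lemma hnorm_sqr x : hnorm x ^+ 2 = sqnorm x.
Proof. by rewrite sqr_sqrtr// sqnorm_ge0. Qed.

Lemma hnorm_eq0 x : (hnorm x == 0) = (x == 0).
Proof. by rewrite -sqnorm_eq0 -hnorm_sqr sqrf_eq0. Qed.

Lemma hnorm0 : hnorm 0 = 0. Proof. by apply/eqP; rewrite hnorm_eq0. Qed.

Lemma hnorm_gt0 x : (0 < hnorm x) = (x != 0).
Proof. by rewrite lt_def hnorm_ge0 hnorm_eq0 andbT. Qed.

Lemma sqnormZ c x : sqnorm (c *: x) = normc c ^+ 2 * sqnorm x.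
Proof.
by rewrite /sqnorm dotZl dotZr mulrA mulcJ ReZ.
Qed.

Lemma hnormZ c x : hnorm (c *: x) = normc c * hnorm x.
Proof. by rewrite /hnorm sqnormZ sqrtrM ?sqr_ge0// sqrtr_sqr ger0_norm ?normc_ge0. Qed.

Lemma hnormZr r x : hnorm (r%:C *: x) = `|r| * hnorm x.
Proof. by rewrite hnormZ normc_real. Qed.

Lemma sqnormN x : sqnorm (- x) = sqnorm x.
Proof. by rewrite /sqnorm dotNl dotNr opprK. Qed.

Lemma hnormN x : hnorm (- x) = hnorm x.
Proof. by rewrite /hnorm sqnormN. Qed.

Lemma hnormBC x y : hnorm (x - y) = hnorm (y - x).
Proof. by rewrite -opprB hnormN. Qed.

Lemma sqnormD x y :
  sqnorm (x + y) = sqnorm x + sqnorm y + 2 * complex.Re (dot x y).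
Proof.
rewrite /sqnorm dotDl !dotDr !ReD (dotC x y) ReJ.
ring.
Qed.

Lemma sqnormB x y :
  sqnorm (x - y) = sqnorm x + sqnorm y - 2 * complex.Re (dot x y).
Proof. by rewrite sqnormD sqnormN dotNr ReN mulrN. Qed.

(** Cauchy-Schwarz: expand the squared norm of [|y|^2 x - <x, y> y] and cancel one factor
    [|y|^2]. *)
Lemma normc_dot_sqr x y : normc (dot x y) ^+ 2 <= sqnorm x * sqnorm y.
Proof.
have [->|y0] := eqVneq y 0.
  by rewrite dot0r sqnorm0 mulr0 Normc.normc0 expr0n.
have Ny := sqnorm_gt0 y0.
have := sqnorm_ge0 ((sqnorm y)%:C *: x - dot x y *: y).
suff -> : sqnorm ((sqnorm y)%:C *: x - dot x y *: y) =
    sqnorm y * (sqnorm x * sqnorm y - normc (dot x y) ^+ 2).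
  by rewrite pmulr_rge0// subr_ge0.
apply: complexI; rewrite -[LHS]dotxx dotBl !dotBr !dotZl !dotZr !dotxx.
rewrite (dotC x y) conjc_real rmorphM rmorphB rmorphM/= -mulcJ; ring.
Qed.

Lemma normc_dot x y : normc (dot x y) <= hnorm x * hnorm y.
Proof.
rewrite -(@ler_pXn2r _ 2)// ?nnegrE ?mulr_ge0 ?normc_ge0 ?hnorm_ge0//.
by rewrite exprMn !hnorm_sqr normc_dot_sqr.
Qed.

Lemma Re_dot_le x y : complex.Re (dot x y) <= hnorm x * hnorm y.
Proof. by rewrite (le_trans (ler_norm _))// (le_trans (Re_le_normc _))// normc_dot. Qed.

Lemma hnormD x y : hnorm (x + y) <= hnorm x + hnorm y.
Proof.
rewrite -(@ler_pXn2r _ 2)// ?nnegrE ?addr_ge0 ?hnorm_ge0//.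
rewrite hnorm_sqr sqnormD sqrrD !hnorm_sqr; have := Re_dot_le x y; lra.
Qed.

Lemma hnormB x y : hnorm (x - y) <= hnorm x + hnorm y.
Proof. by rewrite (le_trans (hnormD _ _))// hnormN. Qed.

Lemma hnorm_triangle y x z : hnorm (x - z) <= hnorm (x - y) + hnorm (y - z).
Proof. by rewrite -[x - z](subrKA y) hnormD. Qed.

Lemma hnorm_small_eq x y : (forall e : R, 0 < e -> hnorm (x - y) < e) -> x = y.
Proof.
move=> small; apply/eqP; rewrite -subr_eq0 -hnorm_eq0 eq_le hnorm_ge0 andbT.
by apply/ler_addgt0Pr => e e0; rewrite add0r ltW// small.
Qed.

Lemma geometric_cauchy_cvg (u : nat -> H) (C q : R) : 0 <= q < 1 ->
  (forall n, hnorm (u n.+1 - u n) <= C * q ^+ n) ->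
  exists l, forall n, hnorm (l - u n) <= C / (1 - q) * q ^+ n.
Proof.
move=> /andP[q0 q1] uq.
have C0 : 0 <= C.
  by have := uq 0; rewrite expr0 mulr1; apply: le_trans; exact: hnorm_ge0.
have q1' : 0 < 1 - q by rewrite subr_gt0.
set D := C / (1 - q); have D0 : 0 <= D by rewrite divr_ge0// ltW.
have step n p : hnorm (u (n + p)%N - u n) <= D * q ^+ n.
  (* The exact partial geometric sum, and not its bound [D * q ^+ n], is what the induction on [p]
     reproduces. *)
  have : hnorm (u (n + p)%N - u n) <= D * (q ^+ n - q ^+ (n + p)).
    elim: p => [|p IH]; first by rewrite addn0 !subrr hnorm0 mulr0.
    rewrite addnS (le_trans (hnorm_triangle (u (n + p)%N) _ _))//.
    rewrite (le_trans (lerD (uq _) IH))// exprS /D -subr_ge0.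
    rewrite [leRHS](_ : _ = 0)//; field; exact: lt0r_neq0.
  move=> /le_trans; apply; rewrite ler_wpM2l// gerBl exprn_ge0//.
have qlim (e : R) : 0 < e -> exists k, forall n, (k <= n)%N -> D * q ^+ n < e.
  move=> e0.
  have : (fun n => q ^+ n : R) @ \oo --> (0 : R) by apply: cvg_expr; rewrite ger0_norm.
  move=> /cvgrPdist_lt /(_ (e / (D + 1))) [|k _ kP].
    by rewrite divr_gt0// ltr_pwDr.
  exists k => n /kP; rewrite sub0r normrN ger0_norm ?exprn_ge0// => qe.
  apply: (@le_lt_trans _ _ ((D + 1) * q ^+ n)).
    by rewrite ler_wpM2r ?exprn_ge0// lerDl.
  by rewrite mulrC -ltr_pdivlMr// ltr_pwDr.
have [|l lP] := @hilbert_complete _ H u.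
  move=> e e0; have [|k kP] := qlim (Num.sqrt e); first by rewrite sqrtr_gt0.
  exists k.
  have main m n : (k <= m)%N -> (m <= n)%N -> sqnorm (u n - u m) < e.
    move=> km mn; rewrite -hnorm_sqr -(sqr_sqrtr (ltW e0)).
    rewrite ltr_pXn2r// ?nnegrE ?hnorm_ge0 ?sqrtr_ge0//.
    by rewrite -(subnKC mn) (le_lt_trans (step _ _))// kP.
  move=> m n km kn; have [mn|/ltnW nm] := leqP m n.
    by rewrite -[_ - _]opprB -/(sqnorm _) sqnormN main.
  exact: main.
exists l => n; apply/ler_addgt0Pr => e e0.
have [|k kP] := lP (e ^+ 2); first by rewrite exprn_gt0.
rewrite (le_trans (hnorm_triangle (u (n + k)%N) _ _))// addrC lerD ?step//.
rewrite hnormBC -(@ler_pXn2r _ 2)// ?nnegrE ?hnorm_ge0// ?(ltW e0)//.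
by rewrite hnorm_sqr ltW// kP// leq_addl.
Qed.

End Hilbert.

(** * Bounded self-adjoint operators *)

Section Operators.
Variables (R : realType) (H : hilbertSpace R).
Implicit Types (x y z : H) (c : R[i]) (r m M q : R) (T S Z V X : {linear H -> H}).

Definition symmetric_op (T : H -> H) := forall x y, dot (T x) y = dot x (T y).
Definition op_bounded_by M (T : H -> H) := forall x, hnorm (T x) <= M * hnorm x.
Definition op_between m M (T : H -> H) := forall x,
  m * sqnorm x <= complex.Re (dot (T x) x) <= M * sqnorm x.

(** Limits of operators are first built pointwise by choice; this turns them into elements of
    [{linear H -> H}]. *)
Lemma exists_linear (f : H -> H) :
  (forall c x y, f (c *: x + y) = c *: f x + f y) ->
  exists F : {linear H -> H}, forall x, F x = f x.
Proof.
move=> lf.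
pose F : {linear H -> H} := HB.pack f (GRing.isLinear.Build R[i] H H _ f lf).
by exists F.
Qed.

Lemma between_bounded_below m M T x : op_between m M T ->
  m * hnorm x <= hnorm (T x).
Proof.
move=> /(_ x)/andP[+ _].
have [->|x0] := eqVneq x 0; first by rewrite hnorm0 mulr0 hnorm_ge0.
move=> /le_trans/(_ (Re_dot_le _ _)); rewrite -hnorm_sqr expr2 mulrA.
by rewrite ler_pM2r// hnorm_gt0.
Qed.

(* This is <(M - T)(T - m)x, x> >= 0; writing P = M - T and Q = T - m, it
   follows from (P + Q) PQ = PQP + QPQ, because P + Q is a positive scalar. *)
Lemma between_quadratic m M T x : symmetric_op T -> op_between m M T -> m < M ->
  sqnorm (T x) + m * M * sqnorm x <= (m + M) * complex.Re (dot (T x) x).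
Proof.
move=> sT bT mM.
have /andP[+ _] := bT (M%:C *: x - T x).
have /andP[_ +] := bT (T x - m%:C *: x).
rewrite ![T (_ - _)]linearB ![T (_ *: _)]linearZ/= /sqnorm.
rewrite !(dotBl, dotBr, dotZl, dotZr, conjcR, ReB, ReZ) -!sT.
set a := complex.Re (dot x x); set b := complex.Re (dot (T x) x).
set c := complex.Re (dot (T (T x)) x); set d := complex.Re (dot (T (T (T x))) x).
move=> h1 h2; have h3 : 0 < M - m by rewrite subr_gt0.
rewrite -(ler_pM2l h3). nra.
Qed.

(** This is (M - T)(T - m)T >= 0, split as (M - T)(T - m)^2 + m (M - T)(T - m): the first summand is
    the upper form bound tested at [T x - m x], the second is the quadratic inequality. At
    [x = Z^(-1) y] it will bound a combination of Z and Z^(-1). *)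
Lemma between_cubic m M T x : symmetric_op T -> op_between m M T -> 0 <= m < M ->
  complex.Re (dot (T (T x)) (T x)) + m * M * complex.Re (dot (T x) x) <=
  (m + M) * sqnorm (T x).
Proof.
move=> sT bT /andP[m0 mM].
have /(ler_wpM2l m0) := between_quadratic x sT bT mM.
have /andP[_ +] := bT (T x - m%:C *: x).
rewrite ![T (_ - _)]linearB ![T (_ *: _)]linearZ/= /sqnorm.
rewrite !(dotBl, dotBr, dotZl, dotZr, conjcR, ReB, ReZ) -!sT.
set a := complex.Re (dot x x); set b := complex.Re (dot (T x) x).
set c := complex.Re (dot (T (T x)) x); set d := complex.Re (dot (T (T (T x))) x).
move=> h1 h2; nra.
Qed.

(** The end points [- q] and [q] add up to zero, so the quadratic inequality loses its middle term
    and reads |T x|^2 <= q^2 |x|^2. *)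
Lemma between_bounded q T : 0 < q -> symmetric_op T -> op_between (- q) q T ->
  op_bounded_by q T.
Proof.
move=> q0 sT bT x.
have := between_quadratic x sT bT ltac:(by rewrite (lt_trans _ q0)// oppr_lt0).
rewrite addNr mul0r mulNr addrC mulNr -expr2 addrC subr_le0 -!hnorm_sqr -exprMn.
by rewrite ler_pXn2r// nnegrE ?hnorm_ge0// mulr_ge0 ?hnorm_ge0// ltW.
Qed.

(** Serves both the Neumann series and the square root. The explicit rate lets identities pass to
    the limit through [geometric_eq]. *)
Lemma operator_limit (Y : nat -> {linear H -> H}) (C q : R) : 0 <= q < 1 ->
  (forall n x, hnorm (Y n.+1 x - Y n x) <= C * q ^+ n * hnorm x) ->
  exists L : {linear H -> H},
    forall n x, hnorm (L x - Y n x) <= C / (1 - q) * q ^+ n * hnorm x.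
Proof.
move=> q01 Yq.
have /choice[f fP] : forall x, exists l, forall n,
    hnorm (l - Y n x) <= C / (1 - q) * q ^+ n * hnorm x.
  move=> x; have [n|l lP] := @geometric_cauchy_cvg R H (Y ^~ x) (C * hnorm x) q q01.
    by rewrite mulrAC; exact: Yq.
  exists l => n; rewrite (le_trans (lP n))// le_eqVlt; apply/orP; left; apply/eqP.
  by set d := (1 - q)^-1; ring.
suff [L LP] : exists L : {linear H -> H}, forall x, L x = f x.
  by exists L => n x; rewrite LP.
apply: exists_linear => c x y; apply: hnorm_small_eq => e e0.
set D := C / (1 - q) in fP *.
set K := D * (hnorm (c *: x + y) + (Normc.normc c * hnorm x + hnorm y)).
have bound n : hnorm (f (c *: x + y) - (c *: f x + f y)) <= K * q ^+ n.
  rewrite (le_trans (hnorm_triangle (Y n (c *: x + y)) _ _))//.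
  rewrite /K mulrDr mulrDl lerD//; first by rewrite mulrAC fP.
  rewrite linearD linearZ opprD addrACA -scalerBr (le_trans (hnormD _ _))//.
  rewrite hnormZ mulrDr mulrDl hnormBC (hnormBC _ (f y)) lerD//.
    rewrite mulrCA -mulrA ler_wpM2l ?normc_ge0// mulrAC; exact: fP.
  by rewrite mulrAC fP.
have : (fun n => q ^+ n : R) @ \oo --> (0 : R).
  by apply: cvg_expr; case/andP: q01 => q0 q1; rewrite ger0_norm.
have K1 : 0 < `|K| + 1 by rewrite ltr_wpDl.
move=> /cvgrPdist_lt /(_ (e / (`|K| + 1))) [|k _ /(_ k (leqnn k))].
  by rewrite divr_gt0.
rewrite sub0r normrN ltr_pdivlMr// => ke.
apply: le_lt_trans (bound k) (le_lt_trans _ ke).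
case/andP: q01 => q0 _.
rewrite ger0_norm ?exprn_ge0// mulrC ler_wpM2l ?exprn_ge0//.
by rewrite (le_trans (ler_norm K))// lerDl.
Qed.

Lemma geometric_small (C q e : R) : 0 <= q < 1 -> 0 < e -> exists n, C * q ^+ n < e.
Proof.
move=> /andP[q0 q1] e0.
have : (fun n => q ^+ n : R) @ \oo --> (0 : R) by apply: cvg_expr; rewrite ger0_norm.
have K1 : 0 < `|C| + 1 by rewrite ltr_wpDl.
move=> /cvgrPdist_lt /(_ (e / (`|C| + 1))) [|k _ /(_ k (leqnn k))].
  by rewrite divr_gt0.
rewrite sub0r normrN ltr_pdivlMr// ger0_norm ?exprn_ge0// => ke.
exists k; apply: le_lt_trans ke; rewrite mulrC ler_wpM2l ?exprn_ge0//.
by rewrite (le_trans (ler_norm C))// lerDl.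
Qed.

Lemma geometric_eq (C q : R) x y : 0 <= q < 1 ->
  (forall n, hnorm (x - y) <= C * q ^+ n) -> x = y.
Proof.
move=> q01 xy; apply: hnorm_small_eq => e e0.
by have [n nP] := geometric_small C q01 e0; exact: le_lt_trans (xy n) nP.
Qed.

End Operators.

(** * Neumann series and positive square roots *)

Section PositiveOperators.
Variables (R : realType) (H : hilbertSpace R).
Implicit Types (x y z : H) (c : R[i]) (r m M q A B : R) (T S Z V X : {linear H -> H}).

(** Neumann series: [V] is the limit of the partial sums of the powers of [X]. *)
Lemma contraction_inverse X q : 0 <= q < 1 -> op_bounded_by q X ->
  exists V, (forall x, V x - X (V x) = x) /\ (forall x, V (x - X x) = x).
Proof.
move=> /[dup] q01 /andP[q0 q1] Xq.
have powX n x : hnorm (iter n X x) <= q ^+ n * hnorm x.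
  elim: n => [|n IH]; first by rewrite expr0 mul1r.
  by rewrite iterS (le_trans (Xq _))// exprS -mulrA ler_wpM2l.
have iterD n x y : iter n X (x + y) = iter n X x + iter n X y.
  by elim: n => // n IH; rewrite !iterS IH linearD.
have iterL n c x y : \sum_(k < n) iter k X (c *: x + y) =
    c *: (\sum_(k < n) iter k X x) + \sum_(k < n) iter k X y.
  rewrite scaler_sumr -big_split/=; apply: eq_bigr => k _; rewrite iterD.
  by congr (_ + _); elim: (k : nat) => // j IH; rewrite !iterS IH linearZ.
have [Y YE] : exists Y : nat -> {linear H -> H},
    forall n x, Y n x = \sum_(k < n) iter k X x.
  have /choice[Y YE] := fun n => exists_linear (iterL n).
  by exists Y.
have [n x|V VP] := @operator_limit R H Y 1 q q01.
  by rewrite !YE big_ord_recr/= addrAC subrr add0r mul1r.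
have q1' : 0 < 1 - q by rewrite subr_gt0.
have Xinj y : X y = y -> y = 0.
  move=> Xy; apply/eqP; rewrite -hnorm_eq0 eq_le hnorm_ge0 andbT.
  have := Xq y; rewrite Xy -subr_le0 -{1}[hnorm y]mul1r -mulrBl pmulr_rle0//.
have VX x : V x - X (V x) = x.
  set D := 1 / (1 - q) in VP.
  apply: (@geometric_eq R H ((D + D) * hnorm x) q) => // n.
  have D0 : 0 <= D * hnorm x * q ^+ n.
    by rewrite !mulr_ge0 ?hnorm_ge0 ?exprn_ge0// invr_ge0 ltW.
  have -> : V x - X (V x) - x = (V x - Y n.+1 x) - X (V x - Y n x).
    have YSn : Y n.+1 x = x + X (Y n x).
      by rewrite !YE big_ord_recl/= linear_sum.
    by rewrite YSn [X (_ - _)]linearB opprB opprD !addrA subrK addrAC.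
  rewrite (le_trans (hnormB _ _))// mulrDl mulrDl lerD//.
    rewrite (le_trans (VP _ _))// [leLHS](_ : _ = q * (D * hnorm x * q ^+ n)).
      by rewrite ler_piMl// ltW.
    by rewrite exprS; ring.
  rewrite (le_trans (Xq _))// (le_trans (ler_wpM2l q0 (VP _ _)))//.
  by rewrite -/D [D * _ * _]mulrAC ler_piMl// ltW.
(* With [w = V (x - X x)], the identity just proved gives [w - X w = x - X x]; so [w - x] is fixed
   by the contraction [X] and vanishes. *)
exists V; split=> // x; apply/eqP; rewrite -subr_eq0; apply/eqP/Xinj.
have := VX (x - X x); set w := V _ => wE.
have -> : X (w - x) = X w - X x by rewrite linearB.
have -> : X w = w - (x - X x) by rewrite -wE opprB addrC subrK.
by rewrite opprB addrA addrAC addrK.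
Qed.

Lemma op_bounded_comp T S M M' : 0 <= M -> op_bounded_by M T ->
  op_bounded_by M' S -> op_bounded_by (M * M') (T \o S).
Proof.
by move=> M0 bT bS x; rewrite (le_trans (bT _))// -mulrA ler_wpM2l.
Qed.

(* [Y] is the limit of Y_0 = 0, Y_{n+1} = (X + Y_n^2) / 2, a contraction on
   the ball of radius 1 - sqrt(1 - q). *)
Lemma contraction_sqrt X q : 0 <= q < 1 -> symmetric_op X -> op_bounded_by q X ->
  exists Y : {linear H -> H}, exists r,
    [/\ 0 <= r < 1, op_bounded_by r Y, symmetric_op Y,
        forall x, Y x = 2^-1%:C *: (X x + Y (Y x)) &
        forall T M, 0 <= M -> op_bounded_by M T ->
          (forall x, T (X x) = X (T x)) -> forall x, T (Y x) = Y (T x)].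
Proof.
move=> /andP[q0 q1] sX Xq.
pose F (Y : {linear H -> H}) : {linear H -> H} :=
  (2^-1%:C \*: (X \+ (Y \o Y)))%R.
pose Y n := iter n F (\0 : {linear H -> H}).
(* [r] solves [2 r = q + r ^+ 2], so the bound [r] on the norm of [Y n] reproduces itself. *)
have [r [r0 r1 rq]] : exists r : R, [/\ 0 <= r, r < 1 & 2^-1 * (q + r ^+ 2) = r].
  exists (1 - Num.sqrt (1 - q)).
  have s0 : 0 < Num.sqrt (1 - q) by rewrite sqrtr_gt0 subr_gt0.
  have s2 : Num.sqrt (1 - q) ^+ 2 = 1 - q by rewrite sqr_sqrtr// subr_ge0 ltW.
  split; last by nra.
    by rewrite subr_ge0 -[leRHS]sqrtr1 ler_wsqrtr// gerBl.
  by rewrite gtrBl.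
have YS n x : Y n.+1 x = 2^-1%:C *: (X x + Y n (Y n x)) by [].
have h0 : 0 <= 2^-1 :> R by rewrite invr_ge0.
have Yr n : op_bounded_by r (Y n).
  elim: n => [|n IH] x; first by rewrite /= hnorm0 mulr_ge0 ?hnorm_ge0.
  rewrite YS hnormZr ger0_norm// -[in leRHS]rq -mulrA ler_wpM2l// mulrDl.
  rewrite (le_trans (hnormD _ _))// lerD//.
  by rewrite expr2 -mulrA (le_trans (IH _))// ler_wpM2l.
have Ysym n : symmetric_op (Y n).
  elim: n => [|n IH] x y; first by rewrite /= dot0l dot0r.
  by rewrite !YS dotZl dotZr conjcR dotDl dotDr sX !IH.
have Ydiff n x : hnorm (Y n.+1 x - Y n x) <= 1 * r ^+ n * hnorm x.
  rewrite mul1r; elim: n x => [|n IH] x.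
    rewrite expr0 mul1r subr0 YS/= addr0 hnormZr ger0_norm//.
    rewrite (le_trans (ler_wpM2l h0 (Xq _)))// mulrA ler_piMl ?hnorm_ge0//; lra.
  rewrite YS (YS n) -scalerBr opprD addrACA subrr add0r hnormZr ger0_norm//.
  (* The difference of the squares splits as [Y_(n+1) D + D Y_n] with [D = Y_(n+1) - Y_n]. Each
     summand is at most [r ^+ n.+1] in norm, and the factor 1/2 of the iteration absorbs their
     sum. *)
  rewrite (_ : _ - _ = Y n.+1 (Y n.+1 x - Y n x) + (Y n.+1 (Y n x) - Y n (Y n x))).
    have h1 : hnorm (Y n.+1 (Y n.+1 x - Y n x)) <= r ^+ n.+1 * hnorm x.
      by rewrite (le_trans (Yr _ _))// exprS -mulrA ler_wpM2l.
    have h2 : hnorm (Y n.+1 (Y n x) - Y n (Y n x)) <= r ^+ n.+1 * hnorm x.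
      by rewrite (le_trans (IH _))// exprSr -mulrA ler_wpM2l ?exprn_ge0 ?Yr.
    have := hnormD (Y n.+1 (Y n.+1 x - Y n x)) (Y n.+1 (Y n x) - Y n (Y n x)).
    lra.
  by rewrite linearB/= subrKA.
have r01 : 0 <= r < 1 by rewrite r0.
have [L LP] := operator_limit r01 Ydiff.
have lim_eq x y D : (forall n, hnorm (x - y) <= D * r ^+ n) -> x = y.
  exact: geometric_eq.
set D : R := 1 / (1 - r) in LP.
have D0 : 0 <= D by rewrite /D divr_ge0 ?subr_ge0 ?(ltW r1).
clearbody D.
have Lr : op_bounded_by r L.
  move=> x; apply/ler_addgt0Pr => e e0.
  have [n nP] := geometric_small (D * hnorm x) r01 e0.
  rewrite addrC -[L x](subrK (Y n x)) (le_trans (hnormD _ _))// lerD ?Yr//.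
  by rewrite (le_trans (LP _ _))// mulrAC ltW.
exists L; exists r; split=> //.
- move=> x y; apply/eqP; rewrite -subr_eq0; apply/eqP/(@Normc.eq0_normc R)/eqP.
  rewrite eq_le normc_ge0 andbT; apply/ler_addgt0Pr => e e0; rewrite add0r.
  have [n nP] := geometric_small (D * hnorm x * hnorm y + D * hnorm y * hnorm x) r01 e0.
  have -> : dot (L x) y - dot x (L y) = dot (L x - Y n x) y - dot x (L y - Y n y).
    by rewrite dotBl dotBr Ysym; ring.
  have h1 := le_trans (normc_dot (L x - Y n x) y) (ler_wpM2r (hnorm_ge0 y) (LP n x)).
  have h2 := le_trans (normc_dot x (L y - Y n y)) (ler_wpM2l (hnorm_ge0 x) (LP n y)).
  have := normcD (dot (L x - Y n x) y) (- dot x (L y - Y n y)).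
  rewrite (@normcN R). nra.
- move=> x; apply: (@lim_eq _ _ ((D * r + 2^-1 * (r * D + D * r)) * hnorm x)) => n.
  rewrite (le_trans (hnorm_triangle (Y n.+1 x) _ _))// mulrDl mulrDl lerD//.
    by rewrite (le_trans (LP _ _))// exprS le_eqVlt; apply/orP; left; apply/eqP; ring.
  rewrite YS -scalerBr hnormZr ger0_norm// -!mulrA ler_wpM2l// opprD addrACA.
  rewrite subrr add0r.
  rewrite (_ : _ - _ = Y n (Y n x - L x) + (Y n (L x) - L (L x))); last first.
    by rewrite linearB/= subrKA.
  rewrite (le_trans (hnormD _ _))// mulrDl lerD//.
    rewrite (le_trans (Yr _ _))// -mulrA ler_wpM2l// hnormBC.
    by rewrite (le_trans (LP _ _))// mulrAC mulrA.
  rewrite hnormBC (le_trans (LP _ _))// -!mulrA mulrCA [leRHS]mulrCA.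
  have := ler_wpM2l D0 (ler_wpM2l (exprn_ge0 n r0) (Lr x)); nra.
- move=> T M M0 bT TX.
  have TY n x : T (Y n x) = Y n (T x).
    elim: n x => [|n IH] x; first by rewrite /= linear0.
    by rewrite !YS linearZ linearD TX !IH.
  move=> x; apply: (@lim_eq _ _ (M * (D * hnorm x) + D * hnorm (T x))) => n.
  rewrite (_ : _ - _ = T (L x - Y n x) + (Y n (T x) - L (T x))); last first.
    by rewrite linearB/= TY subrKA.
  rewrite (le_trans (hnormD _ _))// mulrDl lerD//.
    rewrite (le_trans (bT _))// -mulrA ler_wpM2l//.
    by rewrite (le_trans (LP _ _))// mulrAC.
  by rewrite hnormBC (le_trans (LP _ _))// mulrAC.
Qed.

(** As forms, 0 <= 1 - S/B <= 1 - A/B < 1. Dividing by [B] thus makes [S] a perturbation of the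
    identity by a contraction, to which the Neumann series and the square root iteration apply. *)
Lemma hnormB_scaled S A B x : 0 < A < B -> symmetric_op S -> op_between A B S ->
  hnorm (x - (B^-1)%:C *: S x) <= (1 - A / B) * hnorm x.
Proof.
move=> /andP[A0 AB] sS bS; have B0 := lt_trans A0 AB.
pose X : {linear H -> H} := (idfun \- ((B^-1)%:C \*: S))%R.
apply: (@between_bounded _ _ (1 - A / B) X).
- by rewrite subr_gt0 ltr_pdivrMr// mul1r.
- by move=> y z; rewrite /= dotBl dotBr dotZl dotZr conjcR sS.
- move=> y; rewrite /= dotBl dotZl ReB ReZ -/(sqnorm y).
  have /andP[h1 h2] := bS y; have Bi : 0 < B^-1 by rewrite invr_gt0.
  have e1 := ler_wpM2l (ltW Bi) h1; have e2 := ler_wpM2l (ltW Bi) h2.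
  have e3 : B^-1 * (B * sqnorm y) = sqnorm y by rewrite mulKf// gt_eqF.
  have e4 : 0 <= (1 - A / B) * sqnorm y.
    by rewrite mulr_ge0 ?sqnorm_ge0// subr_ge0 ler_pdivrMr// mul1r ltW.
  rewrite e3 in e2; apply/andP; split.
    by rewrite mulNr (le_trans (_ : _ <= 0)) ?oppr_le0// subr_ge0.
  by rewrite mulrBl mul1r lerB// [A / B]mulrC -mulrA.
Qed.

End PositiveOperators.

Section BoundedBelow.
Variables (R : realType) (H : hilbertSpace R) (A B : R) (S : {linear H -> H}).
Hypotheses (AB : 0 < A < B) (sS : symmetric_op S) (bS : op_between A B S).
Implicit Types (x y : H) (T V Z : {linear H -> H}).

Let A0 : 0 < A. Proof. by case/andP: AB. Qed.
Let B0 : 0 < B. Proof. by case/andP: AB => ?; exact: lt_trans. Qed.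
Let q01 : 0 <= 1 - A / B < 1.
Proof.
rewrite subr_ge0 ler_pdivrMr// mul1r gtrBl divr_gt0//.
by case/andP: AB => _ /ltW ->.
Qed.

Let X : {linear H -> H} := (idfun \- ((B^-1)%:C \*: S))%R.
Let XE x : x - X x = (B^-1)%:C *: S x.
Proof. by rewrite /X/= opprB addrC subrK. Qed.
Let Xq : op_bounded_by (1 - A / B) X.
Proof. by move=> x; exact: hnormB_scaled. Qed.
Let sX : symmetric_op X.
Proof. by move=> x y; rewrite /X/= dotBl dotBr dotZl dotZr conjcR sS. Qed.

Lemma between_inverse : exists V, cancel S V /\ cancel V S.
Proof.
have [V [VX XV]] := contraction_inverse q01 Xq.
exists ((B^-1)%:C \*: V)%R; split=> x /=.
  by rewrite -linearZ/= -XE XV.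
by rewrite linearZ/= -XE VX.
Qed.

Lemma between_op_bounded : op_bounded_by B S.
Proof.
apply: between_bounded => // x; have /andP[h ->] := bS x.
by rewrite (le_trans _ h)// ler_wpM2r ?sqnorm_ge0// (le_trans _ (ltW A0))// oppr_le0 ltW.
Qed.

(** The commutation clause serves twice: it makes the positive root unique, and it lets the root of
    the inverse frame operator commute with the time-frequency shifts. *)
Lemma between_sqrt : exists (Z : {linear H -> H}) (m M : R),
  [/\ 0 < m < M, symmetric_op Z, (forall x, Z (Z x) = S x), op_between m M Z &
      forall T M, 0 <= M -> op_bounded_by M T ->
        (forall x, T (S x) = S (T x)) -> forall x, T (Z x) = Z (T x)].
Proof.
have [Y [r [/andP[r0 r1] Yr sY YE Ycomm]]] := contraction_sqrt q01 sX Xq.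
pose s := Num.sqrt B; have s0 : 0 < s by rewrite sqrtr_gt0.
have sB : s * s = B by rewrite -expr2 sqr_sqrtr// ltW.
(* For X = 1 - S/B the equation 2Y = X + Y^2 reads (1 - Y)^2 = S/B, so [s (1 - Y)] with [s ^+ 2 = B]
   is the root. Since Y has norm at most [r < 1], its form lies between [s (1 - r)] and
   [s (1 + r) <= 2 s]. *)
exists (s%:C \*: (idfun \- Y))%R, (s * (1 - r)), (s * 2); split.
- by rewrite mulr_gt0 ?subr_gt0//= ltr_pM2l//; lra.
- by move=> x y /=; rewrite dotZl dotZr conjcR dotBl dotBr sY.
- move=> x /=; rewrite [Y (_ *: _)]linearZ [Y (_ - _)]linearB -scalerBr scalerA -rmorphM/= sB.
  have YY : Y (Y x) = Y x + (Y x - X x).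
    have : Y x + Y x = X x + Y (Y x).
      rewrite {1 2}YE -scalerDl -rmorphD/= (_ : 2^-1 + 2^-1 = 1) ?scale1r//; lra.
    by move=> e; rewrite addrA e addrAC subrr add0r.
  rewrite YY [- (Y x + (Y x - _))]opprD addrA [Y x - Y x]subrr sub0r opprK subrKA XE.
  by rewrite scalerA -rmorphM/= divff ?gt_eqF// scale1r.
- move=> x; rewrite [dot _ _]dotZl ReZ -!mulrA !ler_pM2l//= dotBl ReB -/(sqnorm x).
  have h1 := Re_dot_le (Y x) x; have h2 := Re_dot_le (- Y x) x.
  rewrite dotNl ReN hnormN in h2.
  have h3 : hnorm (Y x) * hnorm x <= r * sqnorm x.
    by rewrite -hnorm_sqr expr2 mulrA ler_wpM2r ?hnorm_ge0.
  have := sqnorm_ge0 x => h4; apply/andP; split; nra.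
- move=> T M M0 bT TS x /=; rewrite linearZ linearB/= (Ycomm T M)// => y.
  by rewrite /X/= linearB linearZ/= TS.
Qed.

(** [T] commutes with [T^2 = S], hence with [Z], so [y = T x - Z x] satisfies
    [(T + Z) y = T^2 x - Z^2 x = 0]. Pairing with [y] leaves [<Z y, y> <= 0], which the lower bound
    of [Z] allows only for [y = 0]. *)
Lemma between_sqrt_unique Z T (m m' M : R) : 0 < m ->
  (forall x, Z (Z x) = S x) -> op_between m m' Z ->
  (forall T M, 0 <= M -> op_bounded_by M T ->
     (forall x, T (S x) = S (T x)) -> forall x, T (Z x) = Z (T x)) ->
  0 <= M -> op_bounded_by M T ->
  (forall x, 0 <= dot (T x) x) -> (forall x, T (T x) = S x) ->
  forall x, T x = Z x.
Proof.
move=> m0 ZZ Zm Zcomm M0 bT T0 TT x.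
have TZ y : T (Z y) = Z (T y) by apply: (Zcomm T M) => // z; rewrite -!TT.
set y := T x - Z x.
have y0 : T y + Z y = 0.
  by rewrite /y !linearB/= TT ZZ TZ addrC subrKA subrr.
apply/eqP; rewrite -subr_eq0 -sqnorm_eq0 -/y eq_le sqnorm_ge0 andbT.
have /andP[{}Zm _] := Zm y.
rewrite -(pmulr_rle0 _ m0) (le_trans Zm)//.
have : dot (T y + Z y) y = 0 by rewrite y0 dot0l.
rewrite dotDl; have := T0 y; case: (dot (T y) y) (dot (Z y) y) => a b [c d].
by rewrite lecE/= => /andP[_ a0] [ac _]; rewrite -ac lerDr.
Qed.

(** With [y = V x] the form of [V] at [x] is that of [S] at [y], and |x| = |S y| lies between
    [A |y|] and [B |y|]. The lower constant is coarser than 1/B; its positivity is what matters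
    later. *)
Lemma inverse_between V : cancel S V -> cancel V S ->
  [/\ 0 < A / B ^+ 2 < A^-1, symmetric_op V & op_between (A / B ^+ 2) A^-1 V].
Proof.
move=> SV VS; have sV : symmetric_op V by move=> x y; rewrite -{1}[y]VS -sS VS.
split=> //.
  rewrite divr_gt0 ?exprn_gt0//= ltr_pdivrMr ?exprn_gt0// mulrC ltr_pdivlMr//.
  by rewrite -expr2 ltr_pXn2r ?nnegrE ?ltW//; case/andP: AB.
move=> x; rewrite -[x]VS; set y := V x; rewrite SV.
have /andP[h1 h2] := bS y; have h3 := between_op_bounded y.
have h4 := between_bounded_below y bS.
have -> : complex.Re (dot y (S y)) = complex.Re (dot (S y) y) by rewrite -sS.
apply/andP; split.
  rewrite mulrAC ler_pdivrMr ?exprn_gt0// -!hnorm_sqr.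
  have := ler_wpM2r (ltW (exprn_gt0 2 B0)) h1; rewrite -hnorm_sqr; apply: le_trans.
  rewrite -mulrA ler_wpM2l ?(ltW A0)// -exprMn mulrC.
  by rewrite ler_pXn2r ?nnegrE ?mulr_ge0 ?hnorm_ge0 ?(ltW B0).
rewrite mulrC ler_pdivlMr// -hnorm_sqr.
have h5 := Re_dot_le (S y) y.
apply: le_trans (ler_wpM2r (ltW A0) h5) _.
by rewrite expr2 -mulrA ler_wpM2l ?hnorm_ge0// mulrC.
Qed.

End BoundedBelow.

(** * The normalized Newton step *)

Section NewtonStep.
Variables (R : realType) (H : hilbertSpace R).
Implicit Types (x y h : H) (m M : R) (Z V : {linear H -> H}).

Definition newton_map Z V h : {linear H -> H} :=
  (2^-1%:C \*: (((hnorm (Z h))^-1%:C \*: Z) \+ ((hnorm (V h))^-1%:C \*: V)))%R.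

Lemma newton_step m M Z V h : 0 < m < M -> symmetric_op Z -> op_between m M Z ->
  cancel Z V -> cancel V Z -> h != 0 ->
  let k := M / m in let k' := (k + k^-1) / 2 in
  exists rho : R, [/\ 0 < rho, symmetric_op (newton_map Z V h),
    op_between rho (rho * k') (newton_map Z V h),
    rho * hnorm h <= 1 & 1 <= k * (rho * hnorm h)].
Proof.
move=> /andP[m0 mM] sZ bZ ZV VZ h0 k k'; have M0 := lt_trans m0 mM.
have sV : symmetric_op V by move=> x y; rewrite -{1}[y]VZ -sZ VZ.
have pV w : 0 <= complex.Re (dot (Z w) w).
  by have /andP[+ _] := bZ w; apply: le_trans; rewrite mulr_ge0 ?sqnorm_ge0// ltW.
have k0 : 0 < k by rewrite divr_gt0.
have kmM : k * m = M by rewrite mulfVK ?gt_eqF.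
have k1 : 1 < k by rewrite ltr_pdivlMr// mul1r.
clearbody k.
have c0 : 0 < hnorm h by rewrite hnorm_gt0.
have ZMx x : hnorm (Z x) <= M * hnorm x.
  by apply: (@between_op_bounded _ _ m M) => //; rewrite m0.
have mc : m * hnorm h <= hnorm (Z h) by exact: between_bounded_below bZ.
have cM := ZMx h.
have mc' : m * hnorm (V h) <= hnorm h by have := between_bounded_below (V h) bZ; rewrite VZ.
have cM' : hnorm h <= M * hnorm (V h) by have := ZMx (V h); rewrite VZ.
(* By symmetry <Z h, Z^(-1) h> = |h|^2; this is the source of [rho * hnorm h <= 1]. *)
have cab : hnorm h ^+ 2 <= hnorm (Z h) * hnorm (V h).
  by have := Re_dot_le (Z h) (V h); rewrite sZ VZ -/(sqnorm h) -hnorm_sqr.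
rewrite /newton_map; set a := hnorm (Z h) in mc cM cab *.
set b := hnorm (V h) in mc' cM' cab *; set c := hnorm h in c0 mc cM mc' cM' cab *.
have a0 : 0 < a by rewrite (lt_le_trans _ mc)// mulr_gt0.
have b0 : 0 < b by rewrite -(pmulr_rgt0 _ M0) (lt_le_trans c0).
(* Chosen so that [a^-1 = rho * tau] and [b^-1 = rho / tau]: the step is [rho] times the mean of
   [tau Z] and its inverse. *)
pose tau := Num.sqrt (b / a); pose rho := Num.sqrt ((a * b)^-1).
have t0 : 0 < tau by rewrite sqrtr_gt0 divr_gt0.
have r0 : 0 < rho by rewrite sqrtr_gt0 invr_gt0 mulr_gt0.
have t2 : tau ^+ 2 = b / a by rewrite sqr_sqrtr// ltW// divr_gt0.
have r2 : rho ^+ 2 = (a * b)^-1 by rewrite sqr_sqrtr// ltW// invr_gt0 mulr_gt0.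
have aE : a^-1 = rho * tau.
  rewrite /rho /tau -sqrtrM ?invr_ge0 ?mulr_ge0 ?(ltW a0) ?(ltW b0)//.
  rewrite (_ : _ * _ = a^-1 ^+ 2) ?sqrtr_sqr ?gtr0_norm ?invr_gt0//.
  by field; rewrite !gt_eqF.
have bE : b^-1 = rho / tau.
  rewrite (_ : rho / tau = rho ^+ 2 / (rho * tau)); last by field; rewrite !gt_eqF.
  by rewrite r2 -aE; field; rewrite !gt_eqF.
have tM : 1 <= M * tau.
  rewrite -(@ler_pXn2r _ 2)// ?nnegrE ?mulr_ge0 ?(ltW M0) ?(ltW t0)//.
  rewrite expr1n exprMn t2 mulrA ler_pdivlMr// mul1r expr2 -mulrA.
  by rewrite (le_trans cM)// ler_wpM2l// ltW.
have tm : m * tau <= 1.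
  rewrite -(@ler_pXn2r _ 2)// ?nnegrE ?mulr_ge0 ?(ltW m0) ?(ltW t0)//.
  rewrite expr1n exprMn t2 mulrA ler_pdivrMr// mul1r expr2 -mulrA.
  by rewrite (le_trans _ mc)// ler_wpM2l// ltW.
have kt0 : 0 < (k * tau)^-1 by rewrite invr_gt0 mulr_gt0.
have ktt : (k * tau)^-1 < k / tau.
  rewrite invfM ltr_pM2r ?invr_gt0// (lt_trans _ k1)// invf_lt1//.
(* The form bounds are widened to end points with product [tau ^- 2], that is, [tau Z] between 1/k
   and k. This uses [m * tau <= 1 <= M * tau]. *)
have bZ' : op_between ((k * tau)^-1) (k / tau) Z.
  move=> x; have /andP[h1 h2] := bZ x; have N0 := sqnorm_ge0 x; apply/andP; split.
    apply: le_trans h1; rewrite ler_wpM2r// -[leLHS]mul1r ler_pdivrMr ?mulr_gt0//.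
    by rewrite mulrA [m * k]mulrC kmM.
  apply: (le_trans h2); rewrite ler_wpM2r// ler_pdivlMr// -kmM -mulrA.
  by rewrite -[leRHS]mulr1 ler_wpM2l// ltW.
exists rho; split=> //.
- by move=> x y /=; rewrite !(dotZl, dotZr, conjcR, dotDl, dotDr) sZ sV.
(* At [V x] the cubic inequality becomes the upper estimate of [tau Z + (tau Z)^(-1)]. The lower one
   is positivity of [Z] at [tau x - V x], an operator form of the arithmetic-geometric mean
   inequality. *)
- move=> x; have := between_cubic (V x) sZ bZ' ltac:(by rewrite (ltW kt0)).
  have := pV (tau%:C *: x - V x).
  rewrite linearB linearZ/= !VZ !(dotZl, dotNl, dotNr, dotDl, dotBl, dotBr, dotZr, conjcR).
  rewrite !(ReZ, ReD, ReB, ReN) [dot (Z x) (V x)]sZ VZ -[dot x (V x)]sV -/(sqnorm x).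
  set z2 := complex.Re (dot (Z x) x); set v := complex.Re (dot (V x) x).
  set n := sqnorm x => h1 h2.
  have {}h1 : 2 * n <= tau * z2 + v / tau.
    rewrite -subr_ge0 -(pmulr_rge0 _ t0); apply: le_trans h1 _.
    by rewrite le_eqVlt; apply/orP; left; apply/eqP; field; rewrite gt_eqF.
  have {}h2 : tau * z2 + v / tau <= (k + k^-1) * n.
    rewrite -(ler_pM2l (_ : 0 < tau^-1)) ?invr_gt0//.
    apply: le_trans (le_trans h2 _); rewrite le_eqVlt; apply/orP; left; apply/eqP;
      by field; rewrite !gt_eqF.
  rewrite aE bE (_ : 2^-1 * _ = rho * ((tau * z2 + v / tau) / 2)); last by ring.
  rewrite -[rho * k' * n]mulrA !ler_pM2l// /k'; apply/andP; split; lra.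
- rewrite -(@ler_pXn2r _ 2)// ?nnegrE ?mulr_ge0 ?(ltW r0) ?(ltW c0)//.
  by rewrite expr1n exprMn r2 mulrC ler_pdivrMr ?mulr_gt0// mul1r.
- rewrite -(@ler_pXn2r _ 2)// ?nnegrE ?mulr_ge0 ?(ltW r0) ?(ltW c0) ?(ltW k0)//.
  rewrite expr1n !exprMn r2 mulrCA mulrC ler_pdivlMr ?mulr_gt0// mul1r.
  have h1 : a * b <= k * c ^+ 2.
    apply: le_trans (ler_wpM2r (ltW b0) cM) _; rewrite -kmM expr2.
    rewrite (_ : _ * b = k * (c * (m * b))); last by ring.
    by rewrite !ler_wpM2l ?(ltW k0) ?(ltW c0).
  apply: le_trans h1 _; rewrite expr2 -mulrA ler_peMl// ?(ltW k1)//.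
  by rewrite mulr_ge0 ?sqr_ge0 ?(ltW k0).
Qed.

(* [k] is the condition number of the previous operator. *)
Lemma newton_error (k rho : R) Z h : 1 < k -> let k' := (k + k^-1) / 2 in
  0 < rho -> symmetric_op Z -> op_between rho (rho * k') Z ->
  h != 0 -> rho * hnorm h <= 1 -> 1 <= k * (rho * hnorm h) ->
  hnorm (Z h - (hnorm h)^-1%:C *: h) <= k - 1.
Proof.
move=> k1 k' r0 sZ bZ h0 r1 rk; have c0 : 0 < hnorm h by rewrite hnorm_gt0.
set c := hnorm h in c0 r1 rk *.
have k0 : 0 < k by rewrite (lt_trans _ k1).
pose T : {linear H -> H} := (Z \- (c^-1%:C \*: idfun))%R.
(* [Z] and the scalar [1/c] both lie between [rho] and [k rho], which bounds the form of their
   difference. Evaluation at [h], of norm [c], then cancels the denominator. *)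
have : op_bounded_by ((k - 1) / c) T.
  apply: between_bounded => [|x y|x]; first by rewrite divr_gt0// subr_gt0.
    by rewrite /T/= dotBl dotBr dotZl dotZr conjcR sZ.
  have /andP[h1 h2] := bZ x; rewrite /T/= dotBl dotZl ReB ReZ -/(sqnorm x).
  have n0 := sqnorm_ge0 x; set n := sqnorm x in h1 h2 n0 *.
  have k'1 : k' <= k by rewrite /k'; have : k^-1 <= 1 by [rewrite invf_le1 ?ltW//]; lra.
  have e1 : rho <= c^-1 by rewrite -[c^-1]mul1r ler_pdivlMr.
  have e2 : c^-1 <= k * rho by rewrite -[c^-1]mul1r ler_pdivrMr// -mulrA.
  apply/andP; split.
    rewrite lerBrDr; apply: le_trans h1.
    rewrite -mulrDl ler_wpM2r// (_ : _ + _ = (2 - k) * c^-1); last by ring.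
    (* The lower bound amounts to [(2 - k) / c <= rho]. For [k < 2] it follows from [1/c <= k rho]
       and (2 - k) k = 1 - (k - 1)^2 <= 1. *)
    have [k2|k2] := leP 2 k.
      by rewrite (le_trans _ (ltW r0))// mulr_le0_ge0 ?invr_ge0 ?(ltW c0)// subr_le0.
    have k3 : 0 <= 2 - k by rewrite subr_ge0 ltW.
    have := mulr_ge0 (sqr_ge0 (k - 1)) (ltW r0); have := ler_wpM2l k3 e2; lra.
  rewrite lerBlDr (le_trans h2)// -mulrDl ler_wpM2r//.
  rewrite (_ : (k - 1) / c + c^-1 = c^-1 * k); last by ring.
  have k'0 : 0 <= k' by rewrite divr_ge0 ?addr_ge0 ?invr_ge0 ?(ltW k0).
  by rewrite ler_pM ?(ltW r0).
by move=> /(_ h); rewrite -/c mulfVK ?gt_eqF.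
Qed.

End NewtonStep.

(** * Frame series and projective systems of shifts *)

Section FrameSeries.
Variables (R : realType) (H : hilbertSpace R) (I : choiceType).
Implicit Types (x y z : H) (c : R[i]) (e : I -> H) (F G : {fset I}) (B : R).

Local Notation normc := Normc.normc.

Definition frame_sum e F x : H := \sum_(p <- F) dot x (e p) *: e p.

Definition frame_limit e x y := forall d : R, 0 < d -> exists F0 : {fset I},
  forall F, (F0 `<=` F)%fset -> hnorm (y - frame_sum e F x) < d.

Definition bessel B e := forall F x,
  \sum_(p <- F) normc (dot x (e p)) ^+ 2 <= B * sqnorm x.

Lemma big_fset_split (T : Type) (idx : T) (op : Monoid.com_law idx) F G (f : I -> T) :
  (F `<=` G)%fset -> \big[op/idx]_(p <- G) f p =
    op (\big[op/idx]_(p <- F) f p) (\big[op/idx]_(p <- (G `\` F)%fset) f p).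
Proof.
move=> FG; rewrite (big_fsetID _ (mem F))/=; congr (op _ _).
  by apply: eq_fbigl => i; rewrite !inE /= -(@in_fsetI _ G F) (fsetIidPr _).
by apply: eq_fbigl => i; rewrite !inE andbC.
Qed.

Lemma frame_sum_linear e F c x y :
  frame_sum e F (c *: x + y) = c *: frame_sum e F x + frame_sum e F y.
Proof.
rewrite /frame_sum scaler_sumr -big_split/=; apply: eq_bigr => p _.
by rewrite dot_linear scalerDl scalerA.
Qed.

Lemma frame_sum_symmetric e F x y : dot (frame_sum e F x) y = dot x (frame_sum e F y).
Proof.
rewrite dot_suml dot_sumr; apply: eq_bigr => p _.
by rewrite dotZl dotZr -dotC mulrC.
Qed.

Lemma Re_dot_frame_sum e F x :
  complex.Re (dot (frame_sum e F x) x) = \sum_(p <- F) normc (dot x (e p)) ^+ 2.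
Proof.
rewrite dot_suml Re_sum; apply: eq_bigr => p _.
by rewrite dotZl (dotC x) mulcJ.
Qed.

(** Expand |s|^2 as the sum of Re (c_p <e_p, s>) and apply the weighted inequality 2uv <= B u^2 +
    v^2 / B to each term. The Bessel bound at [s] itself turns the second half into |s|^2 / 2, which
    is absorbed on the left. *)
Lemma bessel_synthesis e B F (c : I -> R[i]) : 0 < B -> bessel B e ->
  sqnorm (\sum_(p <- F) c p *: e p) <= B * \sum_(p <- F) normc (c p) ^+ 2.
Proof.
move=> B0 eB; set s := \sum_(p <- F) c p *: e p.
have : sqnorm s <= 2^-1 * (B * \sum_(p <- F) normc (c p) ^+ 2) + 2^-1 * sqnorm s.
  rewrite {1}/sqnorm {1}/s dot_suml Re_sum.
  apply: (@le_trans _ _ (\sum_(p <- F) (2^-1 * (B * normc (c p) ^+ 2) +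
      2^-1 * (B^-1 * normc (dot s (e p)) ^+ 2)))).
    apply: ler_sum => p _; rewrite dotZl.
    rewrite (le_trans (ler_norm _))// (le_trans (Re_le_normc _))// Normc.normcM.
    rewrite (dotC s) normcJ; set u := normc (c p); set v := normc _.
    have Bi : 0 < B^-1 by rewrite invr_gt0.
    have := mulr_ge0 (ltW Bi) (sqr_ge0 (B * u - v)).
    rewrite (_ : B^-1 * (B * u - v) ^+ 2 = B * u ^+ 2 + B^-1 * v ^+ 2 - 2 * (u * v)); first by lra.
    by field; rewrite gt_eqF.
  rewrite big_split/= -!mulr_sumr lerD2l ler_wpM2l// ?invr_ge0//.
  by rewrite ler_pdivrMl// eB.
lra.
Qed.

Lemma frame_limit_unique e x y z : frame_limit e x y -> frame_limit e x z -> y = z.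
Proof.
move=> ly lz; apply: hnorm_small_eq => d d0.
have [|F FP] := ly (d / 2); first by rewrite divr_gt0.
have [|G GP] := lz (d / 2); first by rewrite divr_gt0.
have h1 := FP (F `|` G)%fset (fsubsetUl _ _).
have h2 := GP (F `|` G)%fset (fsubsetUr _ _).
rewrite (le_lt_trans (hnorm_triangle (frame_sum e (F `|` G)%fset x) _ _))//.
rewrite (hnormBC _ z); lra.
Qed.

Lemma frame_limit_linear e c x y x' y' : frame_limit e x y -> frame_limit e x' y' ->
  frame_limit e (c *: x + x') (c *: y + y').
Proof.
move=> lx ly d d0.
have c1 : 0 < normc c + 1 by rewrite ltr_wpDl// normc_ge0.
have [|F FP] := lx (d / 2 / (normc c + 1)); first by rewrite !divr_gt0.
have [|G GP] := ly (d / 2); first by rewrite divr_gt0.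
exists (F `|` G)%fset => K; rewrite fsubUset => /andP[/FP h1 /GP h2].
rewrite frame_sum_linear opprD addrACA -scalerBr (le_lt_trans (hnormD _ _))//.
rewrite hnormZ; move: h1; rewrite ltr_pdivlMr// mulrDr mulr1 mulrC => h1.
have := hnorm_ge0 (y - frame_sum e K x); lra.
Qed.

(** The energies of finite index sets have a supremum. Once a set comes close to it, any enlargement
    adds little energy and therefore, by the synthesis bound, little norm; this gives convergence
    along the net of finite sets. *)
Lemma frame_limit_exists e B x : 0 < B -> bessel B e -> exists y, frame_limit e x y.
Proof.
move=> B0 eB.
pose S := [set \sum_(p <- F) normc (dot x (e p)) ^+ 2 | F in [set: {fset I}]].
have supS : has_sup S.
  split; first by exists (\sum_(p <- fset0) normc (dot x (e p)) ^+ 2); exists fset0.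
  by exists (B * sqnorm x) => _ [F _ <-]; exact: eB.
have near_sup (n : nat) : exists F, forall G, (F `<=` G)%fset ->
    hnorm (frame_sum e G x - frame_sum e F x) <= 1 * 2^-1 ^+ n.
  (* The synthesis bound converts this tolerance on the energy into [2^-1 ^+ n] on the norm. *)
  have d0 : 0 < B^-1 * (2^-1 ^+ n) ^+ 2 by rewrite mulr_gt0 ?invr_gt0 ?exprn_gt0 ?invr_gt0.
  have [_ [F _ <-] Fs] := sup_adherent d0 supS.
  exists F => G FG; rewrite mul1r.
  rewrite -(@ler_pXn2r _ 2)// ?nnegrE ?hnorm_ge0// ?exprn_ge0 ?invr_ge0//.
  rewrite hnorm_sqr /frame_sum (big_fset_split _ _ FG)/= addrAC subrr add0r.
  rewrite (le_trans (bessel_synthesis _ _ B0 eB))//.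
  rewrite -ler_pdivlMl//.
  have : \sum_(p <- G) normc (dot x (e p)) ^+ 2 <= sup S.
    by apply: ub_le_sup; [case: supS | exists G].
  rewrite (big_fset_split _ _ FG)/=; lra.
have [F FP] := choice near_sup.
have q01 : 0 <= (2^-1 : R) < 1 by rewrite invr_ge0 ler0n/= invf_lt1// ltr1n.
have [n|l lP] := @geometric_cauchy_cvg R H (fun n => frame_sum e (F n) x) 2 2^-1 q01.
  (* [F n] and [F n.+1] need not be nested, so they are compared through their union. *)
  rewrite (le_trans (hnorm_triangle (frame_sum e (F n `|` F n.+1)%fset x) _ _))//.
  have h1 := FP n _ (fsubsetUl (F n) (F n.+1)).
  have h2 := FP n.+1 _ (fsubsetUr (F n) (F n.+1)).
  rewrite hnormBC; rewrite exprS in h2.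
  have : 0 <= (2^-1 : R) ^+ n by rewrite exprn_ge0// invr_ge0.
  lra.
exists l => d d0; have [n nd] := geometric_small (2 / (1 - 2^-1) + 1) q01 d0.
exists (F n) => G FG; apply: le_lt_trans nd.
rewrite (le_trans (hnorm_triangle (frame_sum e (F n) x) _ _))//.
by rewrite mulrDl lerD// hnormBC FP.
Qed.

Lemma frame_operator_exists e B : 0 < B -> bessel B e ->
  exists S : {linear H -> H}, forall x, frame_limit e x (S x).
Proof.
move=> B0 eB.
have [f fP] := choice (fun x => @frame_limit_exists e B x B0 eB).
have [S SE] : exists S : {linear H -> H}, forall x, S x = f x.
  apply: exists_linear => c x y; apply: frame_limit_unique (fP _) _.
  exact: frame_limit_linear.
by exists S => x; rewrite SE.
Qed.

(** Besides the symmetry of frame operators, this yields the coefficients of the sum [y] in an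
    orthogonal system, by taking for [x'] one of its vectors. *)
Lemma frame_limit_symmetric e x y x' y' : frame_limit e x y -> frame_limit e x' y' ->
  dot y x' = dot x y'.
Proof.
move=> lx lx'; apply/eqP; rewrite -subr_eq0; apply/eqP/(@Normc.eq0_normc R)/eqP.
rewrite eq_le normc_ge0 andbT; apply/ler_addgt0Pr => d d0; rewrite add0r.
pose K := hnorm x + hnorm x' + 1.
have K0 : 0 < K by rewrite ltr_wpDl// addr_ge0 ?hnorm_ge0.
have dK : 0 < d / K by rewrite divr_gt0.
have [F FP] := lx _ dK; have [G GP] := lx' _ dK.
have /FP h1 := fsubsetUl F G; have /GP h2 := fsubsetUr F G.
set W := (F `|` G)%fset in h1 h2.
have -> : dot y x' - dot x y' =
    dot (y - frame_sum e W x) x' - dot x (y' - frame_sum e W x').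
  by rewrite dotBl dotBr frame_sum_symmetric; ring.
rewrite (le_trans (normcD _ _))// (@normcN R).
have h3 := le_trans (normc_dot _ x') (ler_wpM2r (hnorm_ge0 x') (ltW h1)).
have h4 := le_trans (normc_dot x _) (ler_wpM2l (hnorm_ge0 x) (ltW h2)).
rewrite (le_trans (lerD h3 h4))// [hnorm x * _]mulrC -mulrDr -mulrA ler_piMr ?(ltW d0)//.
by rewrite mulrC ler_pdivrMr// mul1r /K addrC lerDl.
Qed.

Lemma frame_sum_le_limit e x y F : frame_limit e x y ->
  \sum_(p <- F) normc (dot x (e p)) ^+ 2 <= complex.Re (dot y x).
Proof.
move=> lx; apply/ler_addgt0Pr => d d0.
have [|G GP] := lx (d / (hnorm x + 1)).
  by rewrite divr_gt0// ltr_wpDl ?hnorm_ge0.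
have /GP h1 := fsubsetUr F G; set W := (F `|` G)%fset in h1.
apply: (@le_trans _ _ (\sum_(p <- W) normc (dot x (e p)) ^+ 2)).
  rewrite (big_fset_split _ _ (fsubsetUl F G))/= lerDl sumr_ge0// => p _.
  exact: sqr_ge0.
rewrite -Re_dot_frame_sum -lerBlDl -ReB -dotBl.
rewrite (le_trans (Re_dot_le _ _))// hnormBC.
rewrite (le_trans (ler_wpM2r (hnorm_ge0 x) (ltW h1)))//.
rewrite mulrAC ler_pdivrMr ?ltr_wpDl ?hnorm_ge0//.
by rewrite ler_wpM2l ?(ltW d0)// lerDl.
Qed.

Lemma esum_frame_limit e x y : frame_limit e x y ->
  (\esum_(p in [set: I]) (normc (dot x (e p)) ^+ 2)%:E = (complex.Re (dot y x))%:E)%E.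
Proof.
move=> lx; apply/eqP; rewrite eq_le; apply/andP; split.
  apply: ge_ereal_sup => _ [A [finA _] <-].
  by rewrite fsbig_finite//= sumEFin lee_fin frame_sum_le_limit.
apply/lee_addgt0Pr => d d0.
have [|F /(_ F (fsubset_refl F)) FP] := lx (d / (hnorm x + 1)).
  by rewrite divr_gt0// ltr_wpDl ?hnorm_ge0.
have h : complex.Re (dot y x) <= \sum_(p <- F) normc (dot x (e p)) ^+ 2 + d.
  rewrite -Re_dot_frame_sum -lerBlDl -ReB -dotBl.
  rewrite (le_trans (Re_dot_le _ _))//.
  rewrite (le_trans (ler_wpM2r (hnorm_ge0 x) (ltW FP)))//.
  rewrite mulrAC ler_pdivrMr ?ltr_wpDl ?hnorm_ge0//.
  by rewrite ler_wpM2l ?(ltW d0)// lerDl.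
apply: (@le_trans _ _ ((\sum_(p <- F) normc (dot x (e p)) ^+ 2 + d)%:E)).
  by rewrite lee_fin.
rewrite EFinD leeD2r// esum_ge//; exists [set` F] => //.
by rewrite -fsbig_seq//= sumEFin.
Qed.

Lemma bessel_esum e B :
  (forall x, (\esum_(p in [set: I]) (normc (dot x (e p)) ^+ 2)%:E <= (B * sqnorm x)%:E)%E) ->
  bessel B e.
Proof.
move=> eB F x; rewrite -lee_fin; apply: le_trans (eB x).
apply: esum_ge; exists [set` F] => //.
by rewrite -fsbig_seq//= sumEFin.
Qed.

(** Let y be the sum of the <x, e_k> e_k and q the sum of the |<x, e_k>|^2. Then <x, y> = q and
    |y|^2 = B q, so |B x - y|^2 >= 0 reads q <= B |x|^2 after division by [B]. *)
Lemma orthogonal_bessel e B : 0 < B ->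
  (forall k j, dot (e k) (e j) = if k == j then B%:C else 0) -> bessel B e.
Proof.
move=> L_gt0 ee F x; pose y : H := \sum_(k <- F) (dot x (e k) *: e k).
have xy : dot x y = (\sum_(k <- F) normc (dot x (e k)) ^+ 2)%:C.
  rewrite dot_sumr rmorph_sum/=; apply: eq_bigr => k _.
  by rewrite dotZr mulrC mulcJ.
have yy : dot y y = (B * \sum_(k <- F) normc (dot x (e k)) ^+ 2)%:C.
  rewrite /y dot_suml mulr_sumr rmorph_sum/= big_seq [RHS]big_seq.
  apply: eq_bigr => k kF; rewrite dotZl dot_sumr (big_fsetD1 k)//= dotZr ee eqxx.
  rewrite big1_fset ?addr0; first by rewrite mulrA mulcJ -rmorphM mulrC.
  by move=> j; rewrite !inE => /andP[jk _] _; rewrite dotZr ee eq_sym (negbTE jk) mulr0.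
set q := \sum_(k <- F) _ in xy yy *.
have := sqnorm_ge0 (B%:C *: x - y).
rewrite sqnormB sqnormZ /sqnorm dotZl xy yy -rmorphM normc_real.
rewrite real_normK ?num_real//= => h.
rewrite -(ler_pM2l L_gt0); have := h; lra.
Qed.

Lemma orthogonal_frame_limit e B :
  (forall k j, dot (e k) (e j) = if k == j then B%:C else 0) ->
  forall k, frame_limit e (e k) (B%:C *: e k).
Proof.
move=> ee k d d0; exists [fset k]%fset => F; rewrite fsub1set => kF.
rewrite /frame_sum (big_fsetD1 k)//= ee eqxx big1_fset ?addr0 ?subrr ?hnorm0//.
by move=> j; rewrite !inE => /andP[jk _] _; rewrite ee eq_sym (negbTE jk) scale0r.
Qed.

End FrameSeries.

(** * Orbits under a projective system of isometries *)

Section ProjectiveSystem.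
Variables (R : realType) (H : hilbertSpace R) (I : zmodType).
Variable U : I -> {linear H -> H}.
Hypothesis U_iso : forall p x y, dot (U p x) (U p y) = dot x y.
Hypothesis U0 : forall x, U 0 x = x.
Hypothesis U_add : forall p q, exists c : R[i], Normc.normc c = 1 /\
  forall x, U p (U q x) = c *: U (p + q) x.
Implicit Types (g h x y : H) (p q : I) (T Z V S : {linear H -> H}) (m M : R).

Local Notation normc := Normc.normc.

Definition orbit_of g p : H := U p g.

Definition commutes_with_orbit (T : H -> H) := forall p x, T (U p x) = U p (T x).

Lemma normc_dot_orbit x y p : normc (dot x (U p y)) = normc (dot y (U (- p) x)).
Proof.
have [c [c1 cP]] := U_add (- p) p.
rewrite -(U_iso (- p)) cP addNr U0 dotZr Normc.normcM normcJ c1 mul1r.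
by rewrite (dotC y) normcJ.
Qed.

Lemma hnorm_orbit x p : hnorm (U p x) = hnorm x.
Proof. by rewrite /hnorm /sqnorm U_iso. Qed.

(** The shift by [q] translates the index set. The phase from composing shifts occurs once in the
    atom and once, conjugated, in its coefficient, so it cancels. *)
Lemma frame_limit_orbit g x y q : frame_limit (orbit_of g) x y ->
  frame_limit (orbit_of g) (U q x) (U q y).
Proof.
move=> lx d d0; have [F0 FP] := lx d d0.
exists [fset (p + q)%R | p in F0]%fset => F FF.
have -> : frame_sum (orbit_of g) F (U q x) =
    U q (frame_sum (orbit_of g) [fset (p - q)%R | p in F]%fset x).
  rewrite /frame_sum big_imfset/=; last by move=> i j _ _ /addIr.
  rewrite linear_sum; apply: eq_bigr => p _; rewrite linearZ/= /orbit_of.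
  have [c [c1 cP]] := U_add q (p - q).
  rewrite -(U_iso q x) cP subrKC dotZr scalerA mulrAC (mulrC c^*%C) mulcJ c1.
  by rewrite expr1n mul1r.
rewrite -linearB/= hnorm_orbit FP//; apply/fsubsetP => p pF.
have /(fsubsetP FF) pqF : p + q \in [fset (p + q)%R | p in F0]%fset.
  by apply/imfsetP; exists p.
by apply/imfsetP; exists (p + q) => //=; rewrite addrK.
Qed.

Lemma frame_operator_commutes g S : (forall x, frame_limit (orbit_of g) x (S x)) ->
  commutes_with_orbit S.
Proof.
move=> SP p x; apply: frame_limit_unique (SP _) _.
exact/frame_limit_orbit/SP.
Qed.

(** By symmetry and commutation the coefficients of [x] against the orbit of [T g] are those of
    [T x] against the orbit of [g]. With T = S^(-1/2) this makes the tight window Parseval; with T =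
    Z it identifies the frame operator of [Z h]. *)
Lemma frame_limit_map g T M x y : symmetric_op T -> 0 <= M -> op_bounded_by M T ->
  commutes_with_orbit T ->
  frame_limit (orbit_of g) (T x) y -> frame_limit (orbit_of (T g)) x (T y).
Proof.
move=> sT M0 bT cT lx d d0.
have M1 : 0 < M + 1 by rewrite ltr_wpDl.
have [|F0 FP] := lx (d / (M + 1)); first by rewrite divr_gt0.
exists F0 => F /FP h.
have -> : frame_sum (orbit_of (T g)) F x = T (frame_sum (orbit_of g) F (T x)).
  rewrite /frame_sum linear_sum; apply: eq_bigr => p _.
  by rewrite linearZ/= /orbit_of sT cT.
rewrite -linearB/= (le_lt_trans (bT _))//.
rewrite ltr_pdivlMr// in h; have := hnorm_ge0 (y - frame_sum (orbit_of g) F (T x)).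
lra.
Qed.

(* For Parseval windows [h] and [g] over the same lattice, swapping the roles
   of the two windows gives |h| = |g|; here [g] is only a test vector. *)
Lemma esum_parseval_swap h x : (forall y, frame_limit (orbit_of h) y y) ->
  (\esum_(p in [set: I]) (normc (dot h (U p x)) ^+ 2)%:E = (sqnorm x)%:E)%E.
Proof.
move=> hP; rewrite -(esum_frame_limit (hP x)).
rewrite (reindex_esum [set: I] [set: I] (fun p => - p)).
  by apply: eq_esum => p _; rewrite /orbit_of normc_dot_orbit opprK.
by split=> // [p q _ _ /oppr_inj //|p _]; exists (- p) => //; rewrite opprK.
Qed.

(* The windows of the iteration are [Z h] for operators [Z] commuting with the
   time-frequency shifts, [k] bounding the condition number of [Z]. *)
Definition window_state h k x := exists (Z V : {linear H -> H}) (m M : R),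
  [/\ [/\ 0 < m < M, M / m = k & x = Z h], symmetric_op Z, op_between m M Z,
      commutes_with_orbit Z & cancel Z V /\ cancel V Z].

Lemma between_sqr m M Z x : 0 < m < M -> symmetric_op Z -> op_between m M Z ->
  m ^+ 2 * sqnorm x <= sqnorm (Z x) <= M ^+ 2 * sqnorm x.
Proof.
move=> mM sZ bZ; have /andP[m0 m1] := mM; have M0 := lt_trans m0 m1.
rewrite -!hnorm_sqr -!exprMn !ler_pXn2r ?nnegrE ?mulr_ge0 ?hnorm_ge0 ?(ltW m0) ?(ltW M0)//.
apply/andP; split; first exact: between_bounded_below bZ.
exact: (between_op_bounded mM sZ bZ).
Qed.

Section ParsevalWindow.
Variable h : H.
Hypothesis h_parseval : forall x, frame_limit (orbit_of h) x x.
Hypothesis h_neq0 : h != 0.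

Lemma window_frame_limit m M Z x : 0 < m < M -> symmetric_op Z -> op_between m M Z ->
  commutes_with_orbit Z -> frame_limit (orbit_of (Z h)) x (Z (Z x)).
Proof.
move=> mM sZ bZ cZ; apply: (@frame_limit_map _ _ M) => //.
  by case/andP: mM => m0 /(lt_trans m0)/ltW.
exact: between_op_bounded bZ.
Qed.

Lemma window_step k Z V m M : 1 < k -> let k' := (k + k^-1) / 2 in
  0 < m < M -> M / m = k -> symmetric_op Z -> op_between m M Z ->
  commutes_with_orbit Z -> cancel Z V -> cancel V Z ->
  window_state h k' (newton_map Z V h h) /\
  hnorm (newton_map Z V h h - (hnorm h)^-1%:C *: h) <= k - 1.
Proof.
move=> k1 k' mM kE sZ bZ cZ ZV VZ.
have [rho] := newton_step mM sZ bZ ZV VZ h_neq0; rewrite kE => -[r0 sZ' bZ' r1 rk].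
have k'1 : 1 < k'.
  have k0 : 0 < k by rewrite (lt_trans _ k1).
  rewrite /k' ltr_pdivlMr// mul1r -subr_gt0 (_ : _ - _ = (k - 1) ^+ 2 / k).
    by rewrite divr_gt0// exprn_gt0// subr_gt0.
  by field; rewrite gt_eqF.
have rM : 0 < rho < rho * k' by rewrite r0 ltr_pMr.
split; last exact: (newton_error k1 r0 sZ' bZ' h_neq0 r1 rk).
have [V' [ZV' VZ']] := between_inverse rM sZ' bZ'.
exists (newton_map Z V h), V', rho, (rho * k'); split=> //.
  by split=> //; rewrite mulrC mulKf// gt_eqF.
have cV : commutes_with_orbit V by move=> p x; rewrite -{1}[x]VZ -cZ ZV.
by move=> p x; rewrite /newton_map/= cZ cV [U p (_ *: _)]linearZ [U p (_ + _)]linearD ![U p (_ *: _)]linearZ.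
Qed.

End ParsevalWindow.

End ProjectiveSystem.

(** * The Hilbert space of square integrable complex functions *)

Section SquareIntegrable.
Context d (T : measurableType d) (R : realType) (mu : {measure set T -> \bar R}).
Implicit Types (u v w : T -> R) (a : R).

Definition sqint u := measurable_fun [set: T] u /\
  (\int[mu]_t (u t ^+ 2)%:E < +oo)%E.

Lemma measurable_sqr u : measurable_fun [set: T] u ->
  measurable_fun [set: T] (fun t => (u t ^+ 2)%:E).
Proof. by move=> mu0; apply/measurable_EFinP; exact: measurable_funX. Qed.

Lemma sqint_sqr_integrable u : sqint u -> mu.-integrable [set: T] (fun t => (u t ^+ 2)%:E).
Proof.
move=> [mu0 uoo]; apply/integrableP; split; first exact: measurable_sqr.
by under eq_integral => t _ do rewrite abse_EFin ger0_norm ?sqr_ge0//.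
Qed.

Lemma integrable_le_fin (F G : T -> R) : measurable_fun [set: T] F ->
  mu.-integrable [set: T] (EFin \o G) -> (forall t, `|F t| <= G t) ->
  mu.-integrable [set: T] (EFin \o F).
Proof.
move=> mF iG FG; apply: (le_integrable measurableT _ _ iG).
  exact/measurable_EFinP.
by move=> t _ /=; rewrite lee_fin (le_trans (FG t))// ler_norm.
Qed.

Lemma sqint_mul u v : sqint u -> sqint v ->
  mu.-integrable [set: T] (fun t => (u t * v t)%:E).
Proof.
move=> su sv; have [mu0 _] := su; have [mv0 _] := sv.
apply: (@integrable_le_fin _ (fun t => u t ^+ 2 + v t ^+ 2)).
- exact: measurable_funM.
- exact: (integrableD measurableT (sqint_sqr_integrable su) (sqint_sqr_integrable sv)).
- move=> t; rewrite normrM -[u t ^+ 2]real_normK ?num_real// -[v t ^+ 2]real_normK ?num_real//.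
  have := sqr_ge0 (`|u t| - `|v t|); have := normr_ge0 (u t); have := normr_ge0 (v t); nra.
Qed.

Lemma sqint_linear a u v : sqint u -> sqint v -> sqint (fun t => a * u t + v t).
Proof.
move=> su sv; have [mu0 _] := su; have [mv0 _] := sv.
have m : measurable_fun [set: T] (fun t => a * u t + v t).
  by apply: measurable_funD => //; exact: measurable_funM.
split=> //; apply: integrable_lty => //.
apply: (@integrable_le_fin _ (fun t => 2 * a ^+ 2 * u t ^+ 2 + 2 * v t ^+ 2)).
- exact: measurable_funX.
- have := integrableZl measurableT (2 * a ^+ 2) (sqint_sqr_integrable su).
  have := integrableZl measurableT 2 (sqint_sqr_integrable sv) => i1 i2.
  exact: (integrableD measurableT i2 i1).
- move=> t; rewrite ger0_norm ?sqr_ge0//.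
  by have := sqr_ge0 (a * u t - v t); nra.
Qed.

Lemma sqint0 : sqint (fun=> 0).
Proof.
split; first exact: measurable_cst.
by under eq_integral do rewrite expr0n/=; rewrite integral0.
Qed.

Lemma sqintB u v : sqint u -> sqint v -> sqint (fun t => u t - v t).
Proof.
move=> su sv; have := sqint_linear (-1) sv su.
by congr sqint; apply/funext => t; rewrite mulN1r addrC.
Qed.

Lemma limn_einf_le (x : (\bar R)^nat) (l : \bar R) :
  (forall n, x n <= l)%E -> (limn_einf x <= l)%E.
Proof.
move=> xl; rewrite limn_einf_lim; apply: lime_le; first exact: is_cvg_einfs.
apply: nearW => n; apply: le_trans (xl n).
by apply: ereal_inf_lbound; exists n => /=.
Qed.

(* Along a subsequence w with |w_{k+1} - w_k|^2 <= 8^-k in mean, the function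
   sum_k 4^k |w_{k+1} - w_k|^2 is integrable, hence finite almost everywhere,
   so that w converges geometrically almost everywhere. *)
Lemma fast_cauchy_ae_cvg (w : nat -> T -> R) : (forall k, measurable_fun [set: T] (w k)) ->
  (forall k, \int[mu]_t ((w k.+1 t - w k t) ^+ 2)%:E <= (8^-1 ^+ k)%:E)%E ->
  {ae mu, forall t, cvgn (w ^~ t)}.
Proof.
move=> mw wk.
pose f k t : \bar R := (4 ^+ k * (w k.+1 t - w k t) ^+ 2)%:E.
have f0 k t : (0 <= f k t)%E by rewrite lee_fin mulr_ge0 ?sqr_ge0// exprn_ge0.
have mf k : measurable_fun [set: T] (f k).
  apply/measurable_EFinP; apply: measurable_funM => //.
  by apply: measurable_funX; exact: measurable_funB.
have msum : measurable_fun [set: T] (fun t => \sum_(k <oo) f k t)%E.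
  by apply: ge0_emeasurable_sum => // k t _ _; exact: f0.
have intf : mu.-integrable [set: T] (fun t => \sum_(k <oo) f k t)%E.
  apply/integrableP; split=> //.
  under eq_integral => t _.
    rewrite gee0_abs; last by apply: nneseries_ge0 => k _ _; exact: f0.
    over.
  rewrite integral_nneseries//.
  (* The terms are 4^k 8^-k = 2^-k, written in the form required by [cvg_geometric_eseries_half]. *)
  apply: (@le_lt_trans _ _ (\sum_(k <oo) (2 / (2 ^ (k + 1))%:R)%:E)%E).
    apply: lee_nneseries => k _.
      by move=> _; apply: integral_ge0 => t _; exact: f0.
    rewrite /f; under eq_integral do rewrite EFinM.
    rewrite ge0_integralZl_EFin ?exprn_ge0//; first last.
      by apply: measurable_sqr; exact: measurable_funB.
      by move=> t _; rewrite lee_fin sqr_ge0.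
    apply: (@le_trans _ _ ((4 ^+ k)%:E * (8^-1 ^+ k)%:E)%E).
      by rewrite lee_wpmul2l ?lee_fin ?exprn_ge0.
    rewrite -EFinM lee_fin -exprMn natrX addn1 exprS invfM mulVKf// -exprVn.
    by rewrite (_ : 4 * 8^-1 = 2^-1)//; lra.
  by rewrite (cvg_lim _ (@cvg_geometric_eseries_half R 2 0))// ltry.
apply: filterS (integrable_ae measurableT intf) => t /(_ Logic.I) fint.
set C := fine (\sum_(k <oo) f k t)%E.
have fC k : 4 ^+ k * (w k.+1 t - w k t) ^+ 2 <= C.
  rewrite -lee_fin fineK// (le_trans _ (nneseries_lim_ge k.+1 _))//.
  rewrite big_nat_recr//= leeDr//; apply: sume_ge0 => i _; exact: f0.
have C0 : 0 <= C.
  by rewrite (le_trans _ (fC 0%N))// mulr_ge0 ?sqr_ge0.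
have dw k : `|w k.+1 t - w k t| <= Num.sqrt C * 2^-1 ^+ k.
  rewrite -(@ler_pXn2r _ 2)// ?nnegrE ?mulr_ge0 ?sqrtr_ge0 ?exprn_ge0 ?invr_ge0//.
  rewrite real_normK ?num_real// exprMn sqr_sqrtr// -exprM mulnC exprM.
  rewrite (_ : 2^-1 ^+ 2 = 4^-1); last by lra.
  rewrite exprVn -ler_pdivrMr ?invr_gt0 ?exprn_gt0// invrK mulrC.
  exact: fC.
have : cvgn (series (fun k => w k.+1 t - w k t)).
  apply: normed_cvg; apply: (@series_le_cvg _ _ (geometric (Num.sqrt C) 2^-1)) => //.
  - by move=> n; exact: normr_ge0.
  - by move=> n; rewrite /geometric/= mulr_ge0 ?sqrtr_ge0// exprn_ge0// invr_ge0.
  - by apply: is_cvg_geometric_series; rewrite ger0_norm ?invr_ge0// invf_lt1// ltr1n.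
move=> cs.
have -> : w ^~ t = (fun n => w 0%N t + series (fun k => w k.+1 t - w k t) n).
  apply/funext => n; rewrite /series/= telescope_sumr//.
  by rewrite addrC subrK.
by apply: is_cvgD => //; exact: is_cvg_cst.
Qed.

(** Only a subsequence converges almost everywhere; Fatou's lemma along it then carries the Cauchy
    estimate of the whole sequence over to the limit. *)
Theorem riesz_fischer (u : nat -> T -> R) : (forall k, sqint (u k)) ->
  (forall e : R, 0 < e -> exists k, forall m n, (k <= m)%N -> (k <= n)%N ->
     (\int[mu]_t ((u m t - u n t) ^+ 2)%:E < e%:E)%E) ->
  exists v, sqint v /\ forall e : R, 0 < e -> exists k, forall n, (k <= n)%N ->
     (\int[mu]_t ((u n t - v t) ^+ 2)%:E <= e%:E)%E.
Proof.
move=> su cu.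
have e8 (k : nat) : 0 < 8^-1 ^+ k :> R by rewrite exprn_gt0// invr_gt0.
have [psi psiP] := choice (fun k => cu _ (e8 k)).
(* Summing the thresholds makes [phi] strictly increasing while it stays above both [k] and
   [psi k]. *)
pose phi k := (k + \sum_(i < k.+1) psi i)%N.
have phiS k : phi k.+1 = (phi k + psi k.+1).+1.
  by rewrite /phi [in LHS]big_ord_recr/= addSn addnA.
have psi_phi k : (psi k <= phi k)%N by rewrite /phi big_ord_recr/= addnA leq_addl.
pose w k := u (phi k).
have mw k : measurable_fun [set: T] (w k) by have [] := su (phi k).
have wcvg : {ae mu, forall t, cvgn (w ^~ t)}.
  apply: fast_cauchy_ae_cvg => // k; rewrite ltW// psiP// (leq_trans (psi_phi k))//.
  by rewrite phiS -addnS leq_addr.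
(* The upper limit is measurable on the whole space and agrees with the limit wherever the latter
   exists; infinite values become 0. *)
pose v t := fine (limn_esup (fun k => (w k t)%:E)).
have mv : measurable_fun [set: T] v.
  apply: measurableT_comp; first exact: fine_measurable.
  by apply: measurable_fun_limn_esup => k; exact/measurable_EFinP.
have wv : {ae mu, forall t, w ^~ t @ \oo --> v t}.
  apply: filterS wcvg => t ct.
  have wl : (fun k => (w k t)%:E) @ \oo --> (lim (w ^~ t @ \oo))%:E.
    by apply: cvg_EFin; [exact: nearW | exact: ct].
  by rewrite /v (cvg_limn_einf_sup wl).2.
have close (e : R) k : (forall m n, (k <= m)%N -> (k <= n)%N ->
     (\int[mu]_t ((u m t - u n t) ^+ 2)%:E < e%:E)%E) ->
   forall n, (k <= n)%N -> (\int[mu]_t ((u n t - v t) ^+ 2)%:E <= e%:E)%E.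
  move=> kP n kn.
  have phi_id j : (j <= phi j)%N by exact: leq_addr.
  pose f j t := ((u n t - w (k + j)%N t) ^+ 2)%:E.
  have mun : measurable_fun [set: T] (u n) by have [] := su n.
  have mf j : measurable_fun [set: T] (f j).
    by apply: measurable_sqr; exact: measurable_funB.
  have f0 j t : [set: T] t -> (0 <= f j t)%E by move=> _; rewrite lee_fin sqr_ge0.
  apply: (@le_trans _ _ (\int[mu]_t limn_einf (f ^~ t))%E).
    apply: ae_ge0_le_integral => //.
    - by move=> t _; rewrite lee_fin sqr_ge0.
    - by apply: measurable_sqr; exact: measurable_funB.
    - move=> t _; rewrite limn_einf_lim; apply: lime_ge; first exact: is_cvg_einfs.
      by apply: nearW => j; apply: le_ereal_inf_tmp => _ [i _ <-]; exact: f0.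
    - rewrite /limn_einf; apply: measurableT_comp => //.
      by apply: measurable_fun_limn_esup => j; exact: measurableT_comp.
    - apply: filterS wv => t wt _.
      have fl : f ^~ t @ \oo --> ((u n t - v t) ^+ 2)%:E.
        apply: cvg_EFin; first exact: nearW.
        have wk : (fun j => w (k + j)%N t) @ \oo --> v t.
          have := wt; rewrite -(cvg_shiftn k (w ^~ t)).
          rewrite (_ : (fun j => w (k + j)%N t) = [sequence w (j + k)%N t]_j)//.
          by apply/funext => j /=; rewrite addnC.
        have d1 : (fun j => u n t - w (k + j)%N t) @ \oo --> u n t - v t.
          by apply: cvgB => //; exact: cvg_cst.
        exact: (cvgM d1 d1).
      by rewrite (cvg_limn_einf_sup fl).1.
  apply: (le_trans (fatou mu measurableT mf f0)).
  apply: limn_einf_le => j; apply/ltW/kP => //.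
  by rewrite (leq_trans _ (phi_id _))// leq_addr.
exists v; split; last first.
  by move=> e e0; have [k kP] := cu e e0; exists k; exact: close.
have [k kP] := cu 1 ltr01.
have h : sqint (fun t => u k t - v t).
  split; first by apply: measurable_funB => //; have [] := su k.
  by rewrite (le_lt_trans (close 1 k kP k (leqnn k)))// ltry.
have := sqintB (su k) h.
by congr sqint; apply/funext => t; rewrite opprB addrC subrK.
Qed.

End SquareIntegrable.

Section LebesgueAlmostEverywhere.
Variable R : realType.
Local Notation mu := (@lebesgue_measure R).
Implicit Types P Q S : R -> Prop.

#[local] Instance lebesgue_ae_filter : Filter (almost_everywhere mu).
Proof. exact: (@ae_filter_ringOfSetsType _ (measurableTypeR R) R mu). Qed.

Lemma ae_impl P Q : (forall t, P t -> Q t) ->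
  {ae mu, forall t, P t} -> {ae mu, forall t, Q t}.
Proof. by move=> PQ; exact: filterS. Qed.

Lemma ae_impl2 P Q S : (forall t, P t -> Q t -> S t) ->
  {ae mu, forall t, P t} -> {ae mu, forall t, Q t} -> {ae mu, forall t, S t}.
Proof. by move=> PQS; exact: filterS2. Qed.

End LebesgueAlmostEverywhere.

(** * Complex integrals and the inner product of L^2 *)

Section ComplexIntegral.
Variable R : realType.
Local Notation mu := (@lebesgue_measure R).
Implicit Types (F G : R -> R[i]) (c : R[i]).

Lemma Re_mulc (z w : R[i]) : complex.Re (z * w) =
  complex.Re z * complex.Re w - complex.Im z * complex.Im w.
Proof. by case: z; case: w. Qed.

Lemma Im_mulc (z w : R[i]) : complex.Im (z * w) =
  complex.Re z * complex.Im w + complex.Im z * complex.Re w.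
Proof. by case: z; case: w. Qed.

Lemma ImD (z w : R[i]) : complex.Im (z + w) = complex.Im z + complex.Im w.
Proof. by case: z; case: w. Qed.

Lemma ImJ (z : R[i]) : complex.Im z^*%C = - complex.Im z.
Proof. by case: z. Qed.

Lemma eqc (z w : R[i]) : complex.Re z = complex.Re w -> complex.Im z = complex.Im w -> z = w.
Proof. by case: z; case: w => a b c d /= -> ->. Qed.

Definition cintegrable F :=
  mu.-integrable [set: measurableTypeR R] (EFin \o (fun t => complex.Re (F t))) /\
  mu.-integrable [set: measurableTypeR R] (EFin \o (fun t => complex.Im (F t))).

Definition cint F : R[i] :=
  Rintegral mu [set: measurableTypeR R] (fun t => complex.Re (F t)) +i*
  Rintegral mu [set: measurableTypeR R] (fun t => complex.Im (F t)).

Lemma integrable_combine (u v : R -> R) (a b : R) :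
  mu.-integrable [set: measurableTypeR R] (EFin \o u) ->
  mu.-integrable [set: measurableTypeR R] (EFin \o v) ->
  mu.-integrable [set: measurableTypeR R] (EFin \o (fun t => a * u t + b * v t)).
Proof.
move=> iu iv.
exact: (integrableD measurableT (integrableZl measurableT a iu) (integrableZl measurableT b iv)).
Qed.

Lemma Rintegral_combine (u v : R -> R) (a b : R) :
  mu.-integrable [set: measurableTypeR R] (EFin \o u) ->
  mu.-integrable [set: measurableTypeR R] (EFin \o v) ->
  Rintegral mu [set: measurableTypeR R] (fun t => a * u t + b * v t) =
  a * Rintegral mu [set: measurableTypeR R] u + b * Rintegral mu [set: measurableTypeR R] v.
Proof.
move=> iu iv; have iau := integrableZl measurableT a iu.
have ibv := integrableZl measurableT b iv.
by rewrite RintegralD// !RintegralZl.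
Qed.

Lemma cintegrable_linear c F G : cintegrable F -> cintegrable G ->
  cintegrable (fun t => c * F t + G t) /\
  cint (fun t => c * F t + G t) = c * cint F + cint G.
Proof.
move=> [rF iF] [rG iG].
have reE : (fun t => complex.Re (c * F t + G t)) =
    (fun t => 1 * (complex.Re c * complex.Re (F t) + - complex.Im c * complex.Im (F t)) +
       1 * complex.Re (G t)).
  by apply/funext => t; rewrite ReD Re_mulc !mul1r mulNr.
have imE : (fun t => complex.Im (c * F t + G t)) =
    (fun t => 1 * (complex.Re c * complex.Im (F t) + complex.Im c * complex.Re (F t)) +
       1 * complex.Im (G t)).
  by apply/funext => t; rewrite ImD Im_mulc !mul1r.
have i1 := integrable_combine (complex.Re c) (- complex.Im c) rF iF.
have i2 := integrable_combine (complex.Re c) (complex.Im c) iF rF.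
split; first by rewrite /cintegrable reE imE; split; exact: integrable_combine.
rewrite /cint reE imE (Rintegral_combine 1 1 i1 rG) (Rintegral_combine 1 1 i2 iG).
rewrite !Rintegral_combine//.
by apply: eqc; rewrite ?ReD ?ImD ?Re_mulc ?Im_mulc/=; ring.
Qed.

Lemma cint_conj F : cintegrable F -> cint (fun t => (F t)^*%C) = (cint F)^*%C.
Proof.
move=> [_ iF]; rewrite /cint/=; congr (_ +i* _).
  by congr Rintegral; apply/funext => t; rewrite ReJ.
have := Rintegral_combine (-1) 0 iF iF; rewrite mul0r addr0 mulN1r => <-.
by congr Rintegral; apply/funext => t; rewrite ImJ mul0r addr0 mulN1r.
Qed.

End ComplexIntegral.

Section ComplexL2.
Variable R : realType.
Local Notation mu := (@lebesgue_measure R).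
Local Notation sqint := (sqint mu).
Implicit Types (f g h : R -> R[i]) (c : R[i]).

Lemma L2norm_poweR f : L2norm f =
  ((\int[mu]_t (complex.Re (f t) ^+ 2 + complex.Im (f t) ^+ 2)%:E) `^ 2^-1)%E.
Proof.
rewrite /L2norm unlock; congr (_ `^ _)%E; apply: eq_integral => t _ /=.
by rewrite ger0_norm ?normc_ge0// powR_mulrn ?normc_ge0// normc_sqr.
Qed.

Lemma L2_sqint f :
  L2 f <-> sqint (fun t => complex.Re (f t)) /\ sqint (fun t => complex.Im (f t)).
Proof.
rewrite /L2 L2norm_poweR; split.
  move=> [mr mi /(lty_poweRy _)]; rewrite invr_eq0 pnatr_eq0 => /(_ isT) foo.
  split; split=> //; apply: le_lt_trans foo; apply: ge0_le_integral => //.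
  - by move=> t _; rewrite lee_fin sqr_ge0.
  - exact: measurable_sqr.
  - by apply/measurable_EFinP; apply: measurable_funD; exact: measurable_funX.
  - by move=> t _; rewrite lee_fin lerDl sqr_ge0.
  - by move=> t _; rewrite lee_fin sqr_ge0.
  - exact: measurable_sqr.
  - by apply/measurable_EFinP; apply: measurable_funD; exact: measurable_funX.
  - by move=> t _; rewrite lee_fin lerDr sqr_ge0.
move=> [[mr ro] [mi io]]; split=> //; apply: poweR_lty.
under eq_integral do rewrite EFinD.
rewrite ge0_integralD//; first exact: lte_add_pinfty.
- by move=> t _; rewrite lee_fin sqr_ge0.
- exact: measurable_sqr.
- by move=> t _; rewrite lee_fin sqr_ge0.
- exact: measurable_sqr.
Qed.

Lemma L2_linear c f g : L2 f -> L2 g -> L2 (fun t => c * f t + g t).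
Proof.
move=> /L2_sqint[rf jf] /L2_sqint[rg jg]; apply/L2_sqint; split.
  have := sqint_linear (complex.Re c) rf (sqint_linear (- complex.Im c) jf rg).
  by congr sqint; apply/funext => t; rewrite ReD Re_mulc mulNr addrA.
have := sqint_linear (complex.Re c) jf (sqint_linear (complex.Im c) rf jg).
by congr sqint; apply/funext => t; rewrite ImD Im_mulc addrA.
Qed.

Lemma L2_0 : L2 (fun=> 0 : R[i]).
Proof. by apply/L2_sqint; split; exact: sqint0. Qed.

Lemma innerE f g : inner f g = cint (fun t => f t * (g t)^*%C).
Proof. by []. Qed.

Lemma inner_integrable f g : L2 f -> L2 g -> cintegrable (fun t => f t * (g t)^*%C).
Proof.
move=> /L2_sqint[rf jf] /L2_sqint[rg jg]; split.
  have := integrable_combine 1 1 (sqint_mul rf rg) (sqint_mul jf jg).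
  congr (_.-integrable _ _); apply/funext => t /=; congr EFin.
  by rewrite Re_mulc ReJ ImJ !mul1r mulrN opprK.
have := integrable_combine (-1) 1 (sqint_mul rf jg) (sqint_mul jf rg).
congr (_.-integrable _ _); apply/funext => t /=; congr EFin.
by rewrite Im_mulc ReJ ImJ mul1r mulN1r mulrN.
Qed.

Lemma inner_linear c f g h : L2 f -> L2 g -> L2 h ->
  inner (fun t => c * f t + g t) h = c * inner f h + inner g h.
Proof.
move=> Lf Lg Lh; rewrite !innerE.
have [_ <-] := cintegrable_linear c (inner_integrable Lf Lh) (inner_integrable Lg Lh).
by congr cint; apply/funext => t; ring.
Qed.

Lemma innerC f g : L2 f -> L2 g -> inner g f = (inner f g)^*%C.
Proof.
move=> Lf Lg; rewrite !innerE -cint_conj; last exact: inner_integrable.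
by congr cint; apply/funext => t; rewrite rmorphM/= conjcK mulrC.
Qed.

Lemma inner_self f : L2 f -> L2norm f = (Num.sqrt (complex.Re (inner f f)))%:E /\
  (\int[mu]_t (complex.Re (f t) ^+ 2 + complex.Im (f t) ^+ 2)%:E =
   (complex.Re (inner f f))%:E)%E /\ inner f f = (complex.Re (inner f f))%:C.
Proof.
move=> Lf; have [/integrable_fin_num fin _] := inner_integrable Lf Lf.
have E : (\int[mu]_t (complex.Re (f t) ^+ 2 + complex.Im (f t) ^+ 2)%:E =
   (complex.Re (inner f f))%:E)%E.
  rewrite /= /Rintegral fineK ?fin//.
  by apply: eq_integral => t _ /=; rewrite Re_mulc ReJ ImJ mulrN opprK -!expr2.
split; last split=> //.
  rewrite L2norm_poweR E poweR_EFin; congr EFin.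
  by rewrite powR12_sqrt// -lee_fin -E integral_ge0// => t _; rewrite lee_fin addr_ge0 ?sqr_ge0.
rewrite innerE /cint; congr (_ +i* _).
rewrite (_ : (fun t => _) = fun=> 0) ?Rintegral_cst ?mul0r//.
by apply/funext => t; rewrite Im_mulc ReJ ImJ mulrN mulrC addNr.
Qed.

Lemma ae_equal_L2norm0 f : L2 f -> (ae_equal f (fun=> 0) <-> complex.Re (inner f f) = 0).
Proof.
move=> Lf; have [_ [E _]] := inner_self Lf; have [mr mi _] := Lf.
pose F t := (complex.Re (f t) ^+ 2 + complex.Im (f t) ^+ 2)%:E.
have mF : measurable_fun [set: measurableTypeR R] F.
  by apply/measurable_EFinP; apply: measurable_funD; exact: measurable_funX.
have absF : (\int[mu]_t `|F t|)%E = (complex.Re (inner f f))%:E.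
  rewrite -E; apply: eq_integral => t _.
  by rewrite gee0_abs// lee_fin addr_ge0 ?sqr_ge0.
have := ae_eq_integral_abs mu measurableT mF; rewrite absF => -[h1 h2].
split.
  move=> f0; suff /h2 [//] : ae_eq mu setT F (cst 0%E).
  by apply: ae_impl f0 => t /(_ Logic.I) ft _; rewrite /F ft/= expr0n/= addr0.
move=> f0; rewrite f0 in h1; apply: ae_impl (h1 erefl) => t /(_ Logic.I) [/eqP].
rewrite paddr_eq0 ?sqr_ge0// !sqrf_eq0 => /andP[/eqP r0 /eqP i0] _.
exact: eqc.
Qed.

Lemma ae_equal_sub f g : ae_equal f g <-> ae_equal (fun t => -1 * f t + g t) (fun=> 0).
Proof.
rewrite /ae_equal; split=> fg; apply: ae_impl fg => t fg _; first by rewrite fg// mulN1r addNr.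
by have /eqP := fg Logic.I; rewrite mulN1r addrC subr_eq0 => /eqP.
Qed.

Lemma ae_equal_inner f f' g : L2 f -> L2 f' -> L2 g -> ae_equal f f' ->
  inner f g = inner f' g.
Proof.
move=> Lf Lf' Lg ff'.
have [rf jf] := inner_integrable Lf Lg; have [rf' jf'] := inner_integrable Lf' Lg.
rewrite !innerE /cint /Rintegral; congr (fine _ +i* fine _).
  apply: ae_eq_integral => //; [exact: measurable_int rf|exact: measurable_int rf'|].
  by apply: ae_impl ff' => t e _; rewrite /= e.
apply: ae_eq_integral => //; [exact: measurable_int jf|exact: measurable_int jf'|].
by apply: ae_impl ff' => t e _; rewrite /= e.
Qed.

End ComplexL2.

(** * L^2 modulo almost everywhere equality *)

Section L2Quotient.
Variable R : realType.
Local Notation mu := (@lebesgue_measure R).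
Implicit Types (f g h : R -> R[i]) (c : R[i]).

Lemma ae_equal_refl f : ae_equal f f. Proof. exact: aeW. Qed.

Lemma ae_equal_sym f g : ae_equal f g -> ae_equal g f.
Proof. by apply: ae_impl => t e ?; rewrite e. Qed.

Lemma ae_equal_trans f g h : ae_equal f g -> ae_equal g h -> ae_equal f h.
Proof. by apply: ae_impl2 => t e1 e2 ?; rewrite e1// e2. Qed.

Lemma ae_equal_linear c f f' g g' : ae_equal f f' -> ae_equal g g' ->
  ae_equal (fun t => c * f t + g t) (fun t => c * f' t + g' t).
Proof. by apply: ae_impl2 => t e1 e2 ?; rewrite e1// e2. Qed.

(** The choice is made from the class as a set, so functions that agree almost everywhere receive
    the very same representative. *)
Definition canon f := xget (fun=> 0 : R[i]) [set h | L2 h /\ ae_equal h f].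

Lemma canonP f : L2 f -> L2 (canon f) /\ ae_equal (canon f) f.
Proof.
move=> Lf; apply: (xgetPex (fun=> 0) (P := [set h | L2 h /\ ae_equal h f])).
by exists f; split=> //; exact: ae_equal_refl.
Qed.

Lemma canon_eq f g : ae_equal f g -> canon f = canon g.
Proof.
move=> fg; congr xget; apply/seteqP; split=> h [Lh hf]; split=> //.
  exact: ae_equal_trans hf fg.
exact: ae_equal_trans hf (ae_equal_sym fg).
Qed.

Lemma canon_id f : L2 f -> canon (canon f) = canon f.
Proof. by move=> /canonP[_ /canon_eq]. Qed.

(* L^2 is realized by canonical representatives of the almost everywhere
   classes, so that equality in [L2space] is Leibniz equality. *)
Definition L2space := {f : R -> R[i] | `[< L2 f /\ canon f = f >]}.
HB.instance Definition _ := Choice.on L2space.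
Implicit Types (x y z : L2space).

Lemma L2_val x : L2 (val x). Proof. by case: x => f /= /asboolP[]. Qed.

Lemma cls_subproof f : `[< L2 (canon (if `[< L2 f >] then f else fun=> 0)) /\
  canon (canon (if `[< L2 f >] then f else fun=> 0)) =
  canon (if `[< L2 f >] then f else fun=> 0) >].
Proof.
have L : L2 (if `[< L2 f >] then f else fun=> 0).
  by case: asboolP => // _; exact: L2_0.
by apply/asboolP; split; [exact: (canonP L).1 | exact: canon_id].
Qed.

(** Defined on all functions, with the class of 0 as value outside L^2, so that no membership proof
    enters the terms. *)
Definition cls f : L2space :=
  exist (fun h => `[< L2 h /\ canon h = h >])
    (canon (if `[< L2 f >] then f else fun=> 0)) (cls_subproof f).

Lemma val_cls f : L2 f -> ae_equal (val (cls f)) f.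
Proof. by move=> Lf; rewrite /= asboolT//; exact: (canonP Lf).2. Qed.

Lemma cls_eq f g : L2 f -> L2 g -> ae_equal f g -> cls f = cls g.
Proof. by move=> Lf Lg fg; apply/val_inj; rewrite /= !asboolT//; exact: canon_eq. Qed.

Lemma cls_inj f g : L2 f -> L2 g -> cls f = cls g -> ae_equal f g.
Proof.
move=> Lf Lg fg; apply: ae_equal_trans (ae_equal_sym (val_cls Lf)) _.
by rewrite fg; exact: val_cls.
Qed.

Lemma valK' x : cls (val x) = x.
Proof.
by apply/val_inj; case: x => f Pf; rewrite /= asboolT; case/asboolP: Pf.
Qed.

(** Sum, opposite and scalar multiple are all instances of this operation, so compatibility with
    classes is checked once, in [L2comb_cls]. *)
Definition L2comb c x y : L2space := cls (fun t => c * val x t + val y t).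

Lemma L2comb_cls c f g : L2 f -> L2 g ->
  L2comb c (cls f) (cls g) = cls (fun t => c * f t + g t).
Proof.
move=> Lf Lg; apply: cls_eq; [exact/L2_linear/L2_val/L2_val|exact: L2_linear|].
by apply: ae_equal_linear; exact: val_cls.
Qed.

Lemma cls_ext f g : f =1 g -> cls f = cls g.
Proof. by move=> /funext ->. Qed.

Definition L2add x y := L2comb 1 x y.
Definition L2zero := cls (fun=> 0).
Definition L2opp x := L2comb (-1) x L2zero.
Definition L2scale c x := L2comb c x L2zero.

Lemma L2scaleE c f : L2 f -> L2scale c (cls f) = cls (fun t => c * f t).
Proof.
move=> Lf; rewrite /L2scale L2comb_cls//; last exact: L2_0.
by apply: cls_ext => t; rewrite addr0.
Qed.

Lemma L2_scale c f : L2 f -> L2 (fun t => c * f t).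
Proof.
move=> Lf; have := L2_linear c Lf (@L2_0 R); congr L2.
by apply/funext => t; rewrite addr0.
Qed.

Lemma L2_add f g : L2 f -> L2 g -> L2 (fun t => f t + g t).
Proof.
move=> Lf Lg; have := L2_linear 1 Lf Lg; congr L2.
by apply/funext => t; rewrite mul1r.
Qed.

Lemma L2addE f g : L2 f -> L2 g -> L2add (cls f) (cls g) = cls (fun t => f t + g t).
Proof.
by move=> Lf Lg; rewrite /L2add L2comb_cls//; apply: cls_ext => t; rewrite mul1r.
Qed.

Lemma L2addA : associative L2add.
Proof.
move=> x y z; rewrite -[x]valK' -[y]valK' -[z]valK'.
have := L2_val x; have := L2_val y; have := L2_val z.
move: (val x) (val y) (val z) => f g h Lh Lg Lf.
rewrite !L2addE//; try exact: L2_add.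
by apply: cls_ext => t; rewrite addrA.
Qed.

Lemma L2addC : commutative L2add.
Proof.
move=> x y; rewrite -[x]valK' -[y]valK' !L2addE; try exact: L2_val.
by apply: cls_ext => t; rewrite addrC.
Qed.

Lemma L2add0 : left_id L2zero L2add.
Proof.
move=> x; rewrite -[x in LHS]valK' L2addE; [|exact: L2_0|exact: L2_val].
by rewrite -[RHS]valK'; apply: cls_ext => t; rewrite add0r.
Qed.

Lemma L2addN : left_inverse L2zero L2opp L2add.
Proof.
move=> x; rewrite -[x]valK' /L2opp -/(L2scale _ _) L2scaleE; last exact: L2_val.
rewrite L2addE; [|exact/L2_scale/L2_val|exact: L2_val].
by apply: cls_ext => t; rewrite mulN1r addNr.
Qed.

HB.instance Definition _ := GRing.isZmodule.Build L2space L2addA L2addC L2add0 L2addN.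

Lemma L2scaleA a c x : L2scale a (L2scale c x) = L2scale (a * c) x.
Proof.
rewrite -[x]valK' !L2scaleE; try exact: L2_val; try exact/L2_scale/L2_val.
by apply: cls_ext => t; rewrite mulrA.
Qed.

Lemma L2scale1 : left_id 1 L2scale.
Proof.
move=> x; rewrite -[x in LHS]valK' L2scaleE; last exact: L2_val.
rewrite -[RHS]valK'.
by apply: cls_ext => t; rewrite mul1r.
Qed.

Lemma L2scaleDr : right_distributive L2scale +%R.
Proof.
move=> c x y; rewrite -[x]valK' -[y]valK'.
have := L2_val x; have := L2_val y; move: (val x) (val y) => f g Lg Lf.
rewrite -[cls f + _]/(L2add _ _) -[RHS]/(L2add _ _) L2addE// !L2scaleE//; last exact: L2_add.
rewrite L2addE; try exact: L2_scale.
by apply: cls_ext => t; rewrite mulrDr.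
Qed.

Lemma L2scaleDl x : {morph L2scale^~ x : a c / a + c}.
Proof.
move=> a c; rewrite -[x]valK' -[RHS]/(L2add _ _) !L2scaleE; try exact: L2_val.
rewrite L2addE; try exact/L2_scale/L2_val.
by apply: cls_ext => t; rewrite mulrDl.
Qed.

HB.instance Definition _ := GRing.Zmodule_isLmodule.Build R[i] L2space
  L2scaleA L2scale1 L2scaleDr L2scaleDl.

Lemma cls_linear c f g : L2 f -> L2 g ->
  cls (fun t => c * f t + g t) = c *: cls f + cls g.
Proof.
move=> Lf Lg; rewrite -[_ + _]/(L2add _ _) -[_ *: _]/(L2scale _ _) L2scaleE// L2addE//.
exact: L2_scale.
Qed.

Lemma cls_scale c f : L2 f -> cls (fun t => c * f t) = c *: cls f.
Proof. by move=> Lf; rewrite -[RHS]/(L2scale _ _) L2scaleE. Qed.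

Lemma cls_add f g : L2 f -> L2 g -> cls (fun t => f t + g t) = cls f + cls g.
Proof. by move=> Lf Lg; rewrite -[RHS]/(L2add _ _) L2addE. Qed.

Lemma L2_sub f g : L2 f -> L2 g -> L2 (fun t => f t - g t).
Proof.
move=> Lf Lg; have := L2_add Lf (L2_scale (-1) Lg); congr L2.
by apply/funext => t; rewrite mulN1r.
Qed.

Lemma cls_sub f g : L2 f -> L2 g -> cls (fun t => f t - g t) = cls f - cls g.
Proof.
move=> Lf Lg; rewrite -scaleN1r -cls_scale// -cls_add//; last exact: L2_scale.
by apply: cls_ext => t; rewrite mulN1r.
Qed.

Lemma cls0 : cls (fun=> 0) = 0. Proof. by []. Qed.

Lemma cls_sum (I : Type) (s : seq I) (F : I -> R -> R[i]) : (forall i, L2 (F i)) ->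
  L2 (fun t => \sum_(i <- s) F i t) /\
  cls (fun t => \sum_(i <- s) F i t) = \sum_(i <- s) cls (F i).
Proof.
move=> LF; elim: s => [|i s [Ls IH]].
  rewrite big_nil (_ : (fun t => _) = fun=> 0); last by apply/funext => t; rewrite big_nil.
  by split; [exact: L2_0 | exact: cls0].
rewrite big_cons -IH -cls_add//.
rewrite (_ : (fun t => _) = fun t => F i t + \sum_(i <- s) F i t).
  by split; [exact: L2_add|].
by apply/funext => t; rewrite big_cons.
Qed.

Definition L2dot x y : R[i] := inner (val x) (val y).

Lemma L2dot_cls f g : L2 f -> L2 g -> L2dot (cls f) (cls g) = inner f g.
Proof.
move=> Lf Lg; rewrite /L2dot (ae_equal_inner (L2_val _) Lf (L2_val _) (val_cls Lf)).
rewrite (innerC (L2_val _) Lf) (ae_equal_inner (L2_val _) Lg Lf (val_cls Lg)).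
by rewrite -innerC.
Qed.

Lemma L2dot_linear c x y z : L2dot (c *: x + y) z = c * L2dot x z + L2dot y z.
Proof.
have [Lx Ly] := (L2_val x, L2_val y).
have -> : c *: x + y = cls (fun t => c * val x t + val y t) by rewrite cls_linear// !valK'.
rewrite -{1}[z]valK' L2dot_cls; [|exact: L2_linear|exact: L2_val].
by apply: inner_linear => //; exact: L2_val.
Qed.

Lemma L2dotC x y : L2dot y x = (L2dot x y)^*%C.
Proof. by rewrite /L2dot innerC//; exact: L2_val. Qed.

Lemma L2dot_gt0 x : x != 0 -> 0 < L2dot x x.
Proof.
rewrite /L2dot; have [_ [E ->]] := inner_self (L2_val x); rewrite ltcR => x0.
have I0 : 0 <= complex.Re (inner (val x) (val x)).
  by rewrite -lee_fin -E integral_ge0// => t _; rewrite lee_fin addr_ge0 ?sqr_ge0.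
rewrite lt_def I0 andbT; apply: contra x0 => /eqP e.
rewrite -[x]valK' -cls0; apply/eqP/cls_eq; [exact: L2_val|exact: L2_0|].
by apply/ae_equal_L2norm0 => //; exact: L2_val.
Qed.

Lemma L2complete (u : nat -> L2space) :
  (forall e : R, 0 < e -> exists k, forall m n, (k <= m)%N -> (k <= n)%N ->
     complex.Re (L2dot (u m - u n) (u m - u n)) < e) ->
  exists l, forall e : R, 0 < e -> exists k, forall n, (k <= n)%N ->
     complex.Re (L2dot (u n - l) (u n - l)) < e.
Proof.
move=> cu.
have Re_dot f g : L2 f -> L2 g ->
    (complex.Re (L2dot (cls f - cls g) (cls f - cls g)))%:E =
    (\int[mu]_t ((complex.Re (f t) - complex.Re (g t)) ^+ 2)%:E +
     \int[mu]_t ((complex.Im (f t) - complex.Im (g t)) ^+ 2)%:E)%E.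
  move=> Lf Lg; have Lfg := L2_sub Lf Lg.
  rewrite -cls_sub// L2dot_cls//; have [_ [<- _]] := inner_self Lfg.
  move/L2_sqint : Lf => [[mrf _] [mif _]]; move/L2_sqint : Lg => [[mrg _] [mig _]].
  rewrite -ge0_integralD//.
  - by apply: eq_integral => t _; rewrite -EFinD; case: (f t) (g t) => a b [c d].
  - by move=> t _; rewrite lee_fin sqr_ge0.
  - by apply: measurable_sqr; exact: measurable_funB.
  - by move=> t _; rewrite lee_fin sqr_ge0.
  - by apply: measurable_sqr; exact: measurable_funB.
have sr k := (L2_sqint _).1 (L2_val (u k)).
have [e e0|vr [svr vrP]] := riesz_fischer (fun k => (sr k).1).
  have [k kP] := cu e e0; exists k => m n km kn; have := kP m n km kn.
  rewrite -lte_fin -[u m]valK' -[u n]valK' Re_dot; try exact: L2_val.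
  rewrite !valK' => h; apply: le_lt_trans h.
  by rewrite leeDl// integral_ge0// => t _; rewrite lee_fin sqr_ge0.
have [e e0|vi [svi viP]] := riesz_fischer (fun k => (sr k).2).
  have [k kP] := cu e e0; exists k => m n km kn; have := kP m n km kn.
  rewrite -lte_fin -[u m]valK' -[u n]valK' Re_dot; try exact: L2_val.
  rewrite !valK' => h; apply: le_lt_trans h.
  by rewrite leeDr// integral_ge0// => t _; rewrite lee_fin sqr_ge0.
have Lv : L2 (fun t => vr t +i* vi t) by apply/L2_sqint.
exists (cls (fun t => vr t +i* vi t)) => e e0.
(* Thirds for two summands: the bounds from [riesz_fischer] are not strict, the required one is. *)
have e3 : 0 < e / 3 by rewrite divr_gt0.
have [k kP] := vrP _ e3; have [j jP] := viP _ e3.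
exists (maxn k j) => n; rewrite geq_max => /andP[kn jn].
rewrite -lte_fin -[u n]valK' Re_dot//; last exact: L2_val.
apply: (le_lt_trans (leeD (kP n kn) (jP n jn))).
by rewrite -EFinD lte_fin; lra.
Qed.

Definition L2hilbert : hilbertSpace R :=
  HilbertSpace L2dot_linear L2dotC L2dot_gt0 L2complete.

Lemma dot_cls f g : L2 f -> L2 g ->
  dot (cls f : L2hilbert) (cls g : L2hilbert) = inner f g.
Proof. exact: L2dot_cls. Qed.

Lemma L2norm_cls f : L2 f -> L2norm f = (hnorm (cls f : L2hilbert))%:E.
Proof.
by move=> Lf; have [-> _] := inner_self Lf; rewrite /hnorm /sqnorm dot_cls.
Qed.

End L2Quotient.

(** * Time-frequency shifts *)

Section Translation.
Variable R : realType.
Local Notation mu := (@lebesgue_measure R).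
Implicit Types (s : R).

Lemma measurable_shift s :
  measurable_fun [set: measurableTypeR R] (fun t : R => (t - s : measurableTypeR R)).
Proof. by apply: measurable_funB => //; exact: measurable_cst. Qed.

(** Lebesgue measure is determined by its values on half-open intervals, so translation invariance
    reduces to comparing lengths. *)
Lemma lebesgue_measure_shift s (A : set R) : measurable A ->
  pushforward mu (fun t : measurableTypeR R => (t - s : measurableTypeR R)) A = mu A.
Proof.
move=> mA; pose phi := (fun t : measurableTypeR R => (t - s : measurableTypeR R)).
have mphi : measurable_fun setT phi by exact: measurable_shift.
pose mphi_mixin := isMeasurableFun.Build _ _ _ _ _ mphi.
pose mphi_pack : {mfun measurableTypeR R >-> measurableTypeR R} := HB.pack phi mphi_mixin.
apply/esym/(lebesgue_measure_unique (mu := pushforward mu mphi_pack)) => //= _ [[x y]] _ <-.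
rewrite /pushforward /=.
have -> : phi @^-1` [set` `]x, y]%R] = [set` `](x + s)%R, (y + s)%R]%R].
  by apply/seteqP; split => t /=; rewrite !in_itv/= /phi ltrBrDr lerBlDr.
by rewrite !lebesgue_measure_itv/= !lte_fin ltrD2r -!EFinB opprD addrACA subrr addr0.
Qed.

Lemma integral_shift s (f : R -> \bar R) : measurable_fun [set: measurableTypeR R] f ->
  (\int[mu]_t f (t - s)%R = \int[mu]_t f t)%E.
Proof.
have ge0_shift (h : R -> \bar R) : measurable_fun [set: measurableTypeR R] h ->
    (forall t, 0 <= h t)%E -> (\int[mu]_t h (t - s)%R = \int[mu]_t h t)%E.
  move=> mh h0.
  have := ge0_integral_pushforward (measurable_shift s) mu measurableT mh.
  rewrite preimage_setT => <- //.
  apply: eq_measure_integral; first exact: measurable_shift.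
  by move=> mphi A mA _; exact: lebesgue_measure_shift.
move=> mf; rewrite integralE [RHS]integralE.
congr (_ - _)%E.
  rewrite -(ge0_shift (f^\+)%E); [|exact: measurable_funepos|by []].
  by rewrite -/(f \o (fun t => t - s)) funepos_comp.
rewrite -(ge0_shift (f^\-)%E); [|exact: measurable_funeneg|by []].
by rewrite -/(f \o (fun t => t - s)) funeneg_comp.
Qed.

Lemma measurable_comp_shift s (u : R -> R) :
  measurable_fun [set: measurableTypeR R] u ->
  measurable_fun [set: measurableTypeR R] (fun t => u (t - s)).
Proof. by move=> m; apply: measurableT_comp m (measurable_shift s). Qed.

End Translation.

Section TimeFrequencyShifts.
Variables (R : realType) (a b : R).
Local Notation mu := (@lebesgue_measure R).
Implicit Types (f g h : R -> R[i]) (p q : int * int) (x y : R).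

Definition cis x : R[i] := cos x +i* sin x.

Lemma cisD x y : cis (x + y) = cis x * cis y.
Proof. by rewrite /cis cosD sinD; simpc; congr (_ +i* _); ring. Qed.

Lemma normc_cis x : Normc.normc (cis x) = 1.
Proof. by rewrite /= cos2Dsin2 sqrtr1. Qed.

Lemma cisK x : cis x * (cis x)^*%C = 1.
Proof. by rewrite mulcJ normc_cis expr1n. Qed.

Lemma measurable_cos_lin (c : R) :
  measurable_fun [set: measurableTypeR R] (fun t : R => cos (c * t)).
Proof.
apply: measurableT_comp; last exact: measurable_funM.
exact: (continuous_measurable_fun (@continuous_cos R)).
Qed.

Lemma measurable_sin_lin (c : R) :
  measurable_fun [set: measurableTypeR R] (fun t : R => sin (c * t)).
Proof.
apply: measurableT_comp; last exact: measurable_funM.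
exact: (continuous_measurable_fun (@continuous_sin R)).
Qed.

Local Notation tfs f p := (modulated_shift f a b p.1 p.2).

Lemma tfsE f p t : tfs f p t =
  cis (2 * pi * (p.2%:~R * b) * t) * f (t - p.1%:~R * a).
Proof. by []. Qed.

Lemma tfs_linear (c : R[i]) f g p :
  tfs (fun t => c * f t + g t) p = (fun t => c * tfs f p t + tfs g p t).
Proof. by apply/funext => t; rewrite !tfsE; ring. Qed.

Lemma tfs_conj f g p t : tfs f p t * (tfs g p t)^*%C =
  f (t - p.1%:~R * a) * (g (t - p.1%:~R * a))^*%C.
Proof. by rewrite !tfsE rmorphM/= mulrACA cisK mul1r. Qed.

Lemma L2_tfs f p : L2 f -> L2 (tfs f p).
Proof.
move=> Lf; have [mr mi _] := Lf; have [E [I _]] := inner_self Lf.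
have mr' := measurable_comp_shift (p.1%:~R * a) mr.
have mi' := measurable_comp_shift (p.1%:~R * a) mi.
split.
- rewrite (_ : (fun t => _) = (fun t =>
      cos (2 * pi * (p.2%:~R * b) * t) * complex.Re (f (t - p.1%:~R * a)) -
      sin (2 * pi * (p.2%:~R * b) * t) * complex.Im (f (t - p.1%:~R * a)))).
    apply: measurable_funB; apply: measurable_funM => //.
      exact: measurable_cos_lin.
    exact: measurable_sin_lin.
  by apply/funext => t; rewrite tfsE Re_mulc.
- rewrite (_ : (fun t => _) = (fun t =>
      cos (2 * pi * (p.2%:~R * b) * t) * complex.Im (f (t - p.1%:~R * a)) +
      sin (2 * pi * (p.2%:~R * b) * t) * complex.Re (f (t - p.1%:~R * a)))).
    apply: measurable_funD; apply: measurable_funM => //.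
      exact: measurable_cos_lin.
    exact: measurable_sin_lin.
  by apply/funext => t; rewrite tfsE Im_mulc.
- rewrite L2norm_poweR; apply: poweR_lty.
  under eq_integral do rewrite -normc_sqr tfsE Normc.normcM normc_cis mul1r normc_sqr.
  rewrite (integral_shift _ (f := fun t => (complex.Re (f t) ^+ 2 + complex.Im (f t) ^+ 2)%:E)).
    by rewrite I ltry.
  by apply/measurable_EFinP; apply: measurable_funD; exact: measurable_funX.
Qed.

Lemma inner_tfs f g p : L2 f -> L2 g -> inner (tfs f p) (tfs g p) = inner f g.
Proof.
move=> Lf Lg; have [ir ii] := inner_integrable Lf Lg.
rewrite !innerE /cint /Rintegral; congr (fine _ +i* fine _).
  under eq_integral do rewrite tfs_conj.
  exact: (integral_shift _ (measurable_int _ ir)).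
under eq_integral do rewrite tfs_conj.
exact: (integral_shift _ (measurable_int _ ii)).
Qed.

Lemma tfs_add f p q : tfs (tfs f q) p =
  (fun t => cis (- (2 * pi * (q.2%:~R * b) * (p.1%:~R * a))) * tfs f (p + q) t).
Proof.
apply/funext => t; rewrite !tfsE/= !mulrA -!cisD.
congr (cis _ * f _); rewrite ?rmorphD/=; ring.
Qed.

Lemma tfs0 f : tfs f (0 : int * int) = f.
Proof.
apply/funext => t; rewrite tfsE/= !mul0r mulr0 mul0r subr0.
by rewrite /cis cos0 sin0 mul1r.
Qed.

Local Notation H := (L2hilbert R).

Definition tfs_fun p (x : H) : H := cls (tfs (val (x : L2space R)) p).

Lemma tfs_fun_iso p (x y : H) : dot (tfs_fun p x) (tfs_fun p y) = dot x y.
Proof.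
rewrite /tfs_fun dot_cls; try exact/L2_tfs/L2_val.
by rewrite inner_tfs; try exact: L2_val.
Qed.

(** By isometry a shift of a function of norm zero has norm zero. *)
Lemma tfs_ae f g p : L2 f -> L2 g -> ae_equal f g -> ae_equal (tfs f p) (tfs g p).
Proof.
move=> Lf Lg /ae_equal_sub fg; apply/ae_equal_sub.
have Lfg := L2_linear (-1) Lf Lg.
rewrite -(tfs_linear (-1) f g p); apply/ae_equal_L2norm0; first exact: L2_tfs.
by rewrite inner_tfs//; apply/ae_equal_L2norm0.
Qed.

Lemma tfs_fun_cls p f : L2 f -> tfs_fun p (cls f) = cls (tfs f p).
Proof.
move=> Lf; apply: cls_eq; try exact/L2_tfs/L2_val; first exact: L2_tfs.
by apply: tfs_ae => //; [exact: L2_val | exact: val_cls].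
Qed.

Lemma tfs_fun_linear p (c : R[i]) (x y : H) :
  tfs_fun p (c *: x + y) = c *: tfs_fun p x + tfs_fun p y.
Proof.
have Lx := L2_val x; have Ly := L2_val y.
have {1}-> : c *: x + y = cls (fun t => c * val (x : L2space R) t + val (y : L2space R) t).
  by rewrite cls_linear// !valK'.
rewrite tfs_fun_cls; last exact: L2_linear.
by rewrite tfs_linear cls_linear//; exact: L2_tfs.
Qed.

HB.instance Definition _ p := GRing.isLinear.Build R[i] H H _ (tfs_fun p) (tfs_fun_linear p).

Definition tfs_op p : {linear H -> H} := tfs_fun p.

Lemma tfs_op_iso p (x y : H) : dot (tfs_op p x) (tfs_op p y) = dot x y.
Proof. exact: tfs_fun_iso. Qed.

Lemma tfs_op_cls p f : L2 f -> tfs_op p (cls f) = cls (tfs f p) :> H.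
Proof. exact: tfs_fun_cls. Qed.

Lemma tfs_op0 (x : H) : tfs_op 0 x = x.
Proof. by rewrite /tfs_op/= /tfs_fun tfs0 valK'. Qed.

Lemma tfs_op_add p q : exists c : R[i], Normc.normc c = 1 /\
  forall x : H, tfs_op p (tfs_op q x) = c *: tfs_op (p + q) x.
Proof.
have [c [c1 cP]] : exists c : R[i], Normc.normc c = 1 /\
    forall f, tfs (tfs f q) p = (fun t => c * tfs f (p + q) t).
  exists (cis (- (2 * pi * (q.2%:~R * b) * (p.1%:~R * a)))); split; first exact: normc_cis.
  by move=> f; rewrite tfs_add.
exists c; split=> // x; have Lx := L2_val x.
by rewrite /tfs_op/= {2}/tfs_fun tfs_fun_cls ?cP ?cls_scale//; exact: L2_tfs.
Qed.

End TimeFrequencyShifts.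

(** * Fourier series on an interval *)

Section FourierUniqueness.
Variables (R : realType) (s L : R) (u : R -> R).
Local Notation mu := (@lebesgue_measure R).
Local Notation setR := [set: measurableTypeR R].
Local Notation K := `[s, s + L[%classic.
Hypothesis L_gt0 : 0 < L.
Hypothesis u_int : mu.-integrable setR (EFin \o u).
Hypothesis u_supp : forall t, ~ K t -> u t = 0.
Implicit Types (y z psi : R -> R).

Let w : R := 2 * pi / L.

Definition bounded_measurable y :=
  measurable_fun setR y /\ exists M : R, forall t, `|y t| <= M.

Let integral_against y : R := Rintegral mu setR (fun t => u t * y t).

Lemma integrable_against y : bounded_measurable y ->
  mu.-integrable setR (EFin \o (fun t => u t * y t)).
Proof.
move=> [my [M yM]].
have iu : mu.-integrable setR (EFin \o (fun t => M * `|u t|)).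
  exact: (integrableZl measurableT M (integrable_norm u_int)).
apply: (integrable_le_fin _ iu).
  by apply: measurable_funM => //; apply/measurable_EFinP; exact: measurable_int u_int.
by move=> t; rewrite normrM mulrC ler_wpM2r.
Qed.

Lemma bounded_measurable_linear (a : R) y z : bounded_measurable y -> bounded_measurable z ->
  bounded_measurable (fun t => a * y t + z t).
Proof.
move=> [my [M yM]] [mz [N zN]]; split.
  by apply: measurable_funD => //; exact: measurable_funM.
exists (`|a| * M + N) => t; rewrite (le_trans (ler_normD _ _))// lerD//.
by rewrite normrM ler_wpM2l.
Qed.

Lemma bounded_measurableM y z : bounded_measurable y -> bounded_measurable z ->
  bounded_measurable (fun t => y t * z t).
Proof.
move=> [my [M yM]] [mz [N zN]]; split; first exact: measurable_funM.
by exists (M * N) => t; rewrite normrM ler_pM.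
Qed.

Lemma bounded_measurable_cst (c : R) : bounded_measurable (fun=> c).
Proof. by split; [exact: measurable_cst | exists `|c|]. Qed.

Lemma bounded_measurable_cos (c d : R) : bounded_measurable (fun t => cos (c * t + d)).
Proof.
split.
  apply: measurableT_comp; last by apply: measurable_funD => //; exact: measurable_funM.
  exact: (continuous_measurable_fun (@continuous_cos R)).
by exists 1 => t; rewrite ler_norml cos_geN1 cos_le1.
Qed.

Lemma integral_against_linear (a : R) y z : bounded_measurable y -> bounded_measurable z ->
  integral_against (fun t => a * y t + z t) = a * integral_against y + integral_against z.
Proof.
move=> gy gz.
have := Rintegral_combine a 1 (integrable_against gy) (integrable_against gz).
rewrite mul1r => <-; congr Rintegral; apply/funext => t; ring.
Qed.

Lemma integral_against_lim (yn : nat -> R -> R) y (M : R) :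
  (forall n, measurable_fun setR (yn n)) -> (forall n t, `|yn n t| <= M) ->
  (forall t, yn ^~ t @ \oo --> y t) ->
  bounded_measurable y /\
  ((forall n, integral_against (yn n) = 0) -> integral_against y = 0).
Proof.
move=> myn yM yl.
have my : measurable_fun setR y.
  by apply: (measurable_fun_cvg myn) => t _; exact: yl.
have gy : bounded_measurable y.
  split=> //; exists M => t.
  have nl : (fun n => `|yn n t|) @ \oo --> `|y t| by apply: cvg_norm; exact: yl.
  by apply: (cvgr_to_le nl); exact: nearW.
split=> // y0.
have iu : mu.-integrable setR (EFin \o (fun t => M * `|u t|)).
  exact: (integrableZl measurableT M (integrable_norm u_int)).
have mu' : measurable_fun setR u by apply/measurable_EFinP; exact: measurable_int u_int.
have [] := @dominated_convergence _ _ _ mu setR measurableT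
   (fun n t => (u t * yn n t)%:E) (fun t => (u t * y t)%:E)
   (fun t => (M * `|u t|)%:E) _ _ _ iu.
- by move=> n; apply/measurable_EFinP; exact: measurable_funM.
- by apply/measurable_EFinP; exact: measurable_funM.
- apply: aeW => t _; apply: cvg_EFin; first exact: nearW.
  by apply: cvgM => //; exact: cvg_cst.
- apply: aeW => t n _; rewrite abse_EFin lee_fin normrM mulrC ler_wpM2r//.
move=> _ _ Il.
have Iz n : (\int[mu]_t (u t * yn n t)%:E = 0)%E.
  have gn : bounded_measurable (yn n) by split; [|exists M].
  rewrite -(fineK (integrable_fin_num measurableT (integrable_against gn))).
  by congr EFin; exact: y0.
rewrite /integral_against /Rintegral.
have Icst : (fun n => (\int[mu]_t (u t * yn n t)%:E)%E) = cst 0%E by apply/funext.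
have : (fun n => (\int[mu]_t (u t * yn n t)%:E)%E) @ \oo --> 0%E.
  by rewrite Icst; exact: cvg_cst.
by move=> /(cvg_unique _ Il) ->.
Qed.

(** The free phase [d] lets cosines stand for sines as well, and keeps the family of test functions
    closed, up to linear combinations, under products with cosines of frequency [w]. *)
Let annihilated psi := bounded_measurable psi /\ forall (k : int) (d : R),
  integral_against (fun t => psi t * cos (k%:~R * w * t + d)) = 0.

(* Multipliers preserving the space of annihilated functions: this algebra
   contains the trigonometric polynomials and is closed under bounded
   pointwise limits. *)
Let multiplier y := bounded_measurable y /\
  forall psi, annihilated psi -> annihilated (fun t => y t * psi t).

Lemma integral_against_scale (c : R) y : bounded_measurable y ->
  integral_against (fun t => c * y t) = c * integral_against y.
Proof.
move=> gy; have := integral_against_linear (c - 1) gy gy.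
rewrite (_ : _ * _ + _ = c * integral_against y); last by ring.
by move=> <-; congr integral_against; apply/funext => t; ring.
Qed.

Lemma integral_against_ext y z : (forall t, K t -> y t = z t) ->
  integral_against y = integral_against z.
Proof.
move=> yz; congr Rintegral; apply/funext => t.
by have [/yz->//|/u_supp ->] := pselect (K t); rewrite !mul0r.
Qed.

Let good_cos k d := bounded_measurable_cos (k%:~R * w) d.

Lemma multiplier_cst (c : R) : multiplier (fun=> c).
Proof.
split; first exact: bounded_measurable_cst.
move=> psi [gp p0]; split.
  by apply: bounded_measurableM => //; exact: bounded_measurable_cst.
move=> k d; under eq_fun do rewrite -mulrA.
by rewrite integral_against_scale ?p0 ?mulr0//; exact/bounded_measurableM/good_cos.
Qed.

Lemma multiplier_linear (a : R) y z : multiplier y -> multiplier z ->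
  multiplier (fun t => a * y t + z t).
Proof.
move=> [gy yP] [gz zP]; split; first exact: bounded_measurable_linear.
move=> psi /[dup] /yP[gyp yp] /zP[gzp zp]; split.
  rewrite (_ : (fun t => _) = (fun t => a * (y t * psi t) + z t * psi t)).
    exact: bounded_measurable_linear.
  by apply/funext => t; ring.
move=> k d.
rewrite (_ : (fun t => _) = (fun t => a * (y t * psi t * cos (k%:~R * w * t + d)) +
    z t * psi t * cos (k%:~R * w * t + d))); last by apply/funext => t; ring.
rewrite integral_against_linear ?yp ?zp ?mulr0 ?addr0//;
  exact/bounded_measurableM/good_cos.
Qed.

Lemma multiplierM y z : multiplier y -> multiplier z -> multiplier (fun t => y t * z t).
Proof.
move=> [gy yP] [gz zP]; split; first exact: bounded_measurableM.
move=> psi /zP/yP.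
rewrite (_ : (fun t => y t * (z t * psi t)) = (fun t => y t * z t * psi t))//.
by apply/funext => t; rewrite mulrA.
Qed.

Lemma multiplier_lim (yn : nat -> R -> R) y (M : R) :
  (forall n, multiplier (yn n)) -> (forall n t, `|yn n t| <= M) ->
  (forall t, yn ^~ t @ \oo --> y t) -> multiplier y.
Proof.
move=> ynP yM yl.
have [gy _] := integral_against_lim (fun n => (ynP n).1.1) yM yl.
split=> // psi /[dup] psiP [[mp [N pN]] p0]; split.
  exact: bounded_measurableM gy psiP.1.
move=> k d; have [mc [C cC]] := good_cos k d.
pose c t := psi t * cos (k%:~R * w * t + d).
have ycl t : (fun n => yn n t * c t) @ \oo --> y t * c t.
  by apply: cvgM; [exact: yl | exact: cvg_cst].
have [] := @integral_against_lim (fun n t => yn n t * c t) _ (M * (N * C)) _ _ ycl.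
- by move=> n; apply: measurable_funM; [exact: (ynP n).1.1 | exact: measurable_funM].
- by move=> n t; rewrite normrM ler_pM// normrM ler_pM.
move=> _ lim0; rewrite -[RHS]lim0.
  by congr integral_against; apply/funext => t; rewrite /c mulrA.
move=> n; have [_ /(_ k d) <-] := (ynP n).2 _ psiP.
by congr integral_against; apply/funext => t; rewrite /c mulrA.
Qed.

(** The product-to-sum formula moves [k] by one in both directions and [d] by [e], so it stays
    within the tested cosines. *)
Lemma multiplier_cos (e : R) : multiplier (fun t => cos (w * t + e)).
Proof.
have gc : bounded_measurable (fun t => cos (w * t + e)) := bounded_measurable_cos w e.
split=> // psi [gp p0]; split; first exact: bounded_measurableM.
move=> k d.
rewrite (_ : (fun t => _) = (fun t =>
   2^-1 * (psi t * cos ((k + 1)%:~R * w * t + (d + e))) +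
   2^-1 * (psi t * cos ((k - 1)%:~R * w * t + (d - e))))); last first.
  apply/funext => t.
  have -> : (k + 1)%:~R * w * t + (d + e) = (k%:~R * w * t + d) + (w * t + e).
    by rewrite rmorphD/=; ring.
  have -> : (k - 1)%:~R * w * t + (d - e) = (k%:~R * w * t + d) - (w * t + e).
    by rewrite rmorphB/=; ring.
  by move: (_ * t + d) (_ * t + e) => X Y; rewrite cosD cosB; field.
rewrite integral_against_linear; first last.
- apply: bounded_measurableM; first exact: bounded_measurable_cst.
  exact/bounded_measurableM/good_cos.
- exact/bounded_measurableM/good_cos.
rewrite p0 mulr0 add0r integral_against_scale ?p0 ?mulr0//.
exact/bounded_measurableM/good_cos.
Qed.

(** Since [u] vanishes off the interval, a multiplier may be altered there. This allows functions of
    period [L] to produce the indicator of a ray. *)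
Lemma multiplier_ext y z : bounded_measurable z -> (forall t, K t -> y t = z t) ->
  multiplier y -> multiplier z.
Proof.
move=> gz yz [gy yP]; split=> // psi /[dup] [[gp _]] /yP[_ yp].
split; first exact: bounded_measurableM.
by move=> k d; rewrite -[RHS](yp k d); apply: integral_against_ext => t /yz ->.
Qed.

(* The iterates of x |-> 3x^2 - 2x^3 separate [0, 1/2) from (1/2, 1]. *)
Let smooth (x : R) := x ^+ 2 * (3 - 2 * x).

Lemma smooth_itv x : 0 <= x <= 1 -> 0 <= smooth x <= 1.
Proof.
move=> /andP[x0 x1]; rewrite /smooth; apply/andP; split.
  by rewrite mulr_ge0 ?sqr_ge0//; lra.
rewrite -subr_ge0 (_ : _ - _ = (1 - x) ^+ 2 * (1 + 2 * x)); last by ring.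
by rewrite mulr_ge0 ?sqr_ge0//; lra.
Qed.

Lemma iter_smooth_itv n x : 0 <= x <= 1 -> 0 <= iter n smooth x <= 1.
Proof. by move=> x01; elim: n => // n IH; exact: smooth_itv. Qed.

Lemma iter_smooth0 x : 0 <= x < 2^-1 -> (fun n => iter n smooth x) @ \oo --> (0 : R).
Proof.
(* For [x != 0], [r] is [smooth x / x]. The ratio [smooth v / v] increases on [0, 1/2), so [r]
   bounds it for all iterates, which stay below [x]. *)
move=> /andP[x0 x1]; pose r := 3 * x - 2 * x ^+ 2.
have r0 : 0 <= r by rewrite /r; nra.
have r1 : r < 1.
  rewrite -subr_gt0 (_ : _ - _ = (1 - x) * (1 - 2 * x)); last by rewrite /r; ring.
  by apply: mulr_gt0; lra.
have it n : 0 <= iter n smooth x <= x /\ iter n smooth x <= x * r ^+ n.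
  elim: n => [|n [/andP[i0 ix] ir]]; first by rewrite /= x0 lexx mulr1.
  rewrite iterS; set v := iter n smooth x in i0 ix ir *.
  have vr : smooth v <= v * r.
    rewrite -subr_ge0 (_ : _ - _ = v * ((x - v) * (3 - 2 * (x + v)))); last first.
      by rewrite /smooth /r; ring.
    by rewrite mulr_ge0// mulr_ge0//; lra.
  split; last first.
    by rewrite (le_trans vr)// exprSr mulrA ler_wpM2r.
  apply/andP; split; first by rewrite /smooth mulr_ge0 ?sqr_ge0//; lra.
  by rewrite (le_trans vr)// (le_trans _ ix)// ler_piMr// ltW.
apply: (@squeeze_cvgr _ _ _ _ (cst 0) (fun n => x * r ^+ n)).
- by apply: nearW => n; have [/andP[-> _] ->] := it n.
- exact: cvg_cst.
- rewrite -[X in _ --> X](mulr0 x); apply: cvgM; first exact: cvg_cst.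
  by apply: cvg_expr; rewrite ger0_norm.
Qed.

Lemma smooth_sym x : smooth (1 - x) = 1 - smooth x.
Proof. by rewrite /smooth; ring. Qed.

Lemma iter_smooth_sym n x : iter n smooth (1 - x) = 1 - iter n smooth x.
Proof. by elim: n => // n IH; rewrite !iterS IH smooth_sym. Qed.

Lemma iter_smooth1 x : 2^-1 < x <= 1 -> (fun n => iter n smooth x) @ \oo --> (1 : R).
Proof.
move=> /andP[x0 x1].
have : (fun n => iter n smooth (1 - x)) @ \oo --> (0 : R) by apply: iter_smooth0; lra.
rewrite (_ : (fun n => iter n smooth x) = (fun n => 1 - iter n smooth (1 - x))).
  move=> i0; rewrite -[X in _ --> X](subr0 1).
  by apply: cvgB => //; exact: cvg_cst.
by apply/funext => n; rewrite iter_smooth_sym; ring.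
Qed.

Lemma multiplier_gt_half y : multiplier y -> (forall t, 0 <= y t <= 1) ->
  multiplier (fun t => (2^-1 < y t)%R%:R).
Proof.
move=> yP y01.
have itP n : multiplier (fun t => iter n smooth (y t)).
  elim: n => [//|n IH]; rewrite (_ : (fun t => _) = (fun t =>
    iter n smooth (y t) * iter n smooth (y t) * (-2 * iter n smooth (y t) + 3))).
    apply: multiplierM; first exact: multiplierM.
    by apply: multiplier_linear => //; exact: multiplier_cst.
  by apply/funext => t; rewrite iterS /smooth; ring.
(* 1/2 is a fixed point of [smooth], so the limit of the iterates keeps the value 1/2 there. A
   second limit, of the powers of [l], sends it to 0 and leaves the strict inequality. *)
pose l t : R := if 2^-1 < y t then 1 else if y t == 2^-1 then 2^-1 else 0.
have lP : multiplier l.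
  apply: (multiplier_lim itP (M := 1)) => [n t|t].
    by have /andP[i0 i1] := iter_smooth_itv n (y01 t); rewrite ger0_norm.
  have /andP[y0 y1] := y01 t; rewrite /l; case: ifPn => [h|].
    by apply: iter_smooth1; rewrite h.
  rewrite -leNgt le_eqVlt; case: eqVneq => [-> _|_ /= h]; last first.
    by apply: iter_smooth0; rewrite y0.
  rewrite (_ : (fun n => _) = cst 2^-1); first exact: cvg_cst.
  apply/funext => n; elim: n => // n IH; rewrite iterS IH /cst /smooth; lra.
have lnP n : multiplier (fun t => l t ^+ n).
  elim: n => [|n IH]; first by under eq_fun do rewrite expr0; exact: multiplier_cst.
  by under eq_fun do rewrite exprS; exact: multiplierM.
have h01 : 0 <= (2^-1 : R) <= 1 by lra.
apply: (multiplier_lim lnP (M := 1)) => [n t|t].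
  rewrite normrX exprn_ile1// ger0_norm /l; case: ifP; rewrite ?ler01//; case: ifP => //; lra.
rewrite /l; case: ifPn => _.
  by under eq_fun do rewrite expr1n; exact: cvg_cst.
case: ifPn => _; apply: cvg_expr; rewrite ger0_norm; lra.
Qed.

Lemma bounded_measurable_indic (E : set (measurableTypeR R)) :
  measurable E -> bounded_measurable (\1_E : R -> R).
Proof.
move=> mE; split; first exact: measurable_indic.
by exists 1 => t; rewrite indicE; case: (_ \in _); rewrite /= ?normr1 ?normr0.
Qed.

(** The period is made to start at [- d], where the arc cos al >= cos d begins, so that leaving it
    at [d] is the only crossing. Angles beyond [pi] are reflected to [2 * pi - al]. *)
Lemma cos_gt_arc (d al : R) : 0 <= d < pi -> - d <= al < 2 * pi - d ->
  (cos al < cos d) = (d < al).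
Proof.
move=> /andP[d0 dpi] /andP[al1 al2]; have p0 := pi_gt0 R.
have [ald|dal] := leP al d.
  apply/negbTE; rewrite -leNgt.
  have -> : cos al = cos `|al| by case: (ger0P al) => _; rewrite ?cosN.
  have nd : `|al| <= d by rewrite ler_norml al1.
  by rewrite leNgt ltr_cos ?in_itv/= ?normr_ge0 ?d0 ?(ltW dpi)//; [rewrite -leNgt | lra].
have [alpi|pial] := leP al pi.
  rewrite ltr_cos ?in_itv/= ?d0 ?(ltW dpi) ?alpi ?andbT//; lra.
have -> : cos al = cos (2 * pi - al).
  rewrite -[cos al]cosN -(cosD2pi (- al)); congr cos; ring.
rewrite ltr_cos ?in_itv/= ?d0 ?(ltW dpi)//; first lra.
by apply/andP; split; lra.
Qed.

(* On the period [s, s + L) a ray ]x, +oo[ is the arc where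
   cos (w (t - m)) < cos (w (x - s) / 2), for m the midpoint of [s, x]. *)
Lemma multiplier_ray (x : R) : multiplier (\1_(`]x, +oo[%classic) : R -> R).
Proof.
have gr : bounded_measurable (\1_(`]x, +oo[%classic) : R -> R).
  by apply: bounded_measurable_indic; exact: measurable_itv.
have rayE t : (\1_(`]x, +oo[%classic) t : R) = (x < t)%R%:R.
  by rewrite indicE; congr (nat_of_bool _)%:R; apply/idP/idP; rewrite inE/= in_itv/= andbT.
have [xs|sx] := ltP x s.
  apply: multiplier_ext gr _ (multiplier_cst 1) => t /=.
  by rewrite in_itv/= rayE => /andP[st _]; rewrite (lt_le_trans xs st).
have [Lx|xL] := leP (s + L) x.
  apply: multiplier_ext gr _ (multiplier_cst 0) => t /=.
  by rewrite in_itv/= rayE => /andP[_ tL]; rewrite ltNge (ltW (lt_le_trans tL Lx)).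
have p0 := pi_gt0 R.
have w0 : 0 < w by rewrite /w divr_gt0// mulr_gt0.
have wL : w * L = 2 * pi by rewrite /w mulfVK// gt_eqF.
pose d := w * ((x - s) / 2).
have d0 : 0 <= d by rewrite mulr_ge0 ?(ltW w0) ?divr_ge0 ?subr_ge0.
have dpi : d < pi.
  have : w * (x - s) < w * L by rewrite ltr_pM2l// ltrBlDl.
  by rewrite wL /d; lra.
pose m := (s + x) / 2.
(* Division by 4 brings the difference of cosines into [-1/2, 1/2], so [y] takes values in [0, 1]
   and exceeds 1/2 exactly on the arc. *)
pose y t := 2^-1 + (cos d - cos (w * t + - (w * m))) / 4.
have yP : multiplier y.
  rewrite (_ : y = fun t => - 4^-1 * cos (w * t + - (w * m)) + (2^-1 + cos d / 4)).
    by apply: multiplier_linear; [exact: multiplier_cos | exact: multiplier_cst].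
  by apply/funext => t; rewrite /y; field.
have y01 t : 0 <= y t <= 1.
  have := cos_geN1 d; have := cos_le1 d.
  have := cos_geN1 (w * t + - (w * m)); have := cos_le1 (w * t + - (w * m)).
  by rewrite /y => *; apply/andP; split; lra.
apply: multiplier_ext gr _ (multiplier_gt_half yP y01) => t /=.
rewrite in_itv/= rayE => /andP[st tL]; congr (nat_of_bool _)%:R.
have -> : (2^-1 < y t) = (cos (w * t + - (w * m)) < cos d).
  by rewrite /y; apply/idP/idP; lra.
rewrite cos_gt_arc ?d0//.
  rewrite /d /m -mulrBr ltr_pM2l//; apply/idP/idP; lra.
have h1 : w * s <= w * t by rewrite ler_pM2l.
have h2 : w * t < w * s + 2 * pi by rewrite -wL -mulrDr ltr_pM2l.
by rewrite /d /m; apply/andP; split; lra.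
Qed.

(** The sets whose indicator is a multiplier form a sigma-algebra: complements by linearity,
    intersections by products, countable unions by bounded limits of finite ones. It contains the
    rays, which generate the Borel sets. *)
Lemma multiplier_measurable (E : set (measurableTypeR R)) :
  measurable E -> multiplier (\1_E : R -> R).
Proof.
pose S := [set E : set (measurableTypeR R) | measurable E /\ multiplier (\1_E : R -> R)].
have compl (A : set (measurableTypeR R)) : S A -> S (~` A).
  move=> [mA PA]; split; first exact: measurableC.
  rewrite (_ : \1_(~` A) = (fun t => -1 * \1_A t + 1) :> (R -> R)).
    by apply: multiplier_linear => //; exact: multiplier_cst.
  by apply/funext => t; rewrite !indicE in_setC; case: (_ \in _) => /=; ring.
have union (A B : set (measurableTypeR R)) : S A -> S B -> S (A `|` B).
  move=> SA SB; have [mA PA] := compl _ SA; have [mB PB] := compl _ SB.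
  rewrite -[A `|` B]setCK setCU; apply: compl; split; first exact: measurableI.
  rewrite (_ : \1_(~` A `&` ~` B) = (fun t => \1_(~` A) t * \1_(~` B) t) :> (R -> R)).
    exact: multiplierM.
  by apply/funext => t; rewrite !indicE in_setI; do 2 case: (_ \in _); rewrite /= ?mulr0 ?mul0r ?mulr1.
have S0 : S set0.
  by split=> //; rewrite indic0; exact: multiplier_cst.
have bigunion (A : nat -> set (measurableTypeR R)) : (forall n, S (A n)) -> S (\bigcup_n A n).
  move=> SA; split; first by apply: bigcupT_measurable => n; case: (SA n).
  pose An n := \big[setU/set0]_(i < n) A i.
  have SAn n : S (An n).
    by rewrite /An; elim/big_ind : _ => // i _.
  apply: (multiplier_lim (fun n => (SAn n).2) (M := 1)) => [n t|t].
    by rewrite indicE; case: (_ \in _); rewrite /= ?normr1 ?normr0.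
  rewrite indicE; case: (boolP (t \in _)) => [|tA].
    rewrite inE => -[k _ Akt].
    apply: cvg_near_cst; exists k.+1 => // n /= kn.
    by rewrite indicE mem_set// /An -bigcup_mkord; exists k.
  apply: cvg_near_cst; apply: nearW => n.
  rewrite indicE memNset// /An -bigcup_mkord => -[i _ Ait].
  by move/negP: tA; apply; rewrite inE; exists i.
have SS : sigma_algebra setT S.
  by split=> // A SA; rewrite setTD; exact: compl.
have sub : @RGenOInfty.G R `<=` S.
  move=> _ [x ->]; split; [exact: measurable_itv | exact: multiplier_ray].
move=> mE; have := RGenOInfty.measurableE R => /seteqP[/(_ E mE) GE _].
by have [] := smallest_sub SS sub GE.
Qed.

(** The constant 1 is annihilated by hypothesis. Multiplying it by the indicator of a measurable set
    E and testing at [k = 0], [d = 0] shows that the integral of [u] over E is zero. *)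
Theorem fourier_unique :
  (forall (k : int) (d : R), Rintegral mu setR (fun t => u t * cos (k%:~R * w * t + d)) = 0) ->
  ae_eq mu setR (EFin \o u) (cst 0%E).
Proof.
move=> u0; have ann1 : annihilated (fun=> 1).
  split; first exact: bounded_measurable_cst.
  by move=> k d; rewrite -[RHS](u0 k d); congr integral_against; apply/funext => t; rewrite mul1r.
apply: integral_ae_eq => // E _ mE; rewrite integral0.
have [_ /(_ _ ann1)[_ /(_ 0 0)]] := multiplier_measurable mE.
rewrite /integral_against.
under [X in Rintegral _ _ X]eq_fun do rewrite mulr1 !mul0r add0r cos0 mulr1.
move=> h; rewrite -(fineK (integrable_fin_num mE (integrableS measurableT mE (@subsetT _ _) u_int))).
congr EFin; rewrite -[RHS]h -/(Rintegral mu E u) Rintegral_mkcond.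
congr Rintegral; apply/funext => t; rewrite patchE indicE.
by case: (_ \in _); rewrite /= ?mulr1 ?mulr0.
Qed.

End FourierUniqueness.

Lemma L2_mask (R : realType) (E : set (measurableTypeR R)) (g : R -> R[i]) :
  measurable E -> L2 g -> L2 (fun t => (\1_E t)%:C * g t).
Proof.
move=> mE /L2_sqint[[mr rg] [mi ig]].
have sq (v : R -> R) : measurable_fun [set: measurableTypeR R] v ->
    (\int[@lebesgue_measure R]_t (v t ^+ 2)%:E < +oo)%E ->
    sqint (@lebesgue_measure R) (fun t : R => \1_E t * v t).
  move=> mv vg.
  have m1 : measurable_fun [set: measurableTypeR R] (fun t : R => \1_E t * v t).
    by apply: measurable_funM => //; exact: measurable_indic.
  split=> [//|]; apply: (le_lt_trans _ vg); apply: ge0_le_integral => //.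
  - by move=> t _; rewrite lee_fin sqr_ge0.
  - exact: measurable_sqr.
  - exact: measurable_sqr.
  - move=> t _; rewrite lee_fin indicE; case: (_ \in _); rewrite ?mul1r//.
    by rewrite mul0r expr0n/= sqr_ge0.
apply/L2_sqint; split.
  rewrite (_ : (fun t => _) = (fun t => \1_E t * complex.Re (g t))); first exact: sq.
  by apply/funext => t; rewrite ReZ.
rewrite (_ : (fun t => _) = (fun t => \1_E t * complex.Im (g t))); first exact: sq.
by apply/funext => t; rewrite Im_mulc/= mul0r addr0.
Qed.

(** * Fourier modes: orthogonality, completeness and Parseval's identity *)

Section FourierParseval.
Variables (R : realType) (s L : R).
Local Notation mu := (@lebesgue_measure R).
Local Notation K := `[s, s + L[%classic.
Local Notation H := (L2hilbert R).
Hypothesis L_gt0 : 0 < L.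
Let w : R := 2 * pi / L.
Implicit Types (f z : R -> R[i]) (k j : int).

Lemma L2_indic (x y : R) : L2 (fun t => (\1_(`[x, y[%classic) t)%:C : R[i]) /\
  complex.Re (inner (fun t => (\1_(`[x, y[%classic) t)%:C : R[i])
                    (fun t => (\1_(`[x, y[%classic) t)%:C)) = Num.max (y - x) 0.
Proof.
pose E := `[x, y[%classic; pose f t : R[i] := (\1_E t)%:C.
have I : (\int[mu]_t (complex.Re (f t) ^+ 2 + complex.Im (f t) ^+ 2)%:E =
          (Num.max (y - x) 0)%:E)%E.
  transitivity (\int[mu]_t (\1_E t)%:E)%E.
    by apply: eq_integral => t _; rewrite /f/= indicE; case: (_ \in _); rewrite /= ?expr1n ?expr0n/= ?addr0.
  rewrite integral_indic ?setIT//; last exact: measurable_itv.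
  rewrite [LHS](lebesgue_measure_itv `[x, y[)/= lte_fin; case: ltP => xy.
    by rewrite -EFinB; congr EFin; rewrite max_l// subr_ge0 ltW.
  by congr EFin; rewrite max_r// subr_le0.
have Lf : L2 f.
  split; first by apply: measurable_indic; exact: measurable_itv.
    exact: measurable_cst.
  by rewrite L2norm_poweR I; apply: poweR_lty; rewrite ltry.
by split=> //; have [_ [+ _]] := inner_self Lf; rewrite I => -[->].
Qed.

Lemma conjcM (x y : R[i]) : (x * y)^*%C = x^*%C * y^*%C.
Proof. exact: rmorphM. Qed.

Lemma cis0 : cis (0 : R) = 1. Proof. by rewrite /cis cos0 sin0. Qed.

Lemma cisN (x : R) : cis (- x) = (cis x)^*%C.
Proof. by rewrite /cis cosN sinN. Qed.

Lemma cis_2pi_int k : cis (2 * pi * k%:~R : R) = 1.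
Proof.
have nat_case (n : nat) : cis (2 * pi * n%:R : R) = 1.
  elim: n => [|n IH]; first by rewrite mulr0 cis0.
  rewrite (_ : 2 * pi * n.+1%:R = 2 * pi * n%:R + 2 * pi); last by rewrite -natr1; ring.
  rewrite cisD IH mul1r /cis.
  by rewrite (_ : 2 * pi = pi *+ 2) ?cos2pi ?sin2pi// mulr_natl.
case: k => n; first exact: nat_case.
by rewrite NegzE rmorphN/= mulrN cisN nat_case rmorph1.
Qed.

Lemma integral_cos_period (c d : R) k : c != 0 -> c * L = 2 * pi * k%:~R ->
  Rintegral mu K (fun t => cos (c * t + d)) = 0.
Proof.
move=> c0 cL.
have dcos (t : R) : is_derive t (1 : R) (fun t : R => cos (c * t + d) : R) (- sin (c * t + d) * c).
  apply: is_derive_eq.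
  by rewrite /GRing.scale/=; ring.
pose F t := sin (c * t + d) / c.
have dF (t : R) : is_derive t (1 : R) F (cos (c * t + d)).
  rewrite /F; apply: is_derive_eq.
  by rewrite /GRing.scale/=; field.
have ccos : continuous (fun t => cos (c * t + d)).
  by move=> t; apply/differentiable_continuous/derivable1_diffP; case: (dcos t).
have cF : continuous F.
  by move=> t; apply/differentiable_continuous/derivable1_diffP; case: (dF t).
rewrite Rintegral_itv_bndo_bndc; last first.
  apply: (@integrableS _ _ _ mu `[s, s + L]%classic); try exact: measurable_itv.
    by move=> t /=; rewrite !in_itv/= => /andP[-> /ltW ->].
  apply: continuous_compact_integrable; first exact: segment_compact.
  exact: continuous_subspaceT.
have sL : s < s + L by rewrite ltrDl.
rewrite /Rintegral (@continuous_FTC2 R (fun t => cos (c * t + d)) F s (s + L) sL).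
- rewrite /= /F mulrDr cL.
  have := cisD (c * s + d) (2 * pi * k%:~R); rewrite cis_2pi_int mulr1 => -[_ +].
  by rewrite addrAC => ->; rewrite subrr.
- exact: continuous_subspaceT.
- split; [by move=> t _; case: (dF t)|exact/cvg_at_right_filter/cF|exact/cvg_at_left_filter/cF].
- by move=> t _; rewrite derive1E; exact: derive_val.
Qed.

Let mask (t : R) : R[i] := (\1_K t)%:C.
(** Left unnormalized, with squared norm [L]; hence the factor [L] in Parseval's identity. *)
Definition fourier_mode k (t : R) : R[i] := cis (k%:~R * w * t) * mask t.

Lemma L2_fourier_mode k : L2 (fourier_mode k).
Proof.
have [Lm _] := L2_indic s (s + L).
have := L2_tfs 0 L^-1 (0, k) Lm; congr L2; apply/funext => t.
rewrite tfsE/= mulr0 subr0 /fourier_mode; congr (cis _ * _); rewrite /w; ring.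
Qed.

Lemma fourier_mode_orth k j :
  inner (fourier_mode k) (fourier_mode j) = if k == j then L%:C else 0.
Proof.
have mode_conj t : fourier_mode k t * (fourier_mode j t)^*%C =
    cis ((k - j)%:~R * w * t) * (\1_K t)%:C.
  rewrite /fourier_mode conjcM mulrACA -cisN -cisD; congr (cis _ * _).
    by rewrite rmorphB/=; ring.
  by rewrite /mask indicE; case: (_ \in _); simpc; rewrite ?mulr1 ?mulr0.
rewrite innerE /cint.
have -> : (fun t => complex.Re (fourier_mode k t * (fourier_mode j t)^*%C)) =
    (fun t => cos ((k - j)%:~R * w * t + 0)) \_ K.
  apply/funext => t; rewrite mode_conj Re_mulc/= mulr0 subr0 patchE indicE addr0.
  by case: (_ \in _); rewrite ?mulr1 ?mulr0.
(* The sine is written as a cosine with phase -pi/2, so that [integral_cos_period] covers both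
   parts. *)
have -> : (fun t => complex.Im (fourier_mode k t * (fourier_mode j t)^*%C)) =
    (fun t => cos ((k - j)%:~R * w * t + - (pi / 2))) \_ K.
  apply/funext => t; rewrite mode_conj Im_mulc/= mulr0 add0r patchE indicE cosBpihalf.
  by case: (_ \in _); rewrite ?mulr1 ?mulr0.
rewrite -!Rintegral_mkcond.
have w0 : w != 0 by rewrite gt_eqF// /w divr_gt0// mulr_gt0// pi_gt0.
case: eqVneq => [->|kj].
  rewrite subrr; congr (_ +i* _).
    rewrite (_ : (fun t => _) = fun=> 1); last by apply/funext => t; rewrite !mul0r addr0 cos0.
    rewrite Rintegral_cst ?mul1r; last exact: measurable_itv.
    by rewrite [X in fine X](lebesgue_measure_itv `[s, s + L[)/= lte_fin ltrDl L_gt0/= addrAC subrr add0r.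
  rewrite (_ : (fun t => _) = fun=> 0); last first.
    by apply/funext => t; rewrite !mul0r add0r cosN cos_pihalf.
  by rewrite Rintegral_cst ?mul0r//; exact: measurable_itv.
have c0 : (k - j)%:~R * w != 0 by rewrite mulf_neq0// intr_eq0 subr_eq0.
have cL : (k - j)%:~R * w * L = 2 * pi * (k - j)%:~R.
  by rewrite /w; field; rewrite gt_eqF.
by rewrite !(integral_cos_period _ c0 cL).
Qed.

Lemma fourier_complete z : L2 z -> (forall t, ~ K t -> z t = 0) ->
  (forall k, inner z (fourier_mode k) = 0) -> ae_equal z (fun=> 0).
Proof.
move=> Lz zK z0; have [Lm _] := L2_indic s (s + L).
have zmask t : z t * (mask t)^*%C = z t.
  have [Kt|nK] := pselect (K t); last by rewrite zK ?mul0r.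
  by rewrite /mask indicE mem_set//= oppr0 mulr1.
have [iz1 iz2] : cintegrable z.
  by have := inner_integrable Lz Lm; congr cintegrable; apply/funext => t; rewrite zmask.
(* Euler's formula: a real cosine with arbitrary phase is a combination of the modes [k] and [- k].
   Testing with real functions lets real and imaginary parts of [z] be treated separately. *)
have zcos k d : cint (fun t => z t * (cos (k%:~R * w * t + d))%:C) = 0.
  pose F k t := z t * (fourier_mode k t)^*%C.
  have iF j : cintegrable (F j) by exact/inner_integrable/L2_fourier_mode.
  have F0 j : cint (F j) = 0 by exact: z0.
  have i0 : cintegrable (fun=> 0 : R[i]).
    by have := inner_integrable (@L2_0 R) (@L2_0 R); congr cintegrable; apply/funext => t; rewrite mul0r.
  have c0 : cint (fun=> 0 : R[i]) = 0.
    by rewrite /cint/= !Rintegral_cst ?mul0r.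
  have [i1 e1] := cintegrable_linear ((2^-1)%:C * cis (- d)) (iF k) i0.
  have [_] := cintegrable_linear ((2^-1)%:C * cis d) (iF (- k)) i1.
  rewrite e1 !F0 c0 !mulr0 !addr0 => <-.
  congr cint; apply/funext => t; rewrite addr0.
  have -> : (cos (k%:~R * w * t + d))%:C =
     (2^-1)%:C * cis d * (cis ((- k)%:~R * w * t))^*%C +
     (2^-1)%:C * cis (- d) * (cis (k%:~R * w * t))^*%C.
    rewrite -!cisN -!mulrA -!cisD -mulrDr rmorphN/= !mulNr opprK.
    rewrite -[- d + _]opprD [d + _]addrC cisN /cis.
    by apply: eqc; rewrite /=; field.
  rewrite /F /fourier_mode !conjcM.
  by rewrite -{1}(zmask t) /mask; ring.
have comp_cos k d : Rintegral mu setT (fun t => complex.Re (z t) * cos (k%:~R * w * t + d)) = 0 /\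
    Rintegral mu setT (fun t => complex.Im (z t) * cos (k%:~R * w * t + d)) = 0.
  have := zcos k d; rewrite /cint => -[h1 h2]; split; [rewrite -[RHS]h1|rewrite -[RHS]h2];
    congr Rintegral; apply/funext => t.
    by rewrite Re_mulc/= mulr0 subr0.
  by rewrite Im_mulc/= mulr0 add0r.
have zr : ae_eq mu [set: measurableTypeR R] (EFin \o (fun t => complex.Re (z t))) (cst 0%E).
  apply: (@fourier_unique _ s L) => // [t /zK ->//|k d]; exact: (comp_cos k d).1.
have zi : ae_eq mu [set: measurableTypeR R] (EFin \o (fun t => complex.Im (z t))) (cst 0%E).
  apply: (@fourier_unique _ s L) => // [t /zK ->//|k d]; exact: (comp_cos k d).2.
apply: ae_impl2 zr zi => t /(_ Logic.I)[r0] /(_ Logic.I)[i0] _.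
exact: eqc.
Qed.

Lemma fourier_bessel : bessel L (fun k => cls (fourier_mode k) : H).
Proof.
apply: orthogonal_bessel => // k j.
by rewrite dot_cls ?fourier_mode_orth//; exact: L2_fourier_mode.
Qed.

(** The energy of [f] is Re <y, f> for the sum [y] of its unnormalized Fourier series. The
    coefficients of [y] are [L] times those of [f], so completeness forces [y] to agree with [L f]
    on the interval. *)
Theorem fourier_parseval f : L2 f -> (forall t, ~ K t -> f t = 0) ->
  (\esum_(k in [set: int]) (Normc.normc (inner f (fourier_mode k)) ^+ 2)%:E =
   (L * complex.Re (inner f f))%:E)%E.
Proof.
move=> Lf fK; pose e k : H := cls (fourier_mode k).
have [y yP] := frame_limit_exists (cls f : H) L_gt0 fourier_bessel.
have Lv : L2 (val (y : L2space R)) := L2_val _.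
set v := val (y : L2space R) in Lv.
have Le k := L2_fourier_mode k.
have ye k : inner v (fourier_mode k) = L%:C * inner f (fourier_mode k).
  have ee i j : dot (e i) (e j) = if i == j then L%:C else 0.
    by rewrite (dot_cls (Le i) (Le j)) fourier_mode_orth.
  have := frame_limit_symmetric yP (orthogonal_frame_limit ee k).
  rewrite dotZr conjcR -[y in LHS](valK' (y : L2space R)).
  by rewrite (dot_cls Lv (Le k)) (dot_cls Lf (Le k)).
(* The limit [y] is only a class and nothing is known of its support; cutting its representative to
   the interval makes completeness applicable and preserves inner products with the modes and with
   [f]. *)
pose z t := (- L)%:C * f t + (\1_K t)%:C * v t.
have Lkv : L2 (fun t => (\1_K t)%:C * v t).
  by apply: L2_mask Lv; exact: measurable_itv.
have Lz : L2 z by exact: L2_linear.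
have zK t : ~ K t -> z t = 0.
  by move=> nK; rewrite /z fK// indicE memNset// mulr0 mul0r addr0.
have mask_sym h : L2 h -> (forall t, (\1_K t)%:C * h t = h t) ->
    inner (fun t => (\1_K t)%:C * v t) h = inner v h.
  move=> Lh Kh; rewrite !innerE; congr cint; apply/funext => t.
  by rewrite -[h t in RHS]Kh conjcM conjcR; ring.
have z0 k : inner z (fourier_mode k) = 0.
  rewrite inner_linear// mask_sym//; last first.
    by move=> t; rewrite /fourier_mode /mask indicE; case: (_ \in _); rewrite ?mulr0 ?mul0r ?mulr1 ?mul1r.
  by rewrite ye rmorphN mulNr addNr.
have zf : inner z f = 0.
  rewrite (ae_equal_inner Lz (@L2_0 R) Lf (fourier_complete Lz zK z0)).
  by rewrite -(dot_cls (@L2_0 R) Lf); exact: (@dot0l R H).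
have := esum_frame_limit yP; rewrite -/e => E.
transitivity (\esum_(k in [set: int]) (Normc.normc (dot (cls f : H) (e k)) ^+ 2)%:E)%E.
  by apply: eq_esum => k _; rewrite (dot_cls Lf (Le k)).
rewrite E; congr EFin; rewrite -[y in LHS](valK' (y : L2space R)) (dot_cls Lv Lf).
move: zf; rewrite inner_linear// mask_sym//; last first.
  move=> t; have [Kt|nK] := pselect (K t); last by rewrite fK// mulr0.
  by rewrite indicE mem_set// mul1r.
by move=> /eqP; rewrite rmorphN mulNr addrC subr_eq0 => /eqP ->; rewrite ReZ.
Qed.

End FourierParseval.

Lemma le_esumZl (R : realType) (T : choiceType) (S : set T) (r : R) (F : T -> \bar R) :
  0 <= r -> (forall i, 0 <= F i)%E ->
  (\esum_(i in S) (r%:E * F i) <= r%:E * \esum_(i in S) F i)%E.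
Proof.
move=> r0 F0; apply: ge_ereal_sup => _ [A [finA AS] <-].
rewrite -ge0_mule_fsumr// lee_wpmul2l ?lee_fin//.
by apply: ereal_sup_ubound; exists A.
Qed.

Lemma esumZl (R : realType) (T : choiceType) (S : set T) (r : R) (F : T -> \bar R) :
  0 < r -> (forall i, 0 <= F i)%E ->
  (\esum_(i in S) (r%:E * F i) = r%:E * \esum_(i in S) F i)%E.
Proof.
move=> r0 F0; apply/eqP; rewrite eq_le le_esumZl ?(ltW r0)//=.
have ri : 0 < r^-1 by rewrite invr_gt0.
have rF0 i : (0 <= r%:E * F i)%E by rewrite mule_ge0// lee_fin ltW.
have := le_esumZl S (ltW ri) rF0.
under eq_esum do rewrite muleA -EFinM mulVf ?gt_eqF// mul1e.
move=> /(lee_wpmul2l (x := r%:E)); rewrite lee_fin => /(_ (ltW r0)).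
by rewrite muleA -EFinM divff ?gt_eqF// mul1e.
Qed.

(** * The norm of a Parseval window *)

Section IntegralOverTranslates.
Variable R : realType.
Local Notation mu := (@lebesgue_measure R).
Variable g : R -> \bar R.
Hypotheses (mg : measurable_fun [set: measurableTypeR R] g) (g0 : forall t, (0 <= g t)%E).

Let mgS (D : set (measurableTypeR R)) : measurable D -> measurable_fun D g.
Proof. by move=> mD; apply: measurable_funS mg. Qed.

Lemma integral_translates (a : R) : 0 < a ->
  (\esum_(n in [set: int]) \int[mu]_(t in `[(n%:~R * a)%R, (n%:~R * a + a)%R[) g t =
   \int[mu]_t g t)%E.
Proof.
move=> a0; pose J (n : int) : set (measurableTypeR R) := `[n%:~R * a, n%:~R * a + a[%classic.
have JP n t : J n t <-> n = Num.floor (t / a).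
  rewrite /J/= in_itv/= -[X in _ + X]mul1r -mulrDl -ler_pdivlMr// -ltr_pdivrMr//.
  rewrite (_ : n%:~R + 1 = (n + 1)%:~R :> R); last by rewrite rmorphD.
  rewrite -floor_eq.
  by split=> [/eqP|->].
have mJ n : measurable (J n) by exact: measurable_itv.
(* Countable additivity is indexed by natural numbers, so the intervals are renumbered by codes of
   integers, the other codes giving the empty set. *)
pose F k : set (measurableTypeR R) := if pickle_inv k is Some n then J n else set0.
have mF k : measurable (F k) by rewrite /F; case: pickle_inv.
have FT : \bigcup_k F k = [set: measurableTypeR R].
  rewrite -subTset => t _; exists (choice.pickle (Num.floor (t / a))); first by [].
  by rewrite /F choice.pickleK_inv; apply/JP.
have tF : trivIset setT F.
  move=> i j _ _ [t []]; rewrite /F.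
  case Ei : pickle_inv => [n|//] /JP nt; case Ej : pickle_inv => [m|//] /JP mt.
  have := choice.pickle_invK (T := int) i; rewrite Ei/= => <-.
  by have := choice.pickle_invK (T := int) j; rewrite Ej/= => <-; rewrite nt mt.
have := ge0_integral_bigcup mu mF (f := g); rewrite FT => /(_ mg (fun t _ => g0 t) tF) ->.
have I0 (A : set (measurableTypeR R)) : (0 <= \int[mu]_(t in A) g t)%E by exact: integral_ge0.
rewrite nneseries_esumT//.
rewrite (_ : (\esum_(k in [set: nat]) \int[mu]_(t in F k) g t)%E =
    (\esum_(k in (@choice.pickle int) @` [set: int]) \int[mu]_(t in F k) g t)%E).
  rewrite esum_image; last by move=> n m _ _; exact: (pcan_inj (@choice.pickleK int)).
  by apply: eq_esum => n _; rewrite /F choice.pickleK_inv.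
rewrite [RHS]esum_mkcond; apply: eq_esum => k _; case: ifPn => // kP.
rewrite /F; case E : pickle_inv => [n|]; last by rewrite integral_set0.
exfalso; move/negP: kP; apply; rewrite inE; exists n => //.
by have := choice.pickle_invK (T := int) k; rewrite E.
Qed.

Lemma integral_adjacent (x c : R) (N : nat) : 0 < c ->
  (\sum_(j < N) \int[mu]_(t in `[(x + j%:R * c)%R, (x + j%:R * c + c)%R[) g t =
   \int[mu]_(t in `[x, (x + N%:R * c)%R[) g t)%E.
Proof.
move=> c0; elim: N => [|N IH].
  by rewrite big_ord0 mul0r addr0 set_itvco0 integral_set0.
rewrite big_ord_recr/= IH.
rewrite -ge0_integral_setU//.
- congr (integral _ _ _); apply/seteqP; split=> t /=; rewrite !in_itv/= -natr1 mulrDl mul1r.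
    have := mulr_ge0 (ler0n R N) (ltW c0).
    by move=> h [] /andP[h1 h2]; apply/andP; split; lra.
  move=> /andP[h1 h2]; have [h|h] := ltP t (x + N%:R * c); [left|right]; apply/andP; split=> //; lra.
- by apply: mgS; apply: measurableU; exact: measurable_itv.
- apply/disj_setPS => t /= []; rewrite !in_itv/= => /andP[_ h1] /andP[h2 _].
  by move: h1; rewrite ltNge h2.
Qed.

End IntegralOverTranslates.

Section ParsevalWindowNorm.
Variables (R : realType) (a b : R).
Hypotheses (a_gt0 : 0 < a) (b_gt0 : 0 < b).
Local Notation mu := (@lebesgue_measure R).
Local Notation H := (L2hilbert R).
Variable h : H.
Hypothesis h_parseval : forall x, frame_limit (orbit_of (tfs_op a b) h) x x.

Let f : R -> R[i] := val (h : L2space R).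
Let Lf : L2 f. Proof. exact: L2_val. Qed.
Let g (t : R) : \bar R := (complex.Re (f t) ^+ 2 + complex.Im (f t) ^+ 2)%:E.

Let mg : measurable_fun [set: measurableTypeR R] g.
Proof.
have [mr mi _] := Lf.
by apply/measurable_EFinP; apply: measurable_funD; exact: measurable_funX.
Qed.

Let g0 t : (0 <= g t)%E. Proof. by rewrite lee_fin addr_ge0 ?sqr_ge0. Qed.

(* Testing the Parseval identity on the indicator of an interval of length
   c <= 1/b, and summing over the modulations with Fourier's Parseval
   identity on each translate. *)
Lemma translates_mass (x c : R) : 0 < c <= b^-1 ->
  (\esum_(n in [set: int]) \int[mu]_(t in `[(n%:~R * a + x)%R, (n%:~R * a + x + c)%R[) g t =
   (b * c)%:E)%E.
Proof.
move=> /andP[c0 cb]; pose chi (t : R) : R[i] := (\1_(`[x, (x + c)[%classic) t)%:C.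
have [Lchi chi2] := L2_indic x (x + c).
have := esum_parseval_swap (@tfs_op_iso R a b) (@tfs_op0 R a b)
  (@tfs_op_add R a b) (cls chi : H) h_parseval.
rewrite /sqnorm (dot_cls Lchi Lchi) chi2 addrAC subrr add0r max_l ?(ltW c0)//.
have -> : [set: int * int] = [set: int] `*`` (fun=> [set: int]) by apply/seteqP.
rewrite -(@esum_esum _ _ _ [set: int] (fun=> [set: int])
  (fun n m => (Normc.normc (dot h (tfs_op a b (n, m) (cls chi : H))) ^+ 2)%:E)); last first.
  by move=> *; rewrite lee_fin sqr_ge0.
move=> E; have -> : (b * c)%:E = (b%:E * c%:E)%E by [].
rewrite -E.
have inner_mode n : (\esum_(m in [set: int])
   (Normc.normc (dot h (tfs_op a b (n, m) (cls chi : H))) ^+ 2)%:E =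
   b^-1%:E * \int[mu]_(t in `[(n%:~R * a + x)%R, (n%:~R * a + x + c)%R[) g t)%E.
  pose s := n%:~R * a + x.
  (* Because [c <= b^-1], the cut-off function is supported in one period [[s, s + b^-1)], for which
     the modulations by multiples of [b] are the Fourier modes. *)
  pose fJ t : R[i] := (\1_(`[s, s + c[%classic) t)%:C * f t.
  have LfJ : L2 fJ by apply: L2_mask Lf; exact: measurable_itv.
  have bi : 0 < b^-1 by rewrite invr_gt0.
  have fJK t : ~ `[s, s + b^-1[%classic t -> fJ t = 0.
    move=> nK; rewrite /fJ indicE memNset ?mul0r// => Jt; apply: nK; move: Jt.
    by rewrite /= !in_itv/= => /andP[-> /lt_le_trans ->//]; rewrite lerD2l.
  transitivity (\esum_(m in [set: int])
     (Normc.normc (inner fJ (fourier_mode s b^-1 m)) ^+ 2)%:E)%E.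
    apply: eq_esum => m _.
    rewrite (tfs_op_cls _ _ _ Lchi) -[h in dot h](valK' (h : L2space R)).
    rewrite (dot_cls Lf (L2_tfs _ _ _ Lchi)); congr (Normc.normc _ ^+ 2)%:E.
    rewrite !innerE; congr cint; apply/funext => t.
    rewrite tfsE /fourier_mode !conjcM /fJ.
    have -> : 2 * pi * (m%:~R * b) * t = m%:~R * (2 * pi / b^-1) * t by rewrite invrK; ring.
    rewrite /chi !conjcR !indicE.
    have -> : (t - n%:~R * a \in `[x, (x + c)[%classic) = (t \in `[s, s + c[%classic).
      by apply/idP/idP; rewrite !inE/= !in_itv/= /s => /andP[h1 h2]; apply/andP; split; lra.
    case: (boolP (t \in `[s, s + c[%classic)) => Jt; last by rewrite !mulr0 !mul0r.
    rewrite mem_set; last first.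
      move: Jt; rewrite inE/= !in_itv/= => /andP[-> /lt_le_trans ->//].
      by rewrite lerD2l.
    by rewrite mul1r.
  rewrite (fourier_parseval bi LfJ fJK) EFinM; congr (_ * _)%E.
  have [_ [<- _]] := inner_self LfJ.
  rewrite [RHS]integral_mkcond; apply: eq_integral => t _.
  rewrite patchE /fJ indicE /g.
  by case: (_ \in _); rewrite ?mul1r// mul0r/= expr0n/= addr0.
rewrite (eq_esum (fun n _ => inner_mode n)).
rewrite esumZl ?invr_gt0//; last by move=> n; exact: integral_ge0.
by rewrite muleA -EFinM divff ?gt_eqF// mul1e.
Qed.

Lemma parseval_window_sqnorm : sqnorm h = a * b.
Proof.
have I : (\int[mu]_t g t = (sqnorm h)%:E)%E by have [_ [+ _]] := inner_self Lf.
(* [N] exceeds [a * b], so [c = a / N] is at most [b^-1]. The line is then the union of [N] families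
   of translates, of mass [b * c] each, which add up to [a * b]. *)
pose N := (Num.bound (a * b)).+1; pose c := a / N%:R.
have N0 : 0 < N%:R :> R by rewrite ltr0n.
have c0 : 0 < c by rewrite divr_gt0.
have cN : N%:R * c = a by rewrite mulrC divfK// gt_eqF.
have cb : c <= b^-1.
  rewrite ler_pdivrMr// -ler_pdivrMl ?invr_gt0// invrK mulrC.
  rewrite (le_trans (ltW (archi_boundP _)))// ?mulr_ge0 ?(ltW a_gt0) ?(ltW b_gt0)//.
  by rewrite ler_nat.
have := integral_translates mg g0 a_gt0; rewrite I.
have -> : (\esum_(n in [set: int]) \int[mu]_(t in `[(n%:~R * a)%R, (n%:~R * a + a)%R[) g t =
  \esum_(n in [set: int]) \sum_(j < N)
    \int[mu]_(t in `[(n%:~R * a + j%:R * c)%R, (n%:~R * a + j%:R * c + c)%R[) g t)%E.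
  by apply: eq_esum => n _; rewrite integral_adjacent// cN.
rewrite esum_sum; last by move=> *; exact: integral_ge0.
under eq_bigr => j _ do rewrite translates_mass ?c0//.
rewrite sumEFin sumr_const card_ord -[_ *+ N]mulr_natl => -[<-].
by rewrite mulrCA cN mulrC.
Qed.

End ParsevalWindowNorm.

(** * Operators on functions and on classes *)

Section OperatorsOnRepresentatives.
Variable R : realType.
Local Notation H := (L2hilbert R).
Local Notation rep x := (val (x : L2space R)).
Local Notation clsH f := (cls f : H).
Implicit Types (f g : R -> R[i]) (T S W : (R -> R[i]) -> (R -> R[i])).
Implicit Types (That Shat Vhat What Zhat : {linear H -> H}).

(** Maps obtained by [xget] are known only up to almost everywhere equality; the algebra is carried
    by the linear operator that they induce on classes. *)
Definition represents T That := forall f, L2 f -> L2 (T f) /\ clsH (T f) = That (clsH f).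

Lemma cls_rep (x : H) : clsH (rep x) = x. Proof. exact: valK'. Qed.

Lemma L2_rep (x : H) : L2 (rep x). Proof. exact: L2_val. Qed.

Lemma represents_rep That : represents (fun f => rep (That (clsH f))) That.
Proof. by move=> f Lf; split; [exact: L2_rep | exact: cls_rep]. Qed.

Lemma clsH_linear (c : R[i]) f g : L2 f -> L2 g ->
  clsH (fun t => c * f t + g t) = c *: clsH f + clsH g.
Proof. exact: cls_linear. Qed.

Lemma represents_bounded_operator T That M : op_bounded_by M That ->
  represents T That -> bounded_operator T.
Proof.
move=> bT TT; split.
- by move=> f /TT[].
- move=> c f g Lf Lg; have Lfg := L2_linear c Lf Lg.
  have [L1 E1] := TT _ Lfg; have [L2 E2] := TT _ Lf; have [L3 E3] := TT _ Lg.
  apply: cls_inj => //; first exact: L2_linear.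
  by rewrite -/(clsH _) E1 clsH_linear// linearD linearZ/= -E2 -E3 -clsH_linear.
- exists M => f Lf; have [L1 E1] := TT _ Lf.
  by rewrite (L2norm_cls L1) (L2norm_cls Lf) E1 -EFinM lee_fin.
Qed.

(** Boundedness makes [T] compatible with classes: if [f] and [g] agree almost everywhere, then
    [g - f] has norm 0, hence so has its image, which by linearity is the difference of the
    images. *)
Lemma bounded_operator_represents T : bounded_operator T ->
  exists That M, [/\ 0 <= M, op_bounded_by M That & represents T That].
Proof.
move=> [LT linT [M bT]].
have cls_T f g : L2 f -> L2 g -> ae_equal f g -> clsH (T f) = clsH (T g).
  move=> Lf Lg /ae_equal_sub fg; apply: cls_eq; try exact: LT.
  apply/ae_equal_sub; apply: ae_equal_trans (ae_equal_sym (linT (-1) _ _ Lf Lg)) _.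
  have Lfg := L2_linear (-1) Lf Lg.
  apply/ae_equal_L2norm0; first exact: LT.
  have /(ae_equal_L2norm0 Lfg) fg0 := fg.
  have := bT _ Lfg; rewrite (L2norm_cls Lfg) (L2norm_cls (LT _ Lfg)) lee_fin.
  rewrite -(dot_cls (LT _ Lfg) (LT _ Lfg)) -/(sqnorm _) -hnorm_sqr.
  have -> : hnorm (clsH (fun t => -1 * f t + g t)) = 0.
    by apply/eqP; rewrite -sqrf_eq0 hnorm_sqr /sqnorm dot_cls// fg0.
  rewrite mulr0 => h; have -> : hnorm (clsH (T (fun t => -1 * f t + g t))) = 0.
    by apply/eqP; rewrite eq_le h hnorm_ge0.
  by rewrite expr0n.
pose F (x : H) := clsH (T (rep x)).
have linF c x y : F (c *: x + y) = c *: F x + F y.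
  have Lx := L2_rep x; have Ly := L2_rep y.
  rewrite /F -(clsH_linear c (LT _ Lx) (LT _ Ly)).
  rewrite (_ : clsH (T (rep (c *: x + y))) = clsH (T (fun t => c * rep x t + rep y t))).
    apply: cls_eq; [exact/LT/L2_linear|exact/L2_linear/LT/Ly/LT|exact: linT].
  apply: cls_T; [exact: L2_rep|exact: L2_linear|].
  apply: cls_inj; [exact: L2_rep|exact: L2_linear|].
  by rewrite -/(clsH _) cls_rep -/(clsH _) clsH_linear// !cls_rep.
have [That TE] := exists_linear linF.
exists That, `|M|; split=> //.
  move=> x; rewrite TE -lee_fin EFinM -(L2norm_cls (LT _ (L2_rep x))).
  rewrite -[x in leRHS]cls_rep -(L2norm_cls (L2_rep x)).
  apply: le_trans (bT _ (L2_rep x)) _.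
  by rewrite (L2norm_cls (L2_rep x)) -!EFinM lee_fin ler_wpM2r ?hnorm_ge0// ler_norm.
move=> f Lf; split; first exact: LT.
rewrite TE /F; apply: cls_T => //; first exact: L2_rep.
by apply: ae_equal_sym; exact: val_cls.
Qed.

(** [Vhat] provides a witness, so the chosen map does satisfy [is_inverse]; cancelling [Shat] then
    forces its action on classes to be [Vhat]. *)
Lemma op_inv_represents S Shat Vhat M : represents S Shat ->
  cancel Shat Vhat -> cancel Vhat Shat -> op_bounded_by M Vhat ->
  represents (op_inv S) Vhat.
Proof.
move=> SS SV VS bV.
have [bT TP] : is_inverse S (op_inv S).
  apply: (@xgetPex _ (idfun : (R -> R[i]) -> (R -> R[i])) [set T | is_inverse S T]).
  exists (fun f => rep (Vhat (clsH f))).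
  split; first exact: represents_bounded_operator bV (represents_rep _).
  move=> f Lf; split; apply: cls_inj => //; try exact: L2_rep.
  - by have [] := SS _ (L2_rep (Vhat (clsH f))).
  - have [_] := SS _ (L2_rep (Vhat (clsH f))); rewrite -/(clsH _) => ->.
    by rewrite cls_rep VS.
  - rewrite -/(clsH _) cls_rep; have [_ ->] := SS _ Lf; exact: SV.
have [LT _ _] := bT.
move=> f Lf; split; first exact: LT.
have [h _] := TP f Lf; have [LST E] := SS _ (LT _ Lf).
by rewrite -[RHS](congr1 Vhat (cls_eq LST Lf h : clsH _ = clsH _)) E SV.
Qed.

(** As for the inverse, [Zhat] shows that the choice is not the default. The chosen map descends to
    classes, where uniqueness of the positive root identifies it. *)
Lemma op_sqrt_represents W What Zhat m m' : represents W What -> 0 < m < m' ->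
  symmetric_op Zhat -> (forall x, Zhat (Zhat x) = What x) -> op_between m m' Zhat ->
  (forall (T : {linear H -> H}) M, 0 <= M -> op_bounded_by M T ->
     (forall x, T (What x) = What (T x)) -> forall x, T (Zhat x) = Zhat (T x)) ->
  represents (op_sqrt W) Zhat.
Proof.
move=> WW /[dup] mm /andP[m0 _] sZ ZZ bZ Zcomm.
have bZ' := between_op_bounded mm sZ bZ.
have [bT pT TT] : is_positive_sqrt W (op_sqrt W).
  apply: (@xgetPex _ (idfun : (R -> R[i]) -> (R -> R[i])) [set T | is_positive_sqrt W T]).
  have RZ := represents_rep Zhat; exists (fun f => rep (Zhat (clsH f))).
  split; first exact: represents_bounded_operator bZ' RZ.
  - move=> f Lf; have [L1 E1] := RZ _ Lf; rewrite -(dot_cls L1 Lf) E1.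
    have /andP[h _] := bZ (clsH f).
    have : 0 <= complex.Re (dot (Zhat (clsH f)) (clsH f)).
      by apply: le_trans h; rewrite mulr_ge0 ?sqnorm_ge0 ?(ltW m0).
    (* Positivity in [R[i]] also demands a zero imaginary part; symmetry supplies it, the value
       being its own conjugate. *)
    have := dotC (Zhat (clsH f)) (clsH f); rewrite -sZ; case: (dot _ _) => x y /= [/eqP].
    by rewrite -addr_eq0 -mulr2n mulrn_eq0/= => /eqP ->; rewrite lecE/= eqxx.
  - move=> f Lf; have [L1 E1] := RZ _ Lf; have [L2' E2] := RZ _ L1; have [L3 E3] := WW _ Lf.
    apply: cls_inj => //.
    by rewrite -/(clsH _) E2 E1 ZZ -E3.
have [That [M [M0 bThat RT]]] := bounded_operator_represents bT.
have TZ : forall x, That x = Zhat x.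
  apply: (between_sqrt_unique m0 ZZ bZ Zcomm M0 bThat).
    move=> x; have Lx := L2_rep x; have [L1 E1] := RT _ Lx.
    by rewrite -[x]cls_rep -E1 (dot_cls L1 Lx) pT.
  move=> x; have Lx := L2_rep x; have [L1 E1] := RT _ Lx; have [L2' E2] := RT _ L1.
  have [L3 E3] := WW _ Lx.
  rewrite -[x]cls_rep -E1 -E2 -E3; apply: cls_eq => //; exact: TT.
by move=> f /RT[L1 ->]; rewrite TZ.
Qed.

End OperatorsOnRepresentatives.

(** * Gabor systems as frames of classes *)

Section GaborSystems.
Variables (R : realType) (a b : R).
Local Notation H := (L2hilbert R).
Local Notation U := (tfs_op a b).
Local Notation clsH f := (cls f : H).
Implicit Types (f g : R -> R[i]) (x : H).

Lemma coef_cls g f p : L2 g -> L2 f ->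
  coef g a b f p = dot (clsH f) (orbit_of U (clsH g) p).
Proof.
by move=> Lg Lf; rewrite /orbit_of tfs_op_cls// (dot_cls Lf (L2_tfs _ _ _ Lg)).
Qed.

Lemma frame_energy_cls g f : L2 g -> L2 f -> frame_energy g a b f =
  (\esum_(p in [set: int * int])
     (Normc.normc (dot (clsH f) (orbit_of U (clsH g) p)) ^+ 2)%:E)%E.
Proof. by move=> Lg Lf; apply: eq_esum => p _; rewrite coef_cls. Qed.

Lemma frame_residual_cls g f h (F : {fset int * int}) : L2 g -> L2 f -> L2 h ->
  L2norm (fun t => (h t - \sum_(p <- F) coef g a b f p *
    modulated_shift g a b p.1 p.2 t)%R) =
  (hnorm (clsH h - frame_sum (orbit_of U (clsH g)) F (clsH f)))%:E.
Proof.
move=> Lg Lf Lh.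
pose e p t := coef g a b f p * modulated_shift g a b p.1 p.2 t.
have Le p : L2 (e p) by exact/L2_scale/L2_tfs.
have [Ls Es] := cls_sum F Le.
rewrite (L2norm_cls (L2_sub Lh Ls)) (cls_sub Lh Ls) Es; congr (hnorm (_ - _))%:E.
apply: eq_bigr => p _; rewrite /e cls_scale; last exact: L2_tfs.
by rewrite coef_cls// /orbit_of tfs_op_cls.
Qed.

Lemma frame_series_cls g f h : L2 g -> L2 f -> L2 h ->
  is_frame_series g a b f h <-> frame_limit (orbit_of U (clsH g)) (clsH f) (clsH h).
Proof.
move=> Lg Lf Lh; split=> [[_ lim] e e0|lim].
  have [F0 FP] := lim e e0; exists F0 => F /FP.
  by rewrite frame_residual_cls// lte_fin.
split=> // e e0; have [F0 FP] := lim e e0; exists F0 => F /FP.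
by rewrite frame_residual_cls// lte_fin.
Qed.

Lemma frame_operator_represents g (S : {linear H -> H}) : L2 g ->
  (forall x, frame_limit (orbit_of U (clsH g)) x (S x)) ->
  represents (frame_operator g a b) S.
Proof.
move=> Lg SP f Lf.
have FP : is_frame_series g a b f (frame_operator g a b f).
  apply: (xgetPex (fun=> 0) (P := [set h | is_frame_series g a b f h])).
  exists (val (S (clsH f) : L2space R)).
  by apply/frame_series_cls => //; [exact: L2_rep | rewrite cls_rep].
have [LF _] := FP; split=> //.
by apply: frame_limit_unique (SP _); apply/frame_series_cls.
Qed.

Lemma gabor_frame_between g (S : {linear H -> H}) (m M : R) : L2 g -> 0 < m < M ->
  (forall x, frame_limit (orbit_of U (clsH g)) x (S x)) -> op_between m M S ->
  gabor_frame g a b.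
Proof.
move=> Lg /andP[m0 mM] SP bS; split=> //; exists m, M; split=> // [|f Lf].
  exact: lt_trans mM.
rewrite frame_energy_cls// (esum_frame_limit (SP _)) (L2norm_cls Lf).
rewrite -EFin_expe -!EFinM !lee_fin hnorm_sqr.
by have /andP[-> ->] := bS (clsH f).
Qed.

(** The upper frame bound is a Bessel bound and so produces the frame operator; the frame energy is
    then its quadratic form. *)
Lemma frame_bounds_between g (A B : R) : L2 g -> frame_bounds g a b A B ->
  exists S : {linear H -> H}, [/\ forall x, frame_limit (orbit_of U (clsH g)) x (S x),
    symmetric_op S & op_between A B S].
Proof.
move=> Lg [A0 B0 AB].
have energy x : ((A * sqnorm x)%:E <= \esum_(p in [set: int * int])
     (Normc.normc (dot x (orbit_of U (clsH g) p)) ^+ 2)%:E <= (B * sqnorm x)%:E)%E.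
  have Lx := L2_rep x; have := AB _ Lx.
  rewrite frame_energy_cls// (L2norm_cls Lx) -EFin_expe hnorm_sqr -!EFinM.
  by rewrite -[cls _]/(clsH _) !cls_rep => -[-> ->].
have gB : bessel B (orbit_of U (clsH g)).
  by apply: bessel_esum => x; have /andP[] := energy x.
have [S SP] := frame_operator_exists B0 gB.
exists S; split=> // [x y|x]; first exact: frame_limit_symmetric (SP x) (SP y).
by have := energy x; rewrite (esum_frame_limit (SP x)) !lee_fin.
Qed.

Lemma normalize_cls f : L2 f -> L2 (normalize f) /\
  clsH (normalize f) = (hnorm (clsH f))^-1%:C *: clsH f.
Proof.
move=> Lf; have E : normalize f = (fun t => (hnorm (clsH f))^-1%:C * f t).
  by apply/funext => t; rewrite /normalize (L2norm_cls Lf)/= mulrC -fmorphV.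
by rewrite E; split; [exact: L2_scale | exact: cls_scale].
Qed.

End GaborSystems.

(** * The window iteration *)

Section WindowIteration.
Variables (R : realType) (a b : R).
Local Notation H := (L2hilbert R).
Local Notation U := (tfs_op a b).
Local Notation clsH f := (cls f : H).
Variable h : H.
Hypothesis h_parseval : forall x, frame_limit (orbit_of U h) x x.
Hypothesis h_neq0 : h != 0.

Lemma window_iteration_step (g : R -> R[i]) (k : R) :
  let next t := 2^-1 * (normalize g t + normalize (dual_window g a b) t) in
  1 < k -> L2 g -> window_state U h k (clsH g) ->
  [/\ gabor_frame g a b, L2 next, window_state U h ((k + k^-1) / 2) (clsH next) &
      hnorm (clsH next - (hnorm h)^-1%:C *: h) <= k - 1].
Proof.
move=> next k1 Lg [Z [V [m [M [[mM kE gE] sZ bZ cZ [ZV VZ]]]]]].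
have /andP[m0 mltM] := mM; have M0 := lt_trans m0 mltM.
pose S : {linear H -> H} := Z \o Z.
have SP x : frame_limit (orbit_of U (clsH g)) x (S x).
  by rewrite gE; exact: (window_frame_limit h_parseval x mM sZ bZ cZ).
have bS : op_between (m ^+ 2) (M ^+ 2) S.
  move=> x; rewrite (_ : dot _ _ = dot (Z x) (Z x)) -/(sqnorm _); last exact: sZ.
  exact: between_sqr.
have mM2 : 0 < m ^+ 2 < M ^+ 2.
  by rewrite exprn_gt0//= ltr_pXn2r ?nnegrE ?(ltW m0) ?(ltW M0).
have [vv sV bV] := inverse_between mM sZ bZ ZV VZ.
have bV' := between_op_bounded vv sV bV.
have mi : 0 <= m^-1 by rewrite invr_ge0 ltW.
have [Ld dE] : L2 (dual_window g a b) /\ clsH (dual_window g a b) = V h.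
  have RS := frame_operator_represents Lg SP.
  have SV : cancel S (V \o V) by move=> x; rewrite /S /= !ZV.
  have VS : cancel (V \o V) S by move=> x; rewrite /S /= !VZ.
  have [//|L1 E1] := op_inv_represents RS SV VS (op_bounded_comp mi bV' bV') (f := g).
  by split=> //; rewrite E1 gE /= ZV.
have [L1 E1] := normalize_cls Lg; have [L2' E2] := normalize_cls Ld.
have nextE : clsH next = newton_map Z V h h.
  rewrite /next [LHS](cls_scale _ (L2_add L1 L2')) [X in _ *: X](cls_add L1 L2').
  rewrite [X in _ *: (X + _)]E1 [X in _ *: (_ + X)]E2 gE dE /newton_map/=.

  rewrite (_ : 2^-1 = (2^-1)%:C :> R[i]); last by rewrite fmorphV rmorph_nat.
  by [].
have [st err] := window_step h_neq0 k1 mM kE sZ bZ cZ ZV VZ.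
split.
- exact: gabor_frame_between mM2 SP bS.
- exact/L2_scale/L2_add.
- by rewrite nextE.
- by rewrite nextE.
Qed.

End WindowIteration.

(** * Recursion for the condition numbers *)

Section ConditionNumbers.
Variables (R : realType) (k0 : R).
Hypothesis k0_gt1 : 1 < k0.

Fixpoint condition_number n : R :=
  if n is n'.+1 then (condition_number n' + (condition_number n')^-1) / 2 else k0.
Local Notation kap := condition_number.

Lemma condition_number_gt1 n : 1 < kap n.
Proof.
elim: n => //= n IH; have K0 : 0 < kap n by rewrite (lt_trans _ IH).
rewrite ltr_pdivlMr// mul1r -subr_gt0 (_ : _ - _ = (kap n - 1) ^+ 2 / kap n).
  by rewrite divr_gt0// exprn_gt0// subr_gt0.
by field; rewrite gt_eqF.
Qed.

Lemma condition_number_step n : kap n.+1 - 1 = (kap n - 1) ^+ 2 / (2 * kap n).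
Proof.
have K0 : 0 < kap n by rewrite (lt_trans _ (condition_number_gt1 n)).
by rewrite /=; field; rewrite gt_eqF.
Qed.

Lemma condition_number_quadratic n : kap n.+1 - 1 <= (kap n - 1) ^+ 2.
Proof.
have K1 := condition_number_gt1 n.
rewrite condition_number_step ler_pdivrMr ?mulr_gt0 ?(lt_trans _ K1)//.
by rewrite ler_peMr ?sqr_ge0//; lra.
Qed.

(** The quadratic estimate gives no decay while [kap n >= 2]. The factor (kappa - 1) / (2 kappa) <=
    1/2 does, from any starting value. *)
Lemma condition_number_geometric n : kap n - 1 <= (k0 - 1) * 2^-1 ^+ n.
Proof.
elim: n => [|n IH]; first by rewrite expr0 mulr1.
have K1 := condition_number_gt1 n.
have h : kap n.+1 - 1 <= 2^-1 * (kap n - 1).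
  rewrite condition_number_step ler_pdivrMr ?mulr_gt0 ?(lt_trans _ K1)//.
  rewrite (_ : _ * (2 * _) = (kap n - 1) * kap n); last by field.
  by rewrite expr2 ler_wpM2l ?subr_ge0 ?(ltW K1)//; lra.
rewrite (le_trans h)// exprS mulrCA ler_wpM2l// invr_ge0//.
Qed.

Lemma condition_number_cvg : (fun n => kap n - 1) @ \oo --> (0 : R).
Proof.
apply: (@squeeze_cvgr _ _ _ _ (cst 0) (fun n => (k0 - 1) * 2^-1 ^+ n)).
- apply: nearW => n; rewrite condition_number_geometric andbT subr_ge0 ltW//.
  exact: condition_number_gt1.
- exact: cvg_cst.
- rewrite -[X in _ --> X](mulr0 (k0 - 1)); apply: cvgM; first exact: cvg_cst.
  by apply: cvg_expr; rewrite ger0_norm ?invr_ge0// invf_lt1// ltr1n.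
Qed.

End ConditionNumbers.

Theorem theorem4p2 (R : realType) (a b A B : R) (g : R -> R[i])
    (a_gt0 : 0 < a) (b_gt0 : 0 < b)
    (frame_g : gabor_frame g a b)
    (optimal_AB : optimal_frame_bounds g a b A B) :
  (forall k : nat, gabor_frame (window_iter g a b k) a b) /\
  converges_quadratically (window_iter g a b)
    (fun t => (1 / Num.sqrt (a * b))%:C * tight_window g a b t).
Proof.
have [Lg _] := frame_g; have [ABg _] := optimal_AB.
pose H := L2hilbert R; pose U := tfs_op a b.
pose clsH f := cls f : H; pose gam := clsH g.
have [S [SP sS bS]] := frame_bounds_between Lg ABg.
have [A0 B0 _] := ABg.
(* A tight frame has [A = B]; enlarging the upper bound secures the strict inequality that the
   operator lemmas require. *)
have {}bS : op_between A (A + B) S.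
  move=> x; have /andP[-> h] := bS x; rewrite (le_trans h)// ler_wpM2r ?sqnorm_ge0//.
  by rewrite lerDr ltW.
have AB : 0 < A < A + B by rewrite A0 ltrDl.
have [V [SV VS]] := between_inverse AB sS bS.
have [vv sV bV] := inverse_between AB sS bS SV VS.
have [T [t [t' [tt sT TT bT Tcomm]]]] := between_sqrt vv sV bV.
pose h := T gam.
have cS : commutes_with_orbit U S.
  exact: (frame_operator_commutes (@tfs_op_iso R a b) (@tfs_op_add R a b) SP).
have cV : commutes_with_orbit U V.
  by move=> p x; rewrite -{1}[x]VS -cS SV.
have cT : commutes_with_orbit U T.
  (* Shifts are isometries, hence bounded by 1, so the commutation clause of the square root applies
     to them. *)
  move=> p x; apply/esym; apply: (Tcomm (U p) 1 ler01) => y; last by rewrite cV.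
  by rewrite mul1r (hnorm_orbit (@tfs_op_iso R a b)).
have TS x : T (S x) = S (T x).
  have TV y : T (V y) = V (T y) by rewrite -!TT.
  by rewrite -{2}[x]SV TV VS.
have TST x : T (S (T x)) = x by rewrite TS TT VS.
have bT' := between_op_bounded tt sT bT.
have t'0 : 0 <= t' by case/andP: tt => t0 /(lt_trans t0)/ltW.
have h_parseval x : frame_limit (orbit_of U h) x x.
  by rewrite -{2}[x]TST; exact: (frame_limit_map sT t'0 bT' cT (SP _)).
have hab : sqnorm h = a * b by exact: parseval_window_sqnorm.
have hnE : hnorm h = Num.sqrt (a * b) by rewrite /hnorm hab.
have h_neq0 : h != 0 by rewrite -sqnorm_eq0 hab mulf_neq0 ?gt_eqF.
(* [T] is S^(-1/2), so [Z] is S^(1/2), with inverse [T] and [Z h = g]. Its form bounds come from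
   those of [T] by inversion, and their ratio is the initial condition number. *)
pose Z : {linear H -> H} := S \o T.
have TZ : cancel T Z by move=> x; rewrite /Z/= TT VS.
have ZT : cancel Z T by move=> x; rewrite /Z/= TST.
have [zz sZ bZ] := inverse_between tt sT bT TZ ZT.
set m := t / t' ^+ 2 in zz bZ; set M := t^-1 in zz bZ.
pose k0 := M / m.
have k0_gt1 : 1 < k0 by have /andP[m0 mM] := zz; rewrite ltr_pdivlMr// mul1r.
have st0 : window_state U h k0 (clsH (window_iter g a b 0)).
  exists Z, T, m, M; split=> //.
    by split=> //; rewrite /h /Z/= TT VS.
  by move=> p x; rewrite /Z/= cT cS.
pose kap := condition_number k0.
have state k : L2 (window_iter g a b k) /\
    window_state U h (kap k) (clsH (window_iter g a b k)).
  elim: k => [//|k [Lk stk]].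
  by have [] := window_iteration_step h_parseval h_neq0 (condition_number_gt1 k0_gt1 k) Lk stk.
have error k : hnorm (clsH (window_iter g a b k.+1) - (hnorm h)^-1%:C *: h) <= kap k - 1.
  have [Lk stk] := state k.
  by have [] := window_iteration_step h_parseval h_neq0 (condition_number_gt1 k0_gt1 k) Lk stk.
split.
  move=> k; have [Lk stk] := state k.
  by have [] := window_iteration_step h_parseval h_neq0 (condition_number_gt1 k0_gt1 k) Lk stk.
have [Lt tE] : L2 (tight_window g a b) /\ clsH (tight_window g a b) = h.
  have RV := op_inv_represents (frame_operator_represents Lg SP) SV VS (between_op_bounded vv sV bV).
  exact: (op_sqrt_represents RV tt sT TT bT Tcomm Lg).
set u := (fun t => _ * _).
have Lu : L2 u by exact: L2_scale.
have uE : clsH u = (hnorm h)^-1%:C *: h.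
  by rewrite /clsH /u cls_scale// -/(clsH _) hnE -tE div1r.
(* The condition number of step [k'] controls the error of step [k'.+1], hence the shift. [eps 0]
   must dominate the distance of the given, unnormalized window; the maximum with 1 ensures
   [k0 - 1 <= k0 * eps 0 ^+ 2], which is why [k0] serves as the constant. *)
pose eps k := if k is k'.+1 then kap k' - 1
  else Num.max 1 (hnorm (gam - (hnorm h)^-1%:C *: h)).
exists k0, eps; split.
- case=> [|k] /=; first by rewrite le_max ler01.
  by rewrite subr_ge0 ltW// condition_number_gt1.
- by rewrite -(cvg_shiftS eps); exact: condition_number_cvg.
- case=> [|k] /=.
    have e1 : 1 <= eps 0%N by rewrite le_max lexx.
    rewrite (le_trans (_ : _ <= k0)) ?gerBl// ler_peMr ?(ltW (lt_trans ltr01 k0_gt1))//.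
    by rewrite expr2 mulr_ege1.
  rewrite (le_trans (condition_number_quadratic k0_gt1 k))//.
  by rewrite ler_peMl ?sqr_ge0// ltW.
- move=> k; have [Lk _] := state k.
  rewrite (L2norm_cls (L2_sub Lk Lu)) (cls_sub Lk Lu) lee_fin.
  rewrite -/(clsH _) -/(clsH u) uE; case: k Lk => [|k] Lk; last exact: error.
  by rewrite le_max lexx orbT.
Qed.
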